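(* Let $R$ be a rational function such that its Newton map $N_R(z)=z-\frac{R(z)}{R'(z)}$ is quadratic (i.e. a rational function of degree $2$). Then $N_R$ is conformally conjugate either to $$N_1(z)=z-\frac{1}{\frac{d_1}{z}+\frac{d_2}{z-1}}\quad\text{for some natural numbers } d_1,d_2,$$ or to $$N_2(z)=z+\frac{1}{\frac{e_1}{z}+\frac{e_2}{z-1}}\quad\text{for some natural numbers } e_1,e_2.$$ Moreover: 1. If $N_R$ is conformally conjugate to such a map $N_1$, then the Fatou set of $N_R$ is the union of two completely invariant attracting domains and the Julia set of $N_R$ is a Jordan curve. 2. If $N_R$ is conformally conjugate to such a map $N_2$, then the Fatou set of $N_R$ is equal to a completely invariant attracting domain and the Julia set of $N_R$ is totally disconnected. In particular, the Julia set of $N_R$ is either a Jordan curve or totally disconnected.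
   Context: Natural numbers are positive integers. All rational functions are regarded as self-maps of the extended complex plane $\widehat{\mathbb{C}}=\mathbb{C}\cup\{\infty\}$. Two rational functions $f_1,f_2$ are conformally conjugate if $f_1=\phi\circ f_2\circ\phi^{-1}$ for some Möbius map $\phi$. For a rational function $f$ of degree at least two, the Fatou set $\mathcal{F}(f)$ is the set of points of $\widehat{\mathbb{C}}$ having a neighbourhood on which $\{f^n\}_{n>0}$ is a normal family; the Julia set $\mathcal{J}(f)$ is its complement in $\widehat{\mathbb{C}}$. The multiplier of a fixed point $z_0$ of $f$ is $f'(z_0)$ if $z_0\in\mathbb{C}$, and $g'(0)$ with $g(z)=1/f(1/z)$ if $z_0=\infty$; the fixed point is attracting if its multiplier has absolute value less than $1$. A connected component $U$ of the Fatou set of $f$ is an invariant attracting domain if it contains an attracting fixed point of $f$; it is completely invariant if moreover $f^{-1}(U)\subseteq U$. A set is totally disconnected if each of its connected components is a singleton. *)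

(* Defs.v *)
From HB Require Import structures.
From mathcomp Require Import all_boot all_order all_algebra.
From mathcomp Require Import all_classical all_reals all_analysis.
From mathcomp Require Import complex.

Set Implicit Arguments.
Unset Strict Implicit.
Unset Printing Implicit Defensive.

Import Order.TTheory GRing.Theory Num.Theory.
Import numFieldNormedType.Exports.

Local Open Scope classical_set_scope.
Local Open Scope ring_scope.
Local Open Scope complex_scope.

(* R[i] receives the topology and normed-module structure that every
   numFieldType carries. *)
HB.instance Definition _ (R : realType) :=
  PseudoPointedMetric.copy R[i] (R[i] : numFieldType).
HB.instance Definition _ (R : realType) :=
  NormedModule.copy R[i] (R[i] : numFieldType).

(* Some z is the finite point z, None is infinity. *)
Notation sphere R := (one_point_compactification R[i]).

Notation ratfun R := {fraction {poly R[i]}}.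

Section RationalFunctions.
Context {R : realType}.
Implicit Types (r : ratfun R) (f : sphere R -> sphere R).

(* Lowest terms, up to a common nonzero constant factor. *)
Definition rnum r : {poly R[i]} :=
  let x := generic_quotient.repr r in x.1 %/ gcdp x.1 x.2.
Definition rden r : {poly R[i]} :=
  let x := generic_quotient.repr r in x.2 %/ gcdp x.1 x.2.

Definition rdegree r : nat := (maxn (size (rnum r)) (size (rden r))).-1.

Definition rderiv r : ratfun R :=
  tofrac ((rnum r)^`() * rden r - rnum r * (rden r)^`())
  / tofrac (rden r ^+ 2).

(* At infinity the value is the ratio of the coefficients of degree
   deg (rden r); this is 0 when the degree of the numerator is smaller. *)
Definition rmap r : sphere R -> sphere R := fun x =>
  match x with
  | Some z => if (rden r).[z] == 0 then None
              else Some ((rnum r).[z] / (rden r).[z])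
  | None => if (size (rden r) < size (rnum r))%N then None
            else Some ((rnum r)`_(size (rden r)).-1 / lead_coef (rden r))
  end.

Definition is_mobius f : Prop :=
  exists a b c d : R[i], a * d - b * c != 0 /\
    f = rmap (tofrac (a *: 'X + b%:P) / tofrac (c *: 'X + d%:P)).

Definition conformally_conjugate f1 f2 : Prop :=
  exists phi psi : sphere R -> sphere R,
    [/\ is_mobius phi, cancel phi psi, cancel psi phi
      & f1 = phi \o f2 \o psi].

Definition newton r : ratfun R := tofrac 'X - r / rderiv r.

Definition newton1 (d1 d2 : nat) : ratfun R :=
  tofrac 'X - 1 / (d1%:R / tofrac 'X + d2%:R / (tofrac 'X - 1)).

Definition newton2 (e1 e2 : nat) : ratfun R :=
  tofrac 'X + 1 / (e1%:R / tofrac 'X + e2%:R / (tofrac 'X - 1)).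

End RationalFunctions.

Section Dynamics.
Context {R : realType}.
Implicit Types (x y z : sphere R) (f : sphere R -> sphere R).
Implicit Types (U V A : set (sphere R)).

Definition chordal x y : R :=
  match x, y with
  | Some z, Some w =>
      2 * Normc.normc (z - w) /
      (Num.sqrt (1 + Normc.normc z ^+ 2) * Num.sqrt (1 + Normc.normc w ^+ 2))
  | Some z, None | None, Some z => 2 / Num.sqrt (1 + Normc.normc z ^+ 2)
  | None, None => 0
  end.

Definition cvg_uniformly_on V (u : nat -> sphere R -> sphere R) g : Prop :=
  forall eps : R, 0 < eps ->
    \forall n \near \oo, forall x, V x -> chordal (u n x) (g x) < eps.

Definition cvg_locally_uniformly_on U (u : nat -> sphere R -> sphere R) g :
    Prop :=
  forall x, U x -> exists2 V, nbhs x V & cvg_uniformly_on (U `&` V) u g.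

Definition normal_family U (F : set (sphere R -> sphere R)) : Prop :=
  forall u : nat -> sphere R -> sphere R, (forall n, F (u n)) ->
    exists s : nat -> nat, {homo s : m n / (m < n)%N} /\
      exists g, cvg_locally_uniformly_on U (u \o s) g.

Definition iterates f : set (sphere R -> sphere R) :=
  [set iter n f | n in [set n | (0 < n)%N]].

Definition fatou_set f : set (sphere R) :=
  [set x | exists2 U, open_nbhs x U & normal_family U (iterates f)].

Definition julia_set f : set (sphere R) := ~` fatou_set f.

Definition sinv x : sphere R :=
  match x with
  | Some z => if z == 0 then None else Some z^-1
  | None => Some 0
  end.

(* The junk value at infinity does not matter: at a fixed point, the maps
   differentiated in multiplier are finite nearby when f is rational. *)
Definition finite_part x : R[i] := odflt 0 x.

Definition multiplier f x : R[i] :=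
  match x with
  | Some z => derive1 (fun w : R[i] => finite_part (f (Some w))) z
  | None => derive1 (fun w : R[i] => finite_part (sinv (f (sinv (Some w))))) 0
  end.

Definition attracting_fixed_point f x : Prop :=
  f x = x /\ `|multiplier f x| < 1.

Definition fatou_component f U : Prop :=
  exists2 x, fatou_set f x & U = connected_component (fatou_set f) x.

Definition invariant_attracting_domain f U : Prop :=
  fatou_component f U /\ exists2 x, U x & attracting_fixed_point f x.

Definition completely_invariant_attracting_domain f U : Prop :=
  invariant_attracting_domain f U /\ f @^-1` U `<=` U.

Definition jordan_curve A : Prop :=
  let circle := [set z : R[i] | `|z| = 1] in
  exists gamma : R[i] -> sphere R,
    [/\ {within circle, continuous gamma}, set_inj circle gamma
      & gamma @` circle = A].

End Dynamics.

(* Main.v *)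
Require Import Defs.
From HB Require Import structures.
From mathcomp Require Import all_boot all_order all_algebra.
From mathcomp Require Import all_classical all_reals all_analysis.
From mathcomp Require Import complex.
From mathcomp Require Import zify.
From mathcomp Require Import ring lra.

(** The Newton map N of r moves z by minus the reciprocal of the logarithmic
    derivative r'/r, which is a sum of terms m/(z - a) with nonzero integers m,
    the orders of r at its zeros and poles. The points a are the fixed points
    of N in the plane. If N is quadratic there are three fixed points on the
    sphere, and a Mobius map brings them to 0, 1 and oo; N becomes
    z - 1/(m/z + n/(z - 1)), where m, n and 1 - m - n are nonzero integers
    attached to 0, 1 and oo in a way that permuting the fixed points permutes
    them. Three nonzero integers of sum 1 have signs (+,+,-) or (+,-,-), and
    putting the two of equal sign at 0 and 1 gives the two normal forms
    ([newton_classification]). A fixed point of weight m has multiplier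
    1 - 1/m, so positive weights are attracting and negative ones repelling.

    The Fatou and Julia sets are then found from the dynamics, with
    [dichotomy_julia] as criterion: K is the Julia set as soon as K is
    invariant, has dense complement, is separated from two points a and b, and
    every point off K has a neighbourhood that converges uniformly to a or b.
    The Fatou set is the union of the two basins, which are components once
    they are connected. All these data are carried along by conjugation.

    For two negative weights the map is z + 1/(a/z + b/(z - 1)) with a, b > 0.
    By the Cauchy-Schwarz inequality it multiplies Im z by at least
    1 + 1/(a + b), and it pushes real points outside [0,1] away, so everything
    escapes to oo except the points whose orbit stays in [0,1]. This set is
    totally disconnected, because the map expands every interval that does not
    contain its pole; the basin of oo is connected, because it contains all
    vertical rays off the real axis.

    For two positive weights the map is conjugate to
    f(z) = (a z^2 + p)/(t z^2 + d) with 0 <= t <= p < 1, critical points 0 and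
    oo, attracting fixed points p and 1/t and repelling fixed point 1
    ([normal_form_parameters], [wmap_gmap]). Since f(z) = f(-z) and f commutes
    with conjugation, the dynamics can be folded to the upper half-plane, where
    f has two inverse branches: one with values in the first quadrant, and its
    reflection in the imaginary axis. The unit disc lies in the basin of p and
    the exterior of a disc in the basin of 1/t; both basins are increasing
    unions of preimages of these discs, each connected because both branches
    send the critical value to the critical point.

    What remains is the set K of points whose orbit stays in the closed annulus
    in between. In the coordinate z/(1 - t z) the map expands distances between
    nearby points of the annulus by a definite factor ([expansion]), and small
    steps add up to a uniform contraction by long words in the branches
    ([branches_contract]). Pulling back a path from 1 to -1 repeatedly by the
    two branches therefore converges uniformly to a path k from 1 to -1 with
    k(s/2) = g(k(s)) and k(1 - s/2) the reflection of g(k(s)), where g is the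
    branch in the first quadrant ([invariant_curve]). By contraction k passes
    through every point of K in the closed upper half-plane. It is injective,
    because equal values at two parameters remain equal when both are doubled,
    until the parameters lie in different halves of [0,1]; and it meets the real
    axis only at its end points. Together with its mirror image it is a Jordan
    curve equal to K ([trapped_jordan]). *)

Set Implicit Arguments.
Unset Strict Implicit.
Unset Printing Implicit Defensive.

Import Order.TTheory GRing.Theory Num.Theory.
Import numFieldNormedType.Exports.

Local Open Scope classical_set_scope.
Local Open Scope ring_scope.
Local Open Scope complex_scope.

Local Notation nc := (@Normc.normc _).

(** * Planar and spherical topology in real coordinates *)

Section ComplexNorm.
Context {R : realType}.
Implicit Types z w : R[i].

Lemma normc_nc z : `|z| = (nc z)%:C.
Proof. by []. Qed.

Lemma nc_ge0 z : 0 <= nc z.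
Proof. by rewrite -(@lecR R) -normc_nc normr_ge0. Qed.

Lemma nc_sq z : nc z ^+ 2 = complex.Re z ^+ 2 + complex.Im z ^+ 2.
Proof. by case: z => x y /=; rewrite sqr_sqrtr // addr_ge0 // sqr_ge0. Qed.

Lemma nc_eq0 z : (nc z == 0) = (z == 0).
Proof.
apply/eqP/eqP => [/Normc.eq0_normc //|->]; exact: Normc.normc0.
Qed.

Lemma nc_gt0 z : (0 < nc z) = (z != 0).
Proof. by rewrite lt_neqAle eq_sym nc_eq0 nc_ge0 andbT. Qed.

Lemma ncM z w : nc (z * w) = nc z * nc w.
Proof. exact: Normc.normcM. Qed.

Lemma ncV z : nc z^-1 = (nc z)^-1.
Proof. exact: Normc.normcV. Qed.

Lemma ncX z n : nc (z ^+ n) = nc z ^+ n.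
Proof.
elim: n => [|n IH]; first by rewrite !expr0 Normc.normc1.
by rewrite !exprS ncM IH.
Qed.

Lemma ncN z : nc (- z) = nc z.
Proof. exact: normcN. Qed.

Lemma nc_triangle z w : nc (z + w) <= nc z + nc w.
Proof. exact: le_normcD. Qed.

Lemma nc_sub z w : nc (z - w) = nc (w - z).
Proof. by rewrite -ncN opprB. Qed.

Lemma nc_triangleB z w : nc z - nc w <= nc (z - w).
Proof. by rewrite lerBlDr -{1}(subrK w z) nc_triangle. Qed.

Lemma nc_dist z w : `|nc z - nc w| <= nc (z - w).
Proof.
rewrite ler_norml nc_triangleB andbT lerNl opprB nc_sub; exact: nc_triangleB.
Qed.

Lemma nc_conj z : nc z^* = nc z.
Proof. by case: z => x y /=; rewrite sqrrN. Qed.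

Lemma nc_real (x : R) : nc x%:C = `|x|.
Proof. by rewrite /= expr0n addr0 sqrtr_sqr. Qed.

Lemma Re_le_nc z : `|complex.Re z| <= nc z.
Proof.
rewrite -(@ler_pXn2r _ 2) ?nnegrE ?nc_ge0 // nc_sq real_normK ?num_real //.
by rewrite lerDl sqr_ge0.
Qed.

Lemma Im_le_nc z : `|complex.Im z| <= nc z.
Proof.
rewrite -(@ler_pXn2r _ 2) ?nnegrE ?nc_ge0 // nc_sq real_normK ?num_real //.
by rewrite lerDr sqr_ge0.
Qed.

Lemma nc_le_ReIm z : nc z <= `|complex.Re z| + `|complex.Im z|.
Proof.
rewrite -(@ler_pXn2r _ 2) ?nnegrE ?addr_ge0 ?nc_ge0 // nc_sq.
rewrite sqrrD !real_normK ?num_real // lerD2r lerDl mulrn_wge0 //.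
Qed.

Lemma complex_ext z w :
  complex.Re z = complex.Re w -> complex.Im z = complex.Im w -> z = w.
Proof. by case: z => x y; case: w => u v /= -> ->. Qed.

End ComplexNorm.

Section Topology.
Context {R : realType}.
Implicit Types z w : R[i].

Lemma nbhsC z (A : set R[i]) :
  nbhs z A <-> exists2 e : R, 0 < e & forall w, nc (w - z) < e -> A w.
Proof.
split.
  move=> /nbhs_ballP [e /= e0 eA].
  have eE : e = (complex.Re e)%:C by rewrite RRe_real // gtr0_real.
  exists (complex.Re e); first by rewrite -(@ltcR R) -eE.
  move=> w wz; apply: eA; rewrite /ball /= distrC normc_nc eE.
  by rewrite ltcR.
case=> e e0 eA; apply/nbhs_ballP; exists e%:C; first by rewrite /= ltcR.
move=> w; rewrite /ball /= distrC normc_nc ltcR; exact: eA.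
Qed.

Lemma nbhs_Some z (A : set (sphere R)) :
  nbhs (Some z : sphere R) A <->
  exists2 e : R, 0 < e & forall w, nc (w - z) < e -> A (Some w).
Proof. exact: nbhsC. Qed.

Lemma nc_continuous : continuous (fun z : R[i] => nc z).
Proof.
move=> z A /nbhs_ballP [e /= e0 eA]; apply/nbhsC; exists e => // w wz.
apply: eA; rewrite -ball_normE /= distrC; exact: le_lt_trans (nc_dist _ _) wz.
Qed.

Lemma Re_continuous : continuous (fun z : R[i] => complex.Re z).
Proof.
move=> z A /nbhs_ballP [e /= e0 eA]; apply/nbhsC; exists e => // w wz.
apply: eA; rewrite -ball_normE /= distrC -[X in `|X|]raddfB.
exact: le_lt_trans (Re_le_nc _) wz.
Qed.

Lemma Im_continuous : continuous (fun z : R[i] => complex.Im z).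
Proof.
move=> z A /nbhs_ballP [e /= e0 eA]; apply/nbhsC; exists e => // w wz.
apply: eA; rewrite -ball_normE /= distrC -[X in `|X|]raddfB.
exact: le_lt_trans (Im_le_nc _) wz.
Qed.

Lemma cvg_complex (T : Type) (F : set_system T) {FF : Filter F}
    (u v : T -> R) (x y : R) :
  u @ F --> x -> v @ F --> y ->
  (fun t => u t +i* v t) @ F --> (x +i* y : R[i]).
Proof.
move=> ux vy A /nbhsC [e e0 eA].
have e2 : 0 < e / 2 by rewrite divr_gt0.
have Hu : \forall t \near F, `|x - u t| < e / 2 by move/cvgrPdist_lt: ux; apply.
have Hv : \forall t \near F, `|y - v t| < e / 2 by move/cvgrPdist_lt: vy; apply.
suff : \forall t \near F, A (u t +i* v t) by [].
near=> t; apply: eA; apply: le_lt_trans (nc_le_ReIm _) _ => /=.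
by rewrite (splitr e) ltrD // distrC; near: t.
Unshelve. all: by end_near. Qed.

Lemma hausdorffC : hausdorff_space R[i].
Proof. exact: norm_hausdorff. Qed.

(** Complements of compact sets and exteriors of discs are the same
    neighbourhoods of infinity: closed bounded subsets of the plane are compact,
    which is read off from compact squares. *)
Lemma nbhs_None (A : set (sphere R)) :
  nbhs (None : sphere R) A <->
  A None /\ exists r : R, forall z, r < nc z -> A (Some z).
Proof.
split.
  move=> nA; split; first exact: nbhs_singleton nA.
  case: nA => U [cU _] UA.
  have cI : compact [set nc z | z in U].
    apply: continuous_compact => //; apply: continuous_subspaceT.
    exact: nc_continuous.
  have [M [_ HM]] := compact_bounded cI.
  exists (M + 1) => z zM; apply: UA; left; exists z => // Uz.
  have M1 : M < M + 1 by rewrite ltrDl.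
  have := HM (M + 1) M1 (nc z) (ex_intro2 _ _ z Uz erefl).
  by rewrite /= ger0_norm ?nc_ge0 // leNgt zM.
move=> [AN [r rA]].
pose h (p : R * R) : R[i] := p.1 +i* p.2.
pose U : set R[i] := h @` (`[- `|r|, `|r|] `*` `[- `|r|, `|r|]).
have cU : compact U.
  apply: continuous_compact; last by apply: compact_setX; exact: segment_compact.
  apply: continuous_subspaceT => p; apply: cvg_complex; first exact: cvg_fst.
  exact: cvg_snd.
exists U; first by split => //; exact: compact_closed hausdorffC cU.
move=> s [[z nU <-]|->//]; apply: rA; rewrite ltNge; apply/negP => zr.
apply: nU; exists (complex.Re z, complex.Im z); last by case: z {zr}.
have H (x : R) : `|x| <= nc z -> `[- `|r|, `|r|]%classic x.
  move=> xz; rewrite /= in_itv /= -ler_norml (le_trans xz) //.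
  exact: le_trans zr (ler_norm _).
by split => /=; apply: H; [exact: Re_le_nc|exact: Im_le_nc].
Qed.

Lemma sinvK : involutive (@sinv R).
Proof.
case=> [z|] /=; last by rewrite eqxx.
case: eqVneq => [->|z0] //=; by rewrite invr_eq0 (negbTE z0) invrK.
Qed.

(** Inversion is a homeomorphism of the sphere: it exchanges small discs around
    0 and exteriors of large ones, and away from 0 it is continuous as the
    inverse of the field. *)
Lemma nbhs_sinv (A : set (sphere R)) (s : sphere R) :
  nbhs s A -> nbhs (sinv s) [set t | A (sinv t)].
Proof.
case: s => [z|] /=.
  case: eqVneq => [->|z0].
    move=> /nbhs_Some [e e0 eA]; apply/nbhs_None; split=> /=.
      by apply: eA; rewrite subrr Normc.normc0.
    exists e^-1 => w ew; case: eqVneq => [w0|w0].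
      by move: ew; rewrite w0 Normc.normc0 ltNge invr_ge0 ltW.
    apply: eA; rewrite subr0 ncV invf_plt ?posrE // nc_gt0 //.
  move=> nA; have z'0 : z^-1 != 0 by rewrite invr_eq0.
  have : (fun w : R[i] => w^-1) @ z^-1 --> z.
    rewrite -{2}(invrK z); by apply: cvgV => //; exact: (@nbhs_filter R[i] z^-1).
  move=> /(_ _ nA) H.
  have N0 : nbhs z^-1 [set w : R[i] | w != 0].
    apply/nbhsC; exists (nc z^-1); first by rewrite nc_gt0.
    move=> w; apply: contraTneq => ->; by rewrite sub0r ncN ltxx.
  have H2 : nbhs z^-1 (fun w : R[i] => A (Some w^-1)) by exact: H.
  change (nbhs z^-1 (fun w : R[i] => A (sinv (Some w)))).
  apply: filterS (filterI H2 N0) => w [Aw w0] /=; by rewrite (negbTE w0).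
move=> /nbhs_None [AN [r rA]]; apply/nbhs_Some.
exists (`|r| + 1)^-1; first by rewrite invr_gt0 ltr_wpDl.
move=> w; rewrite subr0 /= => wr; case: eqVneq => [//|w0].
apply: rA; rewrite ncV; apply: (@lt_le_trans _ _ (`|r| + 1)).
  by rewrite (le_lt_trans (ler_norm r)) // ltrDl.
by rewrite -[leLHS]invrK lef_pV2 ?ltW // posrE ?nc_gt0 // invr_gt0 ltr_wpDl.
Qed.

Lemma sinv_continuous : continuous (@sinv R).
Proof. by move=> s A /nbhs_sinv; rewrite sinvK. Qed.

Lemma hausdorff_sphere_sep (s t : sphere R) : s != t ->
  exists A B : set (sphere R), [/\ nbhs s A, nbhs t B & A `&` B = set0].
Proof.
have fin_inf (z : R[i]) : exists A B : set (sphere R),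
   [/\ nbhs (Some z : sphere R) A, nbhs (None : sphere R) B & A `&` B = set0].
  exists (fun t => if t is Some w then nc w < nc z + 1 : Prop else False).
  exists (fun t => if t is Some w then nc z + 1 < nc w : Prop else True).
  split.
  - apply/nbhs_Some; exists 1 => // w wz; rewrite -(subrK z w).
    by rewrite (le_lt_trans (nc_triangle _ _)) // addrC ltrD2l.
  - by apply/nbhs_None; split => //; exists (nc z + 1).
  - by rewrite -subset0 => -[w|] [] //= a /(lt_trans a); rewrite ltxx.
case: s t => [z|] [w|] // zw.
- have zw0 : z != w by apply: contra_neq zw => ->.
  have := hausdorffC; rewrite open_hausdorff => /(_ _ _ zw0) [[A B] [/= zA wB]].
  move=> [oA oB AB]; exists (Some @` A), (Some @` B); split.
  + by apply/one_point_compactification_some_nbhs/open_nbhs_nbhs; split => //;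
      rewrite inE in zA.
  + by apply/one_point_compactification_some_nbhs/open_nbhs_nbhs; split => //;
      rewrite inE in wB.
  + rewrite -subset0 => t [[a Aa <-] [b Bb [ba]]].
    have : (A `&` B) a by split => //; rewrite -ba.
    by rewrite (eqP AB).
- have [A [B [nA nB AB]]] := fin_inf w; exists B, A; split => //.
  by rewrite setIC.
Qed.

End Topology.

(** The chordal distance to a fixed point generates the neighbourhoods of that
    point, so that convergence in the chordal metric is plain topological
    convergence. *)
Section Chordal.
Context {R : realType}.
Implicit Types z w : R[i].

Lemma chordal_xx (s : sphere R) : chordal s s = 0.
Proof. by case: s => [z|] //=; rewrite subrr Normc.normc0 mulr0 mul0r. Qed.

Lemma sqrt1D_ge1 (x : R) : 1 <= Num.sqrt (1 + x ^+ 2).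
Proof. by rewrite -[leLHS]sqrtr1 ler_wsqrtr // lerDl sqr_ge0. Qed.

Lemma sqrt1D_le (x : R) : 0 <= x -> Num.sqrt (1 + x ^+ 2) <= 1 + x.
Proof.
move=> x0; rewrite -[leRHS]ger0_norm ?addr_ge0 // -sqrtr_sqr ler_wsqrtr //.
nra.
Qed.

Lemma sqrt1D_ge (x : R) : 0 <= x -> x <= Num.sqrt (1 + x ^+ 2).
Proof.
move=> x0; rewrite -{1}[x]ger0_norm // -sqrtr_sqr ler_wsqrtr //.
by rewrite lerDr.
Qed.

Lemma nbhs_chordal (s : sphere R) (A : set (sphere R)) :
  nbhs s A <-> exists2 e : R, 0 < e & forall t, chordal t s < e -> A t.
Proof.
have S1 z := sqrt1D_ge1 (nc z).
have S0 z : 0 < Num.sqrt (1 + nc z ^+ 2) := lt_le_trans ltr01 (S1 z).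
case: s => [w|]; split.
- move=> /nbhs_Some [r r0 rA]; pose M : R := 1 + nc w.
  have M0 : 0 < M by rewrite ltr_wpDr ?nc_ge0.
  exists (Num.min (2 / M) (2 * r / ((M + r) * M))).
    by rewrite lt_min !divr_gt0 // ?mulr_gt0 // addr_gt0.
  case=> [z|]; rewrite lt_min => /andP[/= H1 H2]; last first.
    exfalso; move: H1; rewrite ltNge => /negP; apply.
    by rewrite ler_pM2l // lef_pV2 ?posrE // sqrt1D_le // nc_ge0.
  apply: rA; rewrite ltNge; apply/negP => rzw.
  move: H2; rewrite ltNge => /negP; apply.
  set t := nc (z - w) in rzw *.
  have t0 : 0 < t := lt_le_trans r0 rzw.
  have Mr : 0 < (M + r) * M by rewrite mulr_gt0 // addr_gt0.
  have Mt : 0 < (M + t) * M by rewrite mulr_gt0 // addr_gt0.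
  have Ms : 0 < Num.sqrt (1 + nc z ^+ 2) * Num.sqrt (1 + nc w ^+ 2).
    exact: mulr_gt0.
  apply: (@le_trans _ _ (2 * t / ((M + t) * M))).
    rewrite ler_pdivrMr // mulrAC ler_pdivlMr //.
    suff : 0 <= 2 * M ^+ 2 * (t - r) by lra.
    apply: mulr_ge0; last by rewrite subr_ge0.
    by rewrite mulr_ge0 // sqr_ge0.
  rewrite ler_pM2l ?mulr_gt0 // lef_pV2 ?posrE //.
  apply: ler_pM; rewrite ?(ltW (S0 _)) //; last exact/sqrt1D_le/nc_ge0.
  apply: le_trans (sqrt1D_le (nc_ge0 _)) _; rewrite /M -addrA lerD2l.
  by rewrite -{1}(subrK w z) addrC (le_trans (nc_triangle _ _)).
- case=> e e0 eA; apply/nbhs_Some; exists (e / 2); first by rewrite divr_gt0.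
  move=> z zw; apply: eA => /=.
  rewrite ltr_pdivrMr ?mulr_gt0 // (@lt_le_trans _ _ e) //; first by lra.
  by rewrite ler_peMr ?(ltW e0) // mulr_ege1.
- move=> /nbhs_None [AN [r rA]]; exists (2 / (1 + `|r|)).
    by rewrite divr_gt0 // ltr_wpDr.
  case=> [z|//] /=; rewrite ltr_pM2l // ltf_pV2 ?posrE // ?ltr_wpDr // => H.
  apply: rA; apply: le_lt_trans (ler_norm r) _.
  have := lt_le_trans H (sqrt1D_le (nc_ge0 z)); by rewrite ltrD2l.
- case=> e e0 eA; apply/nbhs_None; split.
    by apply: eA; rewrite chordal_xx.
  exists (2 / e) => z ze; apply: eA => /=.
  rewrite ltr_pdivrMr // mulrC -ltr_pdivrMr //.
  exact: lt_le_trans ze (sqrt1D_ge (nc_ge0 _)).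
Qed.

End Chordal.

(** * Homogeneous coordinates, Mobius maps and quadratic maps of the sphere *)

Section ComplexLimits.
Context {R : realType} {T : Type} {F : set_system T} {FF : Filter F}.
Implicit Types (u v : T -> R[i]) (x y : R[i]).

Lemma cvgC_cst x : (fun _ => x) @ F --> x.
Proof. exact: cvg_cst. Qed.

Lemma cvgCD u v x y : u @ F --> x -> v @ F --> y ->
  (fun i => u i + v i) @ F --> x + y.
Proof. by move=> ux vy; exact: (@cvgD R[i] R[i] T F FF u v x y ux vy). Qed.

Lemma cvgCM u v x y : u @ F --> x -> v @ F --> y ->
  (fun i => u i * v i) @ F --> x * y.
Proof. by move=> ux vy; exact: (@cvgM R[i] T F FF u v x y ux vy). Qed.

Lemma cvgCV u x : x != 0 -> u @ F --> x -> (fun i => (u i)^-1) @ F --> x^-1.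
Proof. by move=> x0 ux; exact: (@cvgV R[i] T F FF u x x0 ux). Qed.

Lemma cvgCX2 u x : u @ F --> x -> (fun i => u i ^+ 2) @ F --> x ^+ 2.
Proof.
move=> ux; rewrite expr2; have -> : (fun i => u i ^+ 2) = (fun i => u i * u i).
  by apply/funext => i; rewrite expr2.
exact: cvgCM.
Qed.

Lemma cvgC_neq0 u x : x != 0 -> u @ F --> x -> \forall i \near F, u i != 0.
Proof.
move=> x0 ux; have : nbhs x [set z : R[i] | z != 0].
  apply/nbhsC; exists (nc x); first by rewrite nc_gt0.
  by move=> w; apply: contraTneq => ->; rewrite sub0r ncN ltxx.
exact: ux.
Qed.
End ComplexLimits.

Lemma cvgC_id {R : realType} (z : R[i]) : (fun w : R[i] => w) @ nbhs z --> z.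
Proof. by []. Qed.

Arguments cvgC_cst {R T F FF} x.
Arguments cvgC_id {R} z.

Section Homogeneous.
Context {R : realType}.
Implicit Types (x y z w k a b c d : R[i]) (s : sphere R).

(** The point [x : y] of the projective line. *)
Definition pt x y : sphere R := if y == 0 then None else Some (x / y).

Definition nonzero2 x y : bool := (x != 0) || (y != 0).

Lemma nonzero2P x y : ~~ nonzero2 x y -> x = 0 /\ y = 0.
Proof. by rewrite negb_or !negbK => /andP[/eqP-> /eqP->]. Qed.

Lemma pt1 z : pt z 1 = Some z.
Proof. by rewrite /pt oner_eq0 divr1. Qed.

Lemma pt0 x : pt x 0 = None.
Proof. by rewrite /pt eqxx. Qed.

Lemma pt_scale k x y : k != 0 -> pt (k * x) (k * y) = pt x y.
Proof.
move=> k0; rewrite /pt mulf_eq0 (negbTE k0) /=.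
case: eqVneq => // y0; congr Some; rewrite -mulf_div divff // mul1r //.
Qed.

Lemma pt_Some x y : y != 0 -> pt x y = Some (x / y).
Proof. by move=> y0; rewrite /pt (negbTE y0). Qed.

Lemma ptP s : exists x y, nonzero2 x y /\ s = pt x y.
Proof.
case: s => [z|]; [exists z, 1|exists 1, 0]; rewrite /nonzero2 ?pt1 ?pt0.
  by rewrite oner_neq0 orbT.
by rewrite oner_neq0.
Qed.

Lemma sinv_pt x y : nonzero2 x y -> sinv (pt x y) = pt y x.
Proof.
rewrite /pt /nonzero2; case: (eqVneq y 0) => [-> /=|y0 _].
  by rewrite orbF => x0; rewrite (negbTE x0) mul0r.
rewrite /= mulf_eq0 invr_eq0 (negbTE y0) orbF; case: eqVneq => // _.
by rewrite invf_div.
Qed.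

(** Homogeneous coordinates hide the poles: where the denominator vanishes the
    statement follows from the finite case by inversion. *)
Lemma pt_cvg (T : Type) (F : set_system T) {FF : Filter F}
    (u v : T -> R[i]) x y : nonzero2 x y ->
  u @ F --> x -> v @ F --> y -> (fun t => pt (u t) (v t)) @ F --> pt x y.
Proof.
have fin (p q : T -> R[i]) (a b : R[i]) : b != 0 -> p @ F --> a -> q @ F --> b ->
    (fun t => pt (p t) (q t)) @ F --> pt a b.
  move=> b0 pa qb; rewrite [pt a b]pt_Some // => A nA.
  have H : (fun t => p t / q t) @ F --> a / b by exact: (cvgCM pa (cvgCV b0 qb)).
  have {}H : \forall t \near F, A (Some (p t / q t)) by exact: (H (fun w => A (Some w)) nA).
  have N := cvgC_neq0 b0 qb.
  suff : \forall t \near F, A (pt (p t) (q t)) by [].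
  by apply: filterS2 H N => t At qt; rewrite pt_Some.
rewrite /nonzero2 => n ux vy.
case: (eqVneq y 0) n => [y0|y0] n; last exact: fin.
move: n; rewrite orbF => x0.
have H := fin _ _ _ _ x0 vy ux.
move=> A nA; have nS : nbhs (pt y x) [set t | A (sinv t)].
  rewrite -sinv_pt; first exact: nbhs_sinv.
  by rewrite /nonzero2 x0.
have {}H : \forall t \near F, A (sinv (pt (v t) (u t))).
  exact: (H [set t | A (sinv t)] nS).
have N := cvgC_neq0 x0 ux.
suff : \forall t \near F, A (pt (u t) (v t)) by [].
apply: filterS2 H N => t At ut; rewrite -[pt _ _]sinvK sinv_pt //.
by rewrite /nonzero2 ut.
Qed.

Lemma continuous_charts (T : topologicalType) (f : sphere R -> T) :
  (forall z, (fun w : R[i] => f (Some w)) @ nbhs z --> f (Some z)) ->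
  (fun w : R[i] => f (sinv (Some w))) @ nbhs (0 : R[i]) --> f None ->
  continuous f.
Proof.
move=> f1 f2; case=> [z|]; first exact: f1.
move=> A /f2 H; have {}H : nbhs (Some 0 : sphere R) [set t | A (f (sinv t))].
  exact: H.
have := nbhs_sinv H; rewrite /= eqxx; apply: filterS => t /=.
by rewrite sinvK.
Qed.

(** The Mobius map with matrix (a b; c d), and below the map whose homogeneous
    components are two binary quadratic forms. *)
Definition mob a b c d s : sphere R :=
  if s is Some z then pt (a * z + b) (c * z + d) else pt a c.

Definition qmap a b c a' b' c' s : sphere R :=
  if s is Some z then pt (a * z ^+ 2 + b * z + c) (a' * z ^+ 2 + b' * z + c')
  else pt a a'.

Lemma mob_pt a b c d x y : nonzero2 x y ->
  mob a b c d (pt x y) = pt (a * x + b * y) (c * x + d * y).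
Proof.
move=> n; rewrite {1}/pt; case: (eqVneq y 0) n => [->|y0] n /=.
  move: n; rewrite /nonzero2 eqxx orbF => x0.
  by rewrite !mulr0 !addr0 ![_ * x]mulrC pt_scale.
by rewrite -[LHS](pt_scale _ _ y0); congr pt; field.
Qed.

Lemma qmap_pt a b c a' b' c' x y : nonzero2 x y ->
  qmap a b c a' b' c' (pt x y) =
  pt (a * x ^+ 2 + b * x * y + c * y ^+ 2)
     (a' * x ^+ 2 + b' * x * y + c' * y ^+ 2).
Proof.
move=> n; rewrite {1}/pt; case: (eqVneq y 0) n => [->|y0] n /=.
  move: n; rewrite /nonzero2 eqxx orbF => x0.
  rewrite !mulr0 expr0n /= !mulr0 !addr0 ![_ * x ^+ 2]mulrC pt_scale //.
  by rewrite expf_neq0.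
have y20 : y ^+ 2 != 0 by rewrite expf_neq0.
by rewrite -[LHS](pt_scale _ _ y20); congr pt; field.
Qed.

Lemma mob_nonzero a b c d x y : a * d - b * c != 0 -> nonzero2 x y ->
  nonzero2 (a * x + b * y) (c * x + d * y).
Proof.
move=> D; apply: contraTT => /nonzero2P [H1 H2].
have Ex : (a * d - b * c) * x = 0.
  have -> : (a * d - b * c) * x = d * (a * x + b * y) - b * (c * x + d * y).
    by ring.
  by rewrite H1 H2 !mulr0 subr0.
have Ey : (a * d - b * c) * y = 0.
  have -> : (a * d - b * c) * y = a * (c * x + d * y) - c * (a * x + b * y).
    by ring.
  by rewrite H1 H2 !mulr0 subr0.
move/eqP: Ex; move/eqP: Ey; rewrite !mulf_eq0 (negbTE D) /= => y0 x0.
by rewrite /nonzero2 x0 y0.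
Qed.

Lemma nonzero2_sq x y : nonzero2 (x ^+ 2) (y ^+ 2) = nonzero2 x y.
Proof. by rewrite /nonzero2 !expf_eq0. Qed.

Lemma mob_comp a b c d a' b' c' d' s : a' * d' - b' * c' != 0 ->
  mob a b c d (mob a' b' c' d' s) =
  mob (a * a' + b * c') (a * b' + b * d') (c * a' + d * c') (c * b' + d * d') s.
Proof.
move=> D; have [x [y [n ->]]] := ptP s.
rewrite !mob_pt //; first by congr pt; ring.
exact: mob_nonzero.
Qed.

Lemma mob_id a s : a != 0 -> mob a 0 0 a s = s.
Proof.
move=> a0; have [x [y [n ->]]] := ptP s.
by rewrite mob_pt // !mul0r addr0 add0r pt_scale.
Qed.

Lemma mobK a b c d : a * d - b * c != 0 ->
  cancel (mob a b c d) (mob d (- b) (- c) a).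
Proof.
move=> D s; rewrite mob_comp // -[RHS](mob_id s D); congr mob; ring.
Qed.

Lemma mobVK a b c d : a * d - b * c != 0 ->
  cancel (mob d (- b) (- c) a) (mob a b c d).
Proof.
move=> D s; rewrite mob_comp; last first.
  by have -> : d * a - - b * - c = a * d - b * c by ring.
rewrite -[RHS](mob_id s D); congr mob; ring.
Qed.

Lemma qmap_continuous a b c a' b' c' :
  (forall x y, nonzero2 x y ->
     nonzero2 (a * x ^+ 2 + b * x * y + c * y ^+ 2)
              (a' * x ^+ 2 + b' * x * y + c' * y ^+ 2)) ->
  continuous (qmap a b c a' b' c').
Proof.
move=> H; have H1 z : nonzero2 z 1 by rewrite /nonzero2 oner_neq0 orbT.
have H2 z : nonzero2 1 z by rewrite /nonzero2 oner_neq0.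
have poly_cvg (p q r z : R[i]) :
   (fun w : R[i] => p * w ^+ 2 + q * w + r) @ nbhs z --> p * z ^+ 2 + q * z + r.
  have id := cvgC_id z.
  exact: (cvgCD (cvgCD (cvgCM (cvgC_cst p) (cvgCX2 id))
                       (cvgCM (cvgC_cst q) id)) (cvgC_cst r)).
apply: continuous_charts => [z|].
  have := H z 1 (H1 z); rewrite !mulr1 !expr1n !mulr1 => n.
  exact: (pt_cvg n (poly_cvg a b c z) (poly_cvg a' b' c' z)).
have E w : qmap a b c a' b' c' (sinv (Some w)) =
   pt (c * w ^+ 2 + b * w + a) (c' * w ^+ 2 + b' * w + a').
  rewrite -(pt1 w) sinv_pt // qmap_pt //; congr pt; ring.
under eq_fun do rewrite E.
have n : nonzero2 (c * 0 ^+ 2 + b * 0 + a) (c' * 0 ^+ 2 + b' * 0 + a').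
  have := H 1 0 (H2 0).
  by rewrite expr0n /= !mulr0 !addr0 !add0r !expr1n !mulr1.
have -> : qmap a b c a' b' c' None =
    pt (c * 0 ^+ 2 + b * 0 + a) (c' * 0 ^+ 2 + b' * 0 + a').
  by rewrite expr0n /= !mulr0 !add0r.
exact: (pt_cvg n (poly_cvg c b a 0) (poly_cvg c' b' a' 0)).
Qed.

Lemma mob_continuous a b c d : a * d - b * c != 0 -> continuous (mob a b c d).
Proof.
move=> D; have H1 z : nonzero2 z 1 by rewrite /nonzero2 oner_neq0 orbT.
have H2 z : nonzero2 1 z by rewrite /nonzero2 oner_neq0.
have poly_cvg (q r z : R[i]) : (fun w : R[i] => q * w + r) @ nbhs z --> q * z + r.
  have id := cvgC_id z.
  exact: (cvgCD (cvgCM (cvgC_cst q) id) (cvgC_cst r)).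
apply: continuous_charts => [z|].
  have := mob_nonzero D (H1 z); rewrite !mulr1 => n.
  exact: (pt_cvg n (poly_cvg a b z) (poly_cvg c d z)).
have E w : mob a b c d (sinv (Some w)) = pt (b * w + a) (d * w + c).
  rewrite -(pt1 w) sinv_pt // mob_pt //; congr pt; ring.
under eq_fun do rewrite E.
have n : nonzero2 (b * 0 + a) (d * 0 + c).
  by have := mob_nonzero D (H2 0); rewrite !mulr0 !addr0 !add0r !mulr1.
have -> : mob a b c d None = pt (b * 0 + a) (d * 0 + c).
  by rewrite /= !mulr0 !add0r.
exact: (pt_cvg n (poly_cvg b a 0) (poly_cvg d c 0)).
Qed.

End Homogeneous.

(** * From attraction to Fatou and Julia sets *)

Section Attraction.
Context {R : realType}.
Implicit Types (f phi psi : sphere R -> sphere R) (a b x y : sphere R).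
Implicit Types (K O : set (sphere R)).

(** Locally uniform convergence of the iterates to a point, in purely
    topological terms so that it is visibly invariant under conjugation by
    homeomorphisms. *)
Definition attracted f a x : Prop := exists U, nbhs x U /\
  forall W, nbhs a W -> exists N, forall n y, (N <= n)%N -> U y ->
    W (iter n f y).

Lemma infinitely_often_subseq (P : nat -> Prop) :
  (forall N, exists n, (N <= n)%N /\ P n) ->
  exists s : nat -> nat, {homo s : m n / (m < n)%N} /\ forall n, P (s n).
Proof.
move=> /choice [g Hg].
pose s := fix s n := if n is n'.+1 then g (s n').+1 else g 0%N.
exists s; split; last by case=> [|n]; apply: (Hg _).2.
by apply: homo_ltn; [exact: ltn_trans|move=> n; exact: (Hg _).1].
Qed.

Lemma attracted_fatou f a x : attracted f a x -> fatou_set f x.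
Proof.
move=> [U [nU HU]]; exists U°.
  by split; [exact: open_interior|exact: nU].
move=> u Hu.
have {}Hu : forall n, exists m, u n = iter m f.
  by move=> n; have [m _ <-] := Hu n; exists m.
have [m um] := choice Hu.
have [[j Hj]|Hj] := pselect (exists j, forall N, exists n, (N <= n)%N /\ m n = j).
  have [s [sI sj]] := infinitely_often_subseq Hj.
  exists s; split => //; exists (iter j f) => y Uy; exists setT; first exact: filterT.
  move=> e e0; apply: nearW => n z _ /=.
  by rewrite um sj chordal_xx.
have Hm : forall M, exists N, forall n, (N <= n)%N -> (M <= m n)%N.
  elim=> [|M [N HN]]; first by exists 0%N.
  have [N' HN'] : exists N', forall n, (N' <= n)%N -> m n <> M.
    apply: contrapT => H; apply: Hj; exists M => N'.
    apply: contrapT => H'; apply: H; exists N' => n nN' mM.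
    by apply: H'; exists n.
  exists (maxn N N') => n; rewrite geq_max => /andP[n1 n2].
  by rewrite ltn_neqAle HN // andbT; apply/eqP => E; exact: (HN' n n2).
exists id; split => //; exists (fun _ => a) => y Uy; exists setT; first exact: filterT.
move=> e e0.
have /HU [N HN] : nbhs a [set t | chordal t a < e] by apply/nbhs_chordal; exists e.
have [N' HN'] := Hm N; exists N' => // n /= nN' z [Uz _] /=.
rewrite um; apply: HN; first exact: HN'.
exact: interior_subset Uz.
Qed.

Lemma iter_continuous f n : continuous f -> continuous (iter n f).
Proof.
move=> cf; elim: n => [|n IH] x; first exact: cvg_id.
exact: (continuous_comp (IH x) (cf _)).
Qed.

(** What has to be known about a map to read off its Julia set K and its Fatou
    set without Montel's theorem. The open set O separates K from the
    attractors: a limit function on a neighbourhood of a point of K takes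
    values away from a and b on K, but equals a or b on the dense complement. *)
Record dichotomy f a b K O : Prop := Dichotomy {
  dicho_cont : continuous f;
  dicho_out : forall x, ~ K x -> attracted f a x \/ attracted f b x;
  dicho_inv : forall x, K x -> K (f x);
  dicho_dense : forall x W, K x -> nbhs x W -> exists2 y, W y & ~ K y;
  dicho_open : open O;
  dicho_sub : K `<=` O;
  dicho_a : exists2 W, nbhs a W & forall x, W x -> ~ O x;
  dicho_b : exists2 W, nbhs b W & forall x, W x -> ~ O x }.

Lemma attracted_lim f a x b :
  attracted f a x -> (forall e : R, 0 < e -> exists N, forall n, (N <= n)%N ->
     exists2 m, (n <= m)%N & chordal (iter m f x) b < e) -> a = b.
Proof.
move=> [U [nU HU]] Hb; apply/eqP; apply: contraT => ab.
have [A [B [nA nB AB]]] := hausdorff_sphere_sep ab.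
have [N HN] := HU _ nA.
have [e e0 eB] := (nbhs_chordal b B).1 nB.
have [N' HN'] := Hb e e0.
have [m mN] := HN' _ (leq_maxr N N').
move=> /eB Bm; have Am : A (iter m f x).
  apply: HN; last exact: nbhs_singleton nU.
  by apply: leq_trans mN; exact: leq_maxl.
have : (A `&` B) (iter m f x) by [].
by rewrite AB.
Qed.

Lemma attracted_fixed f a b : f b = b -> attracted f a b -> a = b.
Proof.
move=> fb /attracted_lim; apply => e e0; exists 0%N => n _; exists n => //.
by rewrite (_ : iter n f b = b) ?chordal_xx //; elim: n => //= n ->.
Qed.

(** Points of K are not normal: any limit function would be constant a or b at
    the nearby points outside K, while the orbit of K stays in O. *)
Lemma dichotomy_julia f a b K O : dichotomy f a b K O -> julia_set f = K.
Proof.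
case=> cf out inv dense oO KO [Wa nWa WaO] [Wb nWb WbO].
apply/seteqP; split => x.
  by move=> nF; apply: contrapT => /out[] /attracted_fatou.
move=> Kx [U [oU Ux]] N.
have [] := N (fun n => iter n.+1 f); first by move=> n; exists n.+1.
move=> s [sI [g Hg]]; have [V nV HV] := Hg x Ux.
have sge n : (n <= s n)%N.
  by elim: n => // n IH; apply: leq_ltn_trans IH _; exact: sI.
have [ea ea0 eaW] := (nbhs_chordal a Wa).1 nWa.
have [eb eb0 ebW] := (nbhs_chordal b Wb).1 nWb.
pose e := Num.min ea eb.
have e0 : 0 < e by rewrite lt_min ea0.
have [M _ HM] := HV e e0.
have {}HM := HM M (leqnn M).
have cM := @iter_continuous f (s M).+1 cf x.
have OM : O (iter (s M).+1 f x).
  apply: KO; elim: (s M).+1 => //= n IH; exact: inv.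
have nO : nbhs x (iter (s M).+1 f @^-1` O).
  by apply: cM; apply: open_nbhs_nbhs; split.
have [y [[Uy Vy] Oy] nKy] := dense x _ Kx
  (filterI (filterI (open_nbhs_nbhs (conj oU Ux)) nV) nO).
have lim c : attracted f c y -> c = g y.
  move=> /attracted_lim; apply => e' e'0.
  have [N' _ HN'] := HV e' e'0; exists N' => n nN'.
  exists (s n).+1; first exact: leqW.
  exact: HN' n nN' y (conj Uy Vy).
have := HM y (conj Uy Vy) => /=.
have [/lim <-|/lim <-] := out y nKy.
  by rewrite lt_min => /andP[/eaW /WaO].
by rewrite lt_min => /andP[_ /ebW /WbO].
Qed.

Definition basin f a : set (sphere R) := [set x | attracted f a x].

Lemma basin_open f a : open (basin f a).
Proof.
rewrite openE => x [U [nU HU]].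
have : nbhs x U° by exact: nbhs_interior.
apply: filterS => y nUy; exists U; split => //.
Qed.

Lemma basin_preimage f a x : continuous f -> basin f a (f x) -> basin f a x.
Proof.
move=> cf [U [nU HU]]; exists (f @^-1` U); split; first exact: cf.
move=> W nW; have [N HN] := HU W nW; exists N.+1 => -[//|n] y nN Uy.
by rewrite iterSr; exact: HN.
Qed.

Lemma basin_disjoint f a b x : a != b -> basin f a x -> ~ basin f b x.
Proof.
move=> ab [U [nU HU]] [V [nV HV]].
have [A [B [nA nB AB]]] := hausdorff_sphere_sep ab.
have [N HN] := HU _ nA; have [M HM] := HV _ nB.
have : (A `&` B) (iter (maxn N M) f x).
  split; [apply: HN|apply: HM]; rewrite ?leq_maxl ?leq_maxr //;
  exact: nbhs_singleton.
by rewrite AB.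
Qed.

Lemma dichotomy_fatou f a b K O : dichotomy f a b K O ->
  fatou_set f = basin f a `|` basin f b.
Proof.
move=> D; have J := dichotomy_julia D; apply/seteqP; split => x.
  move=> Fx; apply: (dicho_out D); rewrite -J /julia_set /=.
  by move=> nF; exact: nF.
by case; exact: attracted_fatou.
Qed.

(** The two basins are open, disjoint and cover the Fatou set, so connectedness
    makes each of them a whole component. *)
Lemma component_of_clopen (T : topologicalType) (U V : set T) (x : T) :
  open U -> open V -> U `&` V = set0 -> connected U -> U x ->
  U = connected_component (U `|` V) x.
Proof.
move=> oU oV UV cU Ux; apply/seteqP; split.
  by apply: connected_component_max => //; left.
set C := connected_component _ _.
have Cx : C x by apply: connected_component_refl; left.
have CUV : C `<=` U `|` V by exact: connected_component_sub.
have /(_ (C `&` U)) H := @component_connected T (U `|` V) x.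
have <- : C `&` U = C; last by move=> y [].
apply: H.
- by exists x; split.
- by exists U.
- exists (~` V); first by rewrite closedC.
  apply/seteqP; split => y [Cy Uy]; split => //.
    by move=> Vy; have : (U `&` V) y by []; rewrite UV.
  by have [] := CUV y Cy.
Qed.

Lemma dichotomy_basin_a f a b K O : dichotomy f a b K O -> a != b ->
  f a = a -> basin f a a.
Proof.
move=> D ab fa; have [W nW WO] := dicho_a D.
have [//|] : basin f a a \/ basin f b a.
  apply: (dicho_out D) => Ka; apply: (WO a); first exact: nbhs_singleton.
  exact: (dicho_sub D).
by move=> /(attracted_fixed fa) E; move: ab; rewrite E eqxx.
Qed.

Lemma dichotomyC f a b K O : dichotomy f a b K O -> dichotomy f b a K O.
Proof. by case=> c o i d oO KO Ha Hb; split => // x /o[]; [right|left]. Qed.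

Lemma dichotomy_two_basins f a b K O : dichotomy f a b K O -> a != b ->
  connected (basin f a) -> connected (basin f b) ->
  attracting_fixed_point f a -> attracting_fixed_point f b ->
  exists U V : set (sphere R), [/\ U <> V,
    completely_invariant_attracting_domain f U,
    completely_invariant_attracting_domain f V & fatou_set f = U `|` V].
Proof.
move=> D ab ca cb fa fb; have F := dichotomy_fatou D.
have Ba : basin f a a by apply: dichotomy_basin_a D ab (proj1 fa).
have Bb : basin f b b.
  by apply: dichotomy_basin_a (dichotomyC D) _ (proj1 fb); rewrite eq_sym.
have I0 : basin f a `&` basin f b = set0.
  by rewrite -subset0 => x [xa]; exact: basin_disjoint ab xa.
exists (basin f a), (basin f b); split => //.
- by move=> E; apply: (basin_disjoint ab Ba); rewrite -E.
- split; last by move=> x; exact: (basin_preimage (dicho_cont D)).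
  split; last by exists a.
  exists a; first by rewrite F; left.
  by rewrite F; apply: component_of_clopen => //; exact: basin_open.
- split; last by move=> x; exact: (basin_preimage (dicho_cont D)).
  split; last by exists b.
  exists b; first by rewrite F; right.
  rewrite F setUC; apply: component_of_clopen => //; try exact: basin_open.
  by rewrite setIC.
Qed.

Lemma dichotomy_one_basin f a K O : dichotomy f a a K O ->
  connected (basin f a) -> attracting_fixed_point f a ->
  completely_invariant_attracting_domain f (fatou_set f).
Proof.
move=> D ca fa; have F := dichotomy_fatou D; rewrite setUid in F.
have [W nW WO] := dicho_a D.
have Ba : basin f a a.
  by have [] := dicho_out D (x := a) => // Ka; apply: (WO a);
    [exact: nbhs_singleton|exact: (dicho_sub D)].
rewrite F; split; last by move=> x; exact: (basin_preimage (dicho_cont D)).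
split; last by exists a.
exists a; first by rewrite F.
rewrite F -{2}(setU0 (basin f a)); apply: component_of_clopen => //.
- exact: basin_open.
- by rewrite setI0.
Qed.

(** Everything above is transported by a conjugating homeomorphism. *)
Section Transport.
Variables (phi psi g : sphere R -> sphere R).
Hypotheses (phiK : cancel phi psi) (psiK : cancel psi phi).
Hypotheses (cphi : continuous phi) (cpsi : continuous psi).
Let f := phi \o g \o psi.

Lemma iter_conj n x : iter n f (phi x) = phi (iter n g x).
Proof. by elim: n => //= n ->; rewrite /f /= phiK. Qed.

Lemma attracted_conj a x : attracted g a x -> attracted f (phi a) (phi x).
Proof.
move=> [U [nU HU]]; exists (psi @^-1` U); split.
  by apply: cpsi; rewrite phiK.
move=> W nW; have [N HN] := HU (phi @^-1` W) (cphi nW).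
exists N => n y nN Uy; rewrite -(psiK y) iter_conj; exact: HN.
Qed.

Lemma dichotomy_conj a b K O : dichotomy g a b K O ->
  dichotomy f (phi a) (phi b) (psi @^-1` K) (psi @^-1` O).
Proof.
case=> cg out inv dense oO KO [Wa nWa WaO] [Wb nWb WbO]; split.
- move=> x; apply: (@continuous_comp _ _ _ (g \o psi) phi); last exact: cphi.
  exact: (continuous_comp (@cpsi x) (@cg _)).
- move=> x /= /out [] /attracted_conj; rewrite psiK; [left|right] => //.
- by move=> x /= Kx; rewrite /f /= phiK; exact: inv.
- move=> x W Kx nW.
  have nW' : nbhs (psi x) (phi @^-1` W) by apply: cphi; rewrite psiK.
  have [y Wy nK] := dense (psi x) (phi @^-1` W) Kx nW'.
  by exists (phi y) => //=; rewrite phiK.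
- by apply: open_comp => // x _; exact: cpsi.
- by move=> x; exact: KO.
- exists (psi @^-1` Wa); last by move=> x; exact: WaO.
  by apply: cpsi; rewrite phiK.
- exists (psi @^-1` Wb); last by move=> x; exact: WbO.
  by apply: cpsi; rewrite phiK.
Qed.

End Transport.

Lemma basin_conj phi psi g a : cancel phi psi -> cancel psi phi ->
  continuous phi -> continuous psi ->
  basin (phi \o g \o psi) (phi a) = phi @` basin g a.
Proof.
move=> phiK psiK cphi cpsi; apply/seteqP; split => x; last first.
  by move=> [y gy <-]; exact: attracted_conj.
move=> /(attracted_conj psiK phiK cpsi cphi); rewrite phiK => H.
exists (psi x) => //; rewrite /basin /=.
suff -> : g = psi \o (phi \o g \o psi) \o phi by [].
by apply/funext => y /=; rewrite !phiK.
Qed.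

Lemma connected_basin_conj phi psi g a : cancel phi psi -> cancel psi phi ->
  continuous phi -> continuous psi -> connected (basin g a) ->
  connected (basin (phi \o g \o psi) (phi a)).
Proof.
move=> phiK psiK cphi cpsi cB; rewrite basin_conj //.
apply: connected_continuous_connected => //; exact: continuous_subspaceT.
Qed.

Lemma jordan_curve_image phi psi K : cancel phi psi -> cancel psi phi ->
  continuous phi -> jordan_curve K -> jordan_curve (psi @^-1` K).
Proof.
move=> phiK psiK cphi [ga [cg ig gK]]; exists (phi \o ga); split.
- move=> z; exact: (@continuous_comp (subspace _) _ _ ga phi z (cg z) (cphi _)).
- move=> z w zc wc /= /(can_inj phiK); exact: ig.
- apply/seteqP; split => [x [z zc <-]|x Kx].
    by rewrite /= phiK -gK; exists z.
  have : (ga @` [set z : R[i] | `|z| = 1]) (psi x) by rewrite gK.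
  by move=> [z zc zx]; exists z => //=; rewrite zx psiK.
Qed.

Lemma totally_disconnected_image phi psi K : cancel phi psi -> cancel psi phi ->
  continuous psi -> totally_disconnected K ->
  totally_disconnected (psi @^-1` K).
Proof.
move=> phiK psiK cpsi tK x Kx; apply/seteqP; split; last first.
  by move=> _ ->; exact: connected_component_refl.
move=> y Cy; apply: (can_inj psiK).
have : connected_component K (psi x) (psi y).
  apply: (@connected_component_max _ K (psi @` connected_component (psi @^-1` K) x)).
  - by exists x => //; exact: connected_component_refl.
  - by move=> _ [z /connected_component_sub Kz <-].
  - apply: connected_continuous_connected; first exact: component_connected.
    exact: continuous_subspaceT.
  - by exists y.
by rewrite (tK _ Kx).
Qed.

End Attraction.

(** * Multipliers through linearizing charts *)

Section Multiplier.
Context {R : realType}.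
Implicit Types (z w a b c d : R[i]) (f h chi : sphere R -> sphere R).

Lemma derive1_factor (F m : R[i] -> R[i]) z0 m0 :
  F z0 = z0 -> (\forall z \near nbhs z0, F z = z0 + (z - z0) * m z) ->
  m @ nbhs z0 --> m0 -> derive1 F z0 = m0.
Proof.
move=> F0 HF Hm; rewrite /derive1; apply: cvg_lim; first exact: hausdorffC.
move=> A nA.
have nmA : \forall z \near nbhs z0, A (m z) by exact: (Hm A nA).
have [e e0 eA] := (nbhsC z0 _).1 (filterI HF nmA).
suff : nbhs (0 : R[i])
    [set k | k != 0 -> A (k^-1 *: (F (k + z0) - F z0))] by [].
apply/nbhsC; exists e => // k; rewrite subr0 => ke k0.
have [|-> Am] := eA (k + z0); first by rewrite addrK.
rewrite F0 addrK [z0 + _]addrC addrK /GRing.scale /= mulrA mulVf // mul1r.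
exact: Am.
Qed.

Lemma multiplier_None f : multiplier f None = multiplier (sinv \o f \o sinv) (Some 0).
Proof. by []. Qed.

(** The multiplier is invariant under Mobius changes of coordinate, which is
    checked on the explicit difference quotient: in a chart chi where the map
    is w q(w), with q merely continuous at 0, the quotient at x is q times a
    ratio of affine factors that tends to 1. Infinity is the case of a chart
    precomposed with inversion. *)
Lemma multiplier_linearized f h chi chi' (q : R[i] -> R[i]) a b c d x :
  a * d - b * c != 0 -> chi = mob a b c d -> cancel chi chi' -> cancel chi' chi ->
  f = chi' \o h \o chi -> chi x = Some 0 ->
  (\forall w \near nbhs (0 : R[i]), h (Some w) = Some (w * q w)) ->
  q @ nbhs (0 : R[i]) --> q 0 ->
  f x = x /\ multiplier f x = q 0.
Proof.
move=> D chiE chiK chi'K fE chix hq cq.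
have chi'E : chi' = mob d (- b) (- c) a.
  apply/funext => s; apply: (can_inj chiK); rewrite chi'K chiE.
  by rewrite mobVK.
have h0 : h (Some 0) = Some 0.
  by rewrite (nbhs_singleton hq) mul0r.
have fx : f x = x.
  by apply: (can_inj chiK); rewrite fE /= chi'K chix h0.
split => //.
have fin (f0 chi0 chi0' : sphere R -> sphere R) a0 b0 c0 d0 z0 :
  a0 * d0 - b0 * c0 != 0 -> chi0 = mob a0 b0 c0 d0 ->
  chi0' = mob d0 (- b0) (- c0) a0 -> f0 = chi0' \o h \o chi0 ->
  chi0 (Some z0) = Some 0 -> multiplier f0 (Some z0) = q 0.
  move=> {}D E E' F Z.
  have den0 : c0 * z0 + d0 != 0.
    by apply/eqP => H; move: Z; rewrite E /= H pt0.
  have num0 : b0 = - (a0 * z0).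
    move: Z; rewrite E /= pt_Some // => -[] /eqP.
    rewrite mulf_eq0 invr_eq0 (negbTE den0) orbF addrC addr_eq0.
    by move/eqP.
  have D' : a0 * (c0 * z0 + d0) != 0.
    by move: D; rewrite num0; congr (_ != 0); ring.
  have a00 : a0 != 0 by apply: contraNneq D' => ->; rewrite mul0r.
  pose k z := a0 / (c0 * z + d0).
  pose l w := (d0 + c0 * z0) / (a0 - c0 * w).
  pose W z := (z - z0) * k z.
  have idz := cvgC_id z0.
  have cden : (fun z => c0 * z + d0) @ nbhs z0 --> c0 * z0 + d0.
    exact: (cvgCD (cvgCM (cvgC_cst c0) idz) (cvgC_cst d0)).
  have ck : k @ nbhs z0 --> k z0.
    exact: (cvgCM (cvgC_cst a0) (cvgCV den0 cden)).
  have cW : W @ nbhs z0 --> (0 : R[i]).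
    have -> : (0 : R[i]) = (z0 + - z0) * k z0 by rewrite subrr mul0r.
    exact: (cvgCM (cvgCD idz (cvgC_cst (- z0))) ck).
  have cl0 : (fun z => a0 + - c0 * W z) @ nbhs z0 --> a0 + - c0 * 0.
    exact: (cvgCD (cvgC_cst a0) (cvgCM (cvgC_cst (- c0)) cW)).
  have l00 : a0 + - c0 * 0 != 0 by rewrite mulr0 addr0.
  have cl : (fun z => l (W z)) @ nbhs z0 --> l 0.
    have -> : l 0 = (d0 + c0 * z0) * (a0 + - c0 * 0)^-1 by rewrite /l mulNr.
    have -> : (fun z => l (W z)) =
        (fun z => (d0 + c0 * z0) * (a0 + - c0 * W z)^-1).
      by apply/funext => z; rewrite /l mulNr.
    exact: (cvgCM (cvgC_cst (d0 + c0 * z0)) (cvgCV l00 cl0)).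
  have cqW : (fun z => q (W z)) @ nbhs z0 --> q 0.
    move=> A nA; exact: (cW (fun w => A (q w)) (cq A nA)).
  have hqW : \forall z \near nbhs z0, h (Some (W z)) = Some (W z * q (W z)).
    exact: (cW _ hq).
  have cWq : (fun z => W z * q (W z)) @ nbhs z0 --> 0 * q 0.
    exact: (cvgCM cW cqW).
  have cW2 : (fun z => a0 + - c0 * (W z * q (W z))) @ nbhs z0 -->
      a0 + - c0 * (0 * q 0).
    exact: (cvgCD (cvgC_cst a0) (cvgCM (cvgC_cst (- c0)) cWq)).
  have l02 : a0 + - c0 * (0 * q 0) != 0 by rewrite mul0r mulr0 addr0.
  pose m z := k z * q (W z) * ((d0 + c0 * z0) * (a0 + - c0 * (W z * q (W z)))^-1).
  have cm : m @ nbhs z0 --> q 0.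
    have -> : q 0 = k z0 * q 0 * ((d0 + c0 * z0) * (a0 + - c0 * (0 * q 0))^-1).
      rewrite mul0r mulr0 addr0 /k [d0 + _]addrC; field.
      by rewrite a00 den0.
    apply: (cvgCM (cvgCM ck cqW)
                  (cvgCM (cvgC_cst (d0 + c0 * z0)) (cvgCV l02 cW2))).
  have ndens := cvgC_neq0 den0 cden.
  have ndens2 := cvgC_neq0 l02 cW2.
  (* m is the difference quotient of f0 at z0, written through the chart *)
  have FE : \forall z \near nbhs z0, f0 (Some z) = Some (z0 + (z - z0) * m z).
    apply: filterS3 ndens ndens2 hqW => z n1 n2 hz.
    have -> : f0 (Some z) = chi0' (h (chi0 (Some z))) by rewrite F.
    have -> : chi0 (Some z) = Some (W z).
      rewrite E /= pt_Some // /W /k num0; congr Some; field; exact: n1.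
    rewrite hz E' /= pt_Some; last by rewrite addrC.
    rewrite [- c0 * _ + a0]addrC num0; congr Some.
    apply: (mulIf n2); rewrite divfK // mulrDl.
    have -> : (z - z0) * m z * (a0 + - c0 * (W z * q (W z))) =
       W z * q (W z) * (d0 + c0 * z0).
      rewrite /m /W; field; exact: n2.
    ring.
  rewrite /multiplier; apply: (derive1_factor (m := m)) => //.
  - by rewrite (nbhs_singleton FE) /= subrr mul0r addr0.
  - by apply: filterS FE => z ->.
case: x chix fx => [z0|] chix fx; first exact: (fin f chi chi' a b c d).
rewrite multiplier_None.
apply: (fin _ (chi \o sinv) (sinv \o chi') b a d c).
- by rewrite -oppr_eq0 opprB.
- apply/funext => s; have [u [v [n ->]]] := ptP s.
  have n' : nonzero2 v u by move: n; rewrite /nonzero2 orbC.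
  by rewrite /= sinv_pt // chiE !mob_pt //; congr pt; ring.
- apply/funext => s; have [u [v [n ->]]] := ptP s.
  rewrite /= chi'E mob_pt // sinv_pt; last first.
    apply: mob_nonzero => //; rewrite (_ : _ - _ = a * d - b * c) //; ring.
  rewrite mob_pt // -(pt_scale _ _ (k := -1)) ?oppr_eq0 ?oner_eq0 //.
  congr pt; ring.
- by rewrite fE.
- by rewrite /= eqxx.
Qed.

End Multiplier.

Section Linearizable.
Context {R : realType}.
Implicit Types (f phi psi : sphere R -> sphere R) (x : sphere R).

(** The form in which attracting fixed points are exhibited. Unlike the
    multiplier, a derivative taken in one of two charts, it passes to conjugates
    by merely composing charts. *)
Definition linearly_attracting f x : Prop :=
  exists (a b c d : R[i]) h chi (q : R[i] -> R[i]),
  [/\ a * d - b * c != 0,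
      cancel (mob a b c d) chi /\ cancel chi (mob a b c d),
      f = chi \o h \o mob a b c d /\ mob a b c d x = Some 0,
      (\forall w \near nbhs (0 : R[i]), h (Some w) = Some (w * q w)) /\
      q @ nbhs (0 : R[i]) --> q 0
    & nc (q 0) < 1].

Lemma linearly_attracting_fixed f x :
  linearly_attracting f x -> attracting_fixed_point f x.
Proof.
move=> [a [b [c [d [h [chi [q [D [K1 K2] [fE fx] [hq cq] q1]]]]]]]].
have [E M] := multiplier_linearized D (erefl _) K1 K2 fE fx hq cq.
by split => //; rewrite M normc_nc ltcR.
Qed.

Lemma linearly_attracting_conj f x psi (a b c d : R[i]) :
  a * d - b * c != 0 -> cancel (mob a b c d) psi -> cancel psi (mob a b c d) ->
  linearly_attracting f x ->
  linearly_attracting (mob a b c d \o f \o psi) (mob a b c d x).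
Proof.
move=> D phiK psiK [a' [b' [c' [d' [h [chi [q [D' [K1 K2] [fE fx] [hq cq] q1]]]]]]]].
have psiE : psi = mob d (- b) (- c) a.
  by apply/funext => s; apply: (can_inj phiK); rewrite psiK mobVK.
have D2 : d * a - - b * - c != 0 by rewrite (_ : _ - _ = a * d - b * c) //; ring.
have E : mob a' b' c' d' \o psi =
    mob (a' * d + b' * - c) (a' * - b + b' * a) (c' * d + d' * - c) (c' * - b + d' * a).
  by apply/funext => s; rewrite /= psiE mob_comp.
exists (a' * d + b' * - c), (a' * - b + b' * a), (c' * d + d' * - c), (c' * - b + d' * a).
exists h, (mob a b c d \o chi), q; rewrite -E; split => //.
- rewrite (_ : _ - _ = (a' * d' - b' * c') * (a * d - b * c)); last by ring.
  by rewrite mulf_neq0.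
- by split => s /=; rewrite ?K1 ?psiK ?phiK ?K2.
- by split; [rewrite fE|rewrite /= phiK fx].
Qed.

End Linearizable.

(** * The totally disconnected case *)

Section CantorCase.
Context {R : realType}.
Variables a b E : R.
Hypotheses (a0 : 0 < a) (b0 : 0 < b) (EE : E = a + b).
Implicit Types (z w : R[i]) (s : sphere R) (x y : R).

Let E0 : 0 < E. Proof. by rewrite EE addr_gt0. Qed.

(** This is z |-> z + 1 / (a / z + b / (z - 1)). *)
Definition cmap : sphere R -> sphere R :=
  qmap (E%:C + 1) (- (a%:C + 1)) 0 0 E%:C (- a%:C).

Lemma cmap_none : cmap None = None.
Proof. exact: pt0. Qed.

Lemma cmapE z : E%:C * z - a%:C != 0 ->
  cmap (Some z) = Some (z + z * (z - 1) / (E%:C * z - a%:C)).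
Proof.
move=> d0; rewrite /cmap /= mul0r add0r addr0 pt_Some //.
congr Some; field; exact: d0.
Qed.

Lemma cmap_continuous : continuous cmap.
Proof.
apply: qmap_continuous => x y n; apply: contraT => /nonzero2P.
rewrite !mul0r addr0 add0r => -[H1 H2].
have y0 : y = 0.
  apply: contrapT => /eqP y0; have H3 : E%:C * x = a%:C * y.
    apply/eqP; rewrite -subr_eq0; apply/eqP.
    apply: (mulIf y0); rewrite mul0r -H2; ring.
  have H4 : (E%:C * x) ^+ 2 = E%:C * x * (E%:C * y).
    have : ((E%:C * x) ^+ 2 - E%:C * x * (E%:C * y)) =
      E%:C ^+ 2 * ((E%:C + 1) * x ^+ 2 + - (a%:C + 1) * x * y)
      - E%:C ^+ 2 * x * (E%:C * x - a%:C * y) by ring.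
    by rewrite H1 H3 subrr !mulr0 subr0 => /eqP; rewrite subr_eq0 => /eqP.
  move: H4; rewrite H3 => H4; have : (a * (a - E))%:C * (y ^+ 2) = 0.
    rewrite rmorphM rmorphB; have -> : a%:C * (a%:C - E%:C) * y ^+ 2 =
      (a%:C * y) ^+ 2 - a%:C * y * (E%:C * y) by ring.
    by rewrite H4 subrr.
  move/eqP; rewrite mulf_eq0 expf_eq0 /= (negbTE y0) orbF.
  rewrite (inj_eq (@complexI R)) mulf_eq0 (gt_eqF a0) /= EE opprD addrA subrr.
  by rewrite sub0r oppr_eq0 gt_eqF.
move: H1 n; rewrite y0 !mulr0 addr0 /nonzero2 eqxx orbF => /eqP.
rewrite mulf_eq0 expf_eq0 /= (_ : (E%:C + 1 == 0) = false) /=; last first.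
  by rewrite -(rmorph1 (real_complex R)) -rmorphD (inj_eq (@complexI R)) gt_eqF // addr_gt0.
by move=> ->.
Qed.

(** The common expansion factor of the imaginary part and of the real
    differences. *)
Let k := 1 + E^-1.

Lemma k_gt1 : 1 < k.
Proof. by rewrite ltrDl invr_gt0. Qed.

(** 1/(a/z + b/(z-1)) has imaginary part at least Im z / E, by
    Cauchy-Schwarz. *)
Lemma cmap_Im z : complex.Im z != 0 -> exists z', cmap (Some z) = Some z' /\
  complex.Im z' != 0 /\ k * `|complex.Im z| <= `|complex.Im z'|.
Proof.
case: z => x y; rewrite [complex.Im _]/= => y0.
have d0 : E%:C * (x +i* y) - a%:C != 0.
  apply/eqP => H; have : complex.Im (E%:C * (x +i* y) - a%:C) = E * y.
    by rewrite /=; ring.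
  by rewrite H /= => /esym/eqP; rewrite mulf_eq0 (gt_eqF E0) (negbTE y0).
pose w := (x +i* y) * (x +i* y - 1) / (E%:C * (x +i* y) - a%:C).
exists ((x +i* y) + w); split; first exact: cmapE.
have : w * (E%:C * (x +i* y) - a%:C) = (x +i* y) * (x +i* y - 1).
  by rewrite /w divfK.
case: w => u v /eqP; rewrite eq_complex /= => /andP[/eqP H1 /eqP H2].
pose n := (E * x - a) ^+ 2 + (E * y) ^+ 2.
have n0 : 0 < n.
  by rewrite /n ltr_wpDl ?sqr_ge0 // exprn_even_gt0 //= mulf_neq0 // gt_eqF.
have vn : v * n = y * (E * (x ^+ 2 + y ^+ 2) - 2 * a * x + a).
  transitivity ((E * x - a) * (u * (E * y + 0 * x - 0) + v * (E * x - 0 * y - a))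
     - E * y * (u * (E * x - 0 * y - a) - v * (E * y + 0 * x - 0))).
    rewrite /n; ring.
  rewrite H1 H2; ring.
pose c := (E * (x ^+ 2 + y ^+ 2) - 2 * a * x + a) / n.
have vE : v = y * c by rewrite /c mulrA -vn mulfK // gt_eqF.
have cE : E^-1 <= c.
  rewrite /c ler_pdivlMr // mulrC ler_pdivrMr // -subr_ge0.
  have -> : (E * (x ^+ 2 + y ^+ 2) - 2 * a * x + a) * E - n = a * b.
    rewrite /n EE; ring.
  by rewrite mulr_ge0 ?ltW.
have c0 : 0 < c by apply: lt_le_trans cE; rewrite invr_gt0.
have -> : y + v = (1 + c) * y by rewrite vE; ring.
split; first by rewrite mulf_neq0 // gt_eqF // addr_gt0.
rewrite normrM (gtr0_norm (_ : 0 < 1 + c)) ?addr_gt0 // ler_wpM2r //.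
by rewrite lerD2l.
Qed.

Lemma cmap_real x : E * x - a != 0 ->
  cmap (Some x%:C) = Some (x + x * (x - 1) / (E * x - a))%:C.
Proof.
move=> d0; rewrite cmapE; last first.
  by rewrite -rmorphM -rmorphB (inj_eq (@complexI R)) d0.
congr Some; rewrite !rmorphD !rmorphM fmorphV !rmorphB rmorphM rmorph1 //.
Qed.

(** On the real axis the map pushes points outside [0,1] away from it: 0 and 1
    are repelling and infinity is the only other fixed point. *)
Lemma cmap_gt1 x : 1 < x -> exists2 x', cmap (Some x%:C) = Some x'%:C &
  k * (x - 1) <= x' - 1.
Proof.
move=> x1; have d0 : 0 < E * x - a.
  rewrite subr_gt0; apply: (@lt_le_trans _ _ E); first by rewrite EE ltrDl.
  by rewrite ler_peMr ?ltW.
exists (x + x * (x - 1) / (E * x - a)); first by rewrite cmap_real ?gt_eqF.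
have H : (x - 1) / E <= x * (x - 1) / (E * x - a).
  rewrite ler_pdivrMr // mulrAC ler_pdivlMr // -subr_ge0.
  have -> : x * (x - 1) * E - (x - 1) * (E * x - a) = a * (x - 1) by ring.
  by rewrite mulr_ge0 ?ltW // subr_gt0.
rewrite /k; lra.
Qed.

Lemma cmap_lt0 x : x < 0 -> exists2 x', cmap (Some x%:C) = Some x'%:C &
  k * (- x) <= - x'.
Proof.
move=> x0; have d0 : 0 < a - E * x.
  by rewrite subr_gt0 (lt_trans _ a0) // pmulr_rlt0.
exists (x + x * (x - 1) / (E * x - a)).
  by rewrite cmap_real // -oppr_eq0 opprB gt_eqF.
have -> : - (x + x * (x - 1) / (E * x - a)) = - x + x * (x - 1) / (a - E * x).
  rewrite opprD; congr (_ + _); rewrite -[E * x - a]opprB invrN; ring.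
have H : - x / E <= x * (x - 1) / (a - E * x).
  rewrite ler_pdivrMr // mulrAC ler_pdivlMr // -subr_ge0.
  have -> : x * (x - 1) * E - - x * (a - E * x) = - x * b by rewrite EE; ring.
  by rewrite mulr_ge0 ?ltW // oppr_gt0.
rewrite /k; lra.
Qed.

Lemma pow_unbounded (c y : R) : 1 < c -> exists n, y < c ^+ n.
Proof.
move=> c1; have c10 : 0 < c - 1 by rewrite subr_gt0.
have [n Hn] : exists n : nat, y / (c - 1) < n%:R.
  exists (Num.truncn (y / (c - 1))).+1; exact: truncnS_gt.
exists n; apply: (@lt_le_trans _ _ (1 + n%:R * (c - 1))).
  by rewrite ltr_pdivrMr // in Hn; rewrite (lt_trans Hn) // ltrDr.
elim: n {Hn} => [|n IH]; first by rewrite mul0r addr0 expr0.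
rewrite exprS; apply: (@le_trans _ _ (c * (1 + n%:R * (c - 1)))).
  have : 0 <= n%:R * (c - 1) ^+ 2 :> R by rewrite mulr_ge0 ?ler0n ?sqr_ge0.
  rewrite -natr1; nra.
by rewrite ler_pM2l // (lt_trans ltr01).
Qed.

(** A neighbourhood of infinity where |cmap z| >= (1 + 1/(2E)) |z|. *)
Definition far s : Prop := if s is Some z then 4 * a + 3 < nc z else True.

Let l := 1 + (2 * E)^-1.

Lemma far_step z : far (Some z) ->
  cmap (Some z) = None \/
  exists2 z', cmap (Some z) = Some z' & l * nc z <= nc z'.
Proof.
move=> /= zf; rewrite /cmap /= addr0 mul0r add0r /pt.
case: eqVneq => [//|d0]; [by left|right].
eexists; first by [].
rewrite ncM ncV ler_pdivlMr ?nc_gt0 //.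
have H1 : nc (E%:C * z - a%:C) <= E * nc z + a.
  apply: le_trans (nc_triangle _ _) _; rewrite ncM ncN !nc_real.
  by rewrite !ger0_norm // ltW.
have H2 : nc z * ((E + 1) * nc z - (a + 1)) <=
    nc ((E%:C + 1) * z ^+ 2 + - (a%:C + 1) * z).
  have -> : (E%:C + 1) * z ^+ 2 + - (a%:C + 1) * z =
      z * ((E + 1)%:C * z - (a + 1)%:C) by rewrite !rmorphD rmorph1; ring.
  rewrite ncM ler_wpM2l ?nc_ge0 //; apply: le_trans (nc_triangleB _ _).
  by rewrite ncM !nc_real !gtr0_norm ?addr_gt0.
apply: le_trans H2; rewrite [l * _]mulrC -mulrA ler_wpM2l ?nc_ge0 //.
apply: (@le_trans _ _ (l * (E * nc z + a))).
  by rewrite ler_wpM2l // addr_ge0 ?invr_ge0 ?mulr_ge0 ?ltW.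
rewrite -subr_ge0.
have -> : (E + 1) * nc z - (a + 1) - l * (E * nc z + a) =
   nc z / 2 - (2 * a + 1 + (a / E) / 2).
  by rewrite /l; field; rewrite gt_eqF.
have : a / E <= 1 by rewrite ler_pdivrMr // mul1r EE lerDl ltW.
lra.
Qed.

Lemma far_attracted s : far s -> attracted cmap None s.
Proof.
move=> fs; exists far; split.
  case: s fs => [z|] /= zf; last by apply/nbhs_None; split => //; exists (4 * a + 3).
  apply/nbhs_Some; exists (nc z - (4 * a + 3)); first by rewrite subr_gt0.
  move=> w wz /=; have := nc_triangleB z w; rewrite nc_sub => H; lra.
move=> W /nbhs_None [WN [r rW]].
have l1 : 1 < l by rewrite ltrDl invr_gt0 mulr_gt0.
have [N HN] := pow_unbounded r l1; exists N => n y nN fy.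
have H : iter n cmap y = None \/
    exists2 z', iter n cmap y = Some z' & far (Some z') /\ l ^+ n <= nc z'.
  elim: n {nN} => [|n IH].
    case: y fy => [z|] zf; [right|by left].
    by exists z => //; split => //; rewrite expr0; move: zf a0 => /=; lra.
  case: IH => /= [->|[z' -> [zf zl]]]; first by left; exact: cmap_none.
  have [->|[z'' -> H]] := far_step zf; [by left|right].
  exists z'' => //; split.
    apply: lt_le_trans H; rewrite /= in zf; apply: (lt_le_trans zf).
    by rewrite ler_peMl ?nc_ge0 // ltW.
  by rewrite exprS; apply: le_trans H; rewrite ler_pM2l // (lt_trans ltr01).
case: H => [->//|[z' -> [_ zl]]]; apply: rW; apply: lt_le_trans HN _.
by apply: le_trans zl; rewrite ler_eXn2l.
Qed.

(** A quantity that grows geometrically along an orbit and is dominated by the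
    modulus pushes that orbit to infinity. *)
Lemma growth_attracted (P : R[i] -> Prop) (G : R[i] -> R) z :
  (forall z, P z -> 0 < G z /\ G z <= nc z) ->
  (forall z, P z -> exists z', [/\ cmap (Some z) = Some z', P z' & k * G z <= G z']) ->
  P z -> attracted cmap None (Some z).
Proof.
move=> HG Hstep Pz.
have Hn n : exists z', [/\ iter n cmap (Some z) = Some z', P z' & k ^+ n * G z <= G z'].
  elim: n => [|n [z' [E1 Pz' H]]]; first by exists z; rewrite expr0 mul1r.
  have [z'' [E2 P2 H2]] := Hstep _ Pz'; exists z''; split => //.
    by rewrite iterS E1.
  rewrite exprS -mulrA; apply: le_trans H2.
  by rewrite ler_pM2l // (lt_trans ltr01) ?k_gt1.
have [G0 _] := HG z Pz.
have [n Hkn] := pow_unbounded ((4 * a + 3) / G z) k_gt1.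
have [z' [En Pz' H]] := Hn n.
have : attracted cmap None (iter n cmap (Some z)).
  apply: far_attracted; rewrite En /=.
  rewrite ltr_pdivrMr // in Hkn; apply: (lt_le_trans Hkn).
  exact: le_trans H (HG _ Pz').2.
elim: n {Hkn En H} => //= n IH H; apply: IH.
exact: (basin_preimage cmap_continuous).
Qed.

Definition unit_interval s : Prop := exists2 x : R, 0 <= x <= 1 & s = Some x%:C.

Definition cantor : set (sphere R) := [set s | forall n, unit_interval (iter n cmap s)].

Lemma off_unit_attracted s : ~ unit_interval s -> attracted cmap None s.
Proof.
case: s => [z|] nz; last exact: far_attracted.
have [y0|y0] := eqVneq (complex.Im z) 0; last first.
  apply: (@growth_attracted (fun z => complex.Im z != 0) (fun z => `|complex.Im z|)) => //.
    by move=> w w0; rewrite normr_gt0 Im_le_nc.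
  by move=> w /cmap_Im [w' [-> [w'0 H]]]; exists w'.
have zE : z = (complex.Re z)%:C by case: z y0 {nz} => x y /= ->.
have [x1|x1] := ltP 1 (complex.Re z).
  rewrite zE; apply: (@growth_attracted
    (fun w => exists2 x, w = x%:C & 1 < x) (fun w => complex.Re w - 1)).
  - move=> w [x -> x1'] /=; rewrite subr_gt0 expr0n addr0 sqrtr_sqr; split => //.
    by apply: le_trans (ler_norm x); rewrite lerBlDr lerDl.
  - move=> w [x -> /[dup] x1' /cmap_gt1 [x' -> H]]; exists x'%:C; split => //.
    exists x' => //; rewrite -subr_gt0; apply: lt_le_trans H.
    by rewrite mulr_gt0 ?subr_gt0 // (lt_trans ltr01) ?k_gt1.
  - by exists (complex.Re z).
have [x0|x0] := ltP (complex.Re z) 0.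
  rewrite zE; apply: (@growth_attracted
    (fun w => exists2 x, w = x%:C & x < 0) (fun w => - complex.Re w)).
  - move=> w [x -> x1'] /=; rewrite oppr_gt0 expr0n addr0 sqrtr_sqr; split => //.
    by rewrite -normrN; apply: ler_norm.
  - move=> w [x -> /[dup] x1' /cmap_lt0 [x' -> H]]; exists x'%:C; split => //.
    exists x' => //; rewrite -oppr_gt0; apply: lt_le_trans H.
    by rewrite mulr_gt0 ?oppr_gt0 // (lt_trans ltr01) ?k_gt1.
  - by exists (complex.Re z).
by case: nz; exists (complex.Re z); [rewrite x0 x1|rewrite -zE].
Qed.

Definition disc2 : set (sphere R) := [set s | if s is Some z then nc z < 2 else False].

Lemma cantor_dichotomy : dichotomy cmap None None cantor disc2.
Proof.
have W2 : exists2 W, nbhs (None : sphere R) W & forall s, W s -> ~ disc2 s.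
  exists (fun s => if s is Some z then 2 < nc z : Prop else True).
    by apply/nbhs_None; split => //; exists 2.
  by case=> [z z2|_ []]; move=> /(lt_trans z2); rewrite ltxx.
split => //.
- exact: cmap_continuous.
- move=> s; rewrite /cantor /= -existsNP => -[n nn]; left.
  have : attracted cmap None (iter n cmap s) by exact: off_unit_attracted.
  by elim: n {nn} => //= n IH H; apply: IH; exact: (basin_preimage cmap_continuous).
- by move=> s Ks n; rewrite -iterSr; exact: Ks.
- move=> s W Ks nW; have [x _ sx] := Ks 0%N; rewrite /= in sx.
  move: nW; rewrite sx => /nbhs_Some [e e0 eW].
  exists (Some (x +i* (e / 2))).
    apply: eW; apply: le_lt_trans (nc_le_ReIm _) _ => /=.
    by rewrite subrr normr0 add0r oppr0 addr0 gtr0_norm ?divr_gt0 //; lra.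
  move=> /(_ 0%N) /= [x' _ [_ /eqP]]; rewrite gt_eqF // divr_gt0 //.
- rewrite openE => -[z|//] /= z2; apply/nbhs_Some.
  exists (2 - nc z); first by rewrite subr_gt0.
  by move=> w wz /=; have := nc_triangleB w z; lra.
- move=> s /(_ 0%N) [x /andP[x0 x1] /= ->] /=.
  by rewrite expr0n addr0 sqrtr_sqr ger0_norm //; lra.
Qed.

(** The basin contains everything off the segment [0,1], so a point joins
    infinity along a vertical ray, which leaves the real axis at once; the
    parametrization by a projective line includes the end point. *)
Lemma cantor_basin_connected : connected (basin cmap None).
Proof.
pose ray (x y e t : R) : sphere R := pt ((x * (1 - t)) +i* (y * (1 - t) + e * t)) (1 - t)%:C.
have cray x y e : e != 0 -> continuous (ray x y e).
  move=> e0 t; apply: pt_cvg.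
  - rewrite /nonzero2; case: (eqVneq t 1) => [->|t1].
      by rewrite subrr mulr0 mulr0 add0r mulr1 eq_complex /= (negbTE e0) andbF.
    apply/orP; right; rewrite (inj_eq (@complexI R)) subr_eq0 eq_sym //.
  - have c1 : (fun t : R => 1 - t) @ t --> 1 - t.
      by apply: cvgB; [exact: cvg_cst|exact: cvg_id].
    apply: cvg_complex; first by apply: cvgMr.
    by apply: cvgD; [exact: cvgMr|apply: cvgMr; exact: cvg_id].
  - apply: cvg_complex; last exact: cvg_cst.
    by apply: cvgB; [exact: cvg_cst|exact: cvg_id].
have Bray x y e t : t <= 1 -> y * (1 - t) + e * t != 0 ->
    basin cmap None (ray x y e t).
  move=> t1 n; have [->|tn1] := eqVneq t 1.
    by rewrite /ray subrr pt0; apply: far_attracted.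
  have t1' : 0 < 1 - t by rewrite subr_gt0 lt_neqAle tn1.
  have tC : (1 - t)%:C != 0 by rewrite (inj_eq (@complexI R)) gt_eqF.
  apply: off_unit_attracted => -[r _].
  rewrite /ray pt_Some // => /Some_inj H.
  have : (x * (1 - t)) +i* (y * (1 - t) + e * t) = (r * (1 - t))%:C.
    by rewrite (rmorphM (real_complex R)) /= -H divfK.
  by case=> _ /eqP; rewrite (negbTE n).
pose good (p : R * R * R) := p.2 != 0 /\
  ray p.1.1 p.1.2 p.2 @` `[0, 1] `<=` basin cmap None.
have -> : basin cmap None =
    \bigcup_(p in good) (ray p.1.1 p.1.2 p.2 @` `[0, 1]%classic).
  apply/seteqP; split => s; last by move=> [p [_ gp] ps]; exact: gp.
  case: s => [z|] Bs.
    pose e : R := if 0 <= complex.Im z then 1 else -1.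
    have e0 : e != 0 by rewrite /e; case: ifP; rewrite ?oppr_eq0 oner_eq0.
    have ray0 : ray (complex.Re z) (complex.Im z) e 0 = Some z.
      by rewrite /ray subr0 !mulr1 mulr0 addr0 pt1; case: z {e e0 Bs}.
    exists (complex.Re z, complex.Im z, e) => /=; last first.
      by exists 0 => //; rewrite /= in_itv /= lexx ler01.
    split => //= _ [t /= /[!in_itv] /= /andP[t0 t1] <-].
    have [->|tn0] := eqVneq t 0; first by rewrite ray0.
    have t0' : 0 < t by rewrite lt_neqAle eq_sym tn0.
    apply: Bray => //; rewrite /e; case: ifP => [y0|/negbT].
      have : 0 <= complex.Im z * (1 - t) by rewrite mulr_ge0 // subr_ge0.
      by move=> H; rewrite gt_eqF //; lra.
    rewrite -ltNge => y0.
    have : complex.Im z * (1 - t) <= 0 by rewrite mulr_le0_ge0 ?subr_ge0 // ltW.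
    by move=> H; rewrite lt_eqF //; lra.
  exists (0, 1, 1) => /=; last first.
    exists 1; first by rewrite /= in_itv /= lexx ler01.
    by rewrite /ray subrr pt0.
  split => /=; first exact: oner_neq0.
  move=> _ [t /= /[!in_itv] /= /andP[t0 t1] <-]; apply: Bray => //.
  by rewrite !mul1r subrK oner_neq0.
apply: bigcup_connected.
  exists None => -[[x y] e] [/= e0 _]; exists 1.
    by rewrite /= in_itv /= lexx ler01.
  by rewrite /ray subrr pt0.
move=> [[x y] e] [/= e0 _]; apply: connected_continuous_connected.
  exact: segment_connected.
by apply: continuous_subspaceT; exact: cray.
Qed.

(** A connected part of the invariant set is an interval of [0,1]. It avoids the
    pole a/E, where the orbit would leave the segment, so the two end points lie
    on one side of the pole and are moved apart by the factor k. Iterating, an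
    interval of positive length would outgrow [0,1]. *)
Lemma cantor_totally_disconnected : totally_disconnected cantor.
Proof.
have gap (A : set (sphere R)) (x y c : R) : connected A -> A `<=` cantor ->
    A (Some x%:C) -> A (Some y%:C) -> x < c -> c < y -> A (Some c%:C).
  move=> cA AK Ax Ay xc cy; apply: contrapT => nAc.
  pose L : set (sphere R) := [set s | if s is Some z then complex.Re z < c else False].
  pose H : set (sphere R) := [set s | if s is Some z then c < complex.Re z else False].
  have oL : open L.
    rewrite openE => -[z|//] /= zc; apply/nbhs_Some; exists (c - complex.Re z).
      by rewrite subr_gt0.
    move=> w wz /=; have := Re_le_nc (w - z); rewrite raddfB /= => h.
    by have := ler_norm (complex.Re w - complex.Re z); lra.
  have oH : open H.
    rewrite openE => -[z|//] /= zc; apply/nbhs_Some; exists (complex.Re z - c).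
      by rewrite subr_gt0.
    move=> w wz /=; have := Re_le_nc (w - z); rewrite raddfB /= => h.
    by have := ler_norm (- (complex.Re w - complex.Re z)); rewrite normrN; lra.
  have E1 : A `&` L = A.
    apply: cA.
    - by exists (Some x%:C).
    - by exists L.
    - exists (~` H); first by rewrite closedC.
      apply/seteqP; split => s [As sL]; split => //.
        by case: s sL {As} => //= z h1 /(lt_trans h1); rewrite ltxx.
      have [x' _ sx] := AK _ As 0%N; rewrite /= in sx; rewrite sx /= in As sL *.
      rewrite lt_neqAle; apply/andP; split; last by rewrite leNgt; apply/negP.
      by apply/eqP => xc'; rewrite xc' in As.
  have : (A `&` L) (Some y%:C) by rewrite E1.
  by move=> [_ /=] /(lt_trans cy); rewrite ltxx.
have expand n : forall (A : set (sphere R)) (x y : R), connected A -> A `<=` cantor ->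
    A (Some x%:C) -> A (Some y%:C) -> x < y -> k ^+ n * (y - x) <= 1.
  elim: n => [|n IH] A x y cA AK Ax Ay xy.
    have [x' /andP[x0 _] [xE]] := AK _ Ax 0%N; have [y' /andP[_ y1] [yE]] := AK _ Ay 0%N.
    by rewrite expr0 mul1r; lra.
  have pole (u : R) : A (Some u%:C) -> E * u - a != 0.
    move=> Au; apply/eqP => H; have [v _] := AK _ Au 1%N.
    have EuC : E%:C * u%:C - a%:C = 0.
      by rewrite -(rmorphM (real_complex R)) -(rmorphB (real_complex R)) /= H.
    by rewrite /= /pt mul0r add0r EuC eqxx.
  have nx := pole _ Ax; have ny := pole _ Ay.
  have side : 0 < (E * x - a) * (E * y - a).
    rewrite lt_neqAle eq_sym mulf_neq0 //= leNgt; apply/negP => sg.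
    have [x1 y1] : E * x < a /\ a < E * y.
      have lt : E * x < E * y by rewrite ltr_pM2l.
      move: nx ny; rewrite !subr_eq0 => nx ny.
      have [h|h|h] := ltgtP (E * x) a; last by rewrite h eqxx in nx.
        split => //; have [h'|//|h'] := ltgtP (E * y) a.
          by move: sg; nra.
        by rewrite h' eqxx in ny.
      by move: sg; nra.
    have /pole : A (Some (a / E)%:C).
      apply: gap cA AK Ax Ay _ _; first by rewrite ltr_pdivlMr // mulrC.
      by rewrite ltr_pdivrMr // mulrC.
    by rewrite mulrCA (divff (lt0r_neq0 E0)) mulr1 subrr eqxx.
  pose F (u : R) := u + u * (u - 1) / (E * u - a).
  have cF (u : R) : A (Some u%:C) -> cmap (Some u%:C) = Some (F u)%:C.
    by move=> /pole; exact: cmap_real.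
  have FE : k * (y - x) <= F y - F x.
    have Q : F y - F x = (y - x) * (1 +
        (a * (1 - x) * (1 - y) + b * x * y) / ((E * x - a) * (E * y - a))).
      by rewrite /F EE; field; rewrite -EE nx ny.
    rewrite Q [k * _]mulrC ler_wpM2l ?subr_ge0 ?(ltW xy) // /k lerD2l.
    rewrite ler_pdivlMr // mulrC.
    rewrite ler_pdivrMr // -subr_ge0.
    have -> : (a * (1 - x) * (1 - y) + b * x * y) * E - (E * x - a) * (E * y - a) = a * b.
      by rewrite EE; ring.
    by rewrite mulr_ge0 ?ltW.
  have k0 : 0 < k := lt_trans ltr01 k_gt1.
  have Fxy : F x < F y.
    by rewrite -subr_gt0; apply: lt_le_trans FE; rewrite mulr_gt0 // subr_gt0.
  have := IH (cmap @` A) (F x) (F y).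
  rewrite exprSr -mulrA => H; apply: le_trans (H _ _ _ _ Fxy).
  - by rewrite ler_pM2l // exprn_gt0.
  - apply: connected_continuous_connected => //.
    by apply: continuous_subspaceT; exact: cmap_continuous.
  - by move=> _ [s As <-]; exact: (dicho_inv cantor_dichotomy (AK _ As)).
  - by exists (Some x%:C) => //; exact: cF.
  - by exists (Some y%:C) => //; exact: cF.
move=> s Ks; apply/seteqP; split; last first.
  by move=> _ ->; exact: connected_component_refl.
move=> t Ct; have cC := @component_connected _ cantor s.
have CK : connected_component cantor s `<=` cantor by exact: connected_component_sub.
have Cs : connected_component cantor s s by exact: connected_component_refl.
have [x _ sx] := CK _ Cs 0%N; have [y _ ty] := CK _ Ct 0%N.
rewrite /= in sx ty; rewrite sx in cC CK Cs Ct *; rewrite ty in Ct *.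
have nlt (u v : R) : connected_component cantor (Some x%:C) (Some u%:C) ->
    connected_component cantor (Some x%:C) (Some v%:C) -> ~ u < v.
  move=> Cu Cv uv; have vu0 : 0 < v - u by rewrite subr_gt0.
  have [n Hn] := pow_unbounded (v - u)^-1 k_gt1.
  have := expand n _ u v cC CK Cu Cv uv; apply/negP; rewrite -ltNge.
  by rewrite -ltr_pdivrMr // mul1r.
have [xy|xy|->//] := ltgtP x y; first by case: (nlt _ _ Cs Ct xy).
by case: (nlt _ _ Ct Cs xy).
Qed.

(** Infinity has weight 1 + E, hence multiplier E / (E + 1). *)
Lemma cmap_linearly_attracting : linearly_attracting cmap None.
Proof.
pose q (w : R[i]) := (E%:C - a%:C * w) / ((E%:C + 1) - (a%:C + 1) * w).
have nd : E%:C + 1 != 0.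
  by rewrite -(rmorph1 (real_complex R)) -rmorphD (inj_eq (@complexI R)) gt_eqF // addr_gt0.
have nd0 : E%:C + 1 + - (a%:C + 1) * 0 != 0 by rewrite mulr0 addr0.
have id0 := cvgC_id (0 : R[i]).
have cd : (fun w => E%:C + 1 + - (a%:C + 1) * w) @ nbhs (0 : R[i]) -->
    E%:C + 1 + - (a%:C + 1) * 0.
  exact: (cvgCD (cvgC_cst _) (cvgCM (cvgC_cst _) id0)).
have q0E : q 0 = (E%:C + - a%:C * 0) * (E%:C + 1 + - (a%:C + 1) * 0)^-1.
  by rewrite /q !mulNr.
exists 0, 1, 1, 0, (sinv \o cmap \o sinv), sinv, q.
have mE : mob 0 1 1 0 = @sinv R.
  apply/funext => s; have [x [y [n ->]]] := ptP s.
  by rewrite mob_pt // sinv_pt // !mul0r !mul1r add0r addr0.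
rewrite mE; split.
- by rewrite mul0r mul1r sub0r oppr_eq0 oner_neq0.
- by split; exact: sinvK.
- by split => //; apply/funext => s /=; rewrite !sinvK.
- split; last first.
    rewrite q0E; have -> : q = fun w => (E%:C + - a%:C * w) * (E%:C + 1 + - (a%:C + 1) * w)^-1.
      by apply/funext => w; rewrite /q !mulNr.
    exact: (cvgCM (cvgCD (cvgC_cst _) (cvgCM (cvgC_cst _) id0)) (cvgCV nd0 cd)).
  have := cvgC_neq0 nd0 cd; apply: filterS => w nw.
  have n1 : nonzero2 w 1 by rewrite /nonzero2 oner_neq0 orbT.
  have n2 : nonzero2 1 w by rewrite /nonzero2 oner_neq0.
  have -> : (sinv \o cmap \o sinv) (Some w) = sinv (cmap (sinv (pt w 1))).
    by rewrite pt1.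
  rewrite sinv_pt // /cmap qmap_pt //.
  have nw' : E%:C + 1 - (a%:C + 1) * w != 0 by rewrite -mulNr.
  have -> : (E%:C + 1) * 1 ^+ 2 + - (a%:C + 1) * 1 * w + 0 * w ^+ 2 =
    E%:C + 1 - (a%:C + 1) * w by ring.
  rewrite sinv_pt; last by apply/orP; left.
  by rewrite pt_Some //; congr Some; rewrite /q; field.
- rewrite /q !mulr0 !subr0 -(rmorph1 (real_complex R)) -rmorphD -fmorphV -rmorphM nc_real.
  by rewrite gtr0_norm ?divr_gt0 ?addr_gt0 // ltr_pdivrMr ?addr_gt0 // mul1r ltrDl.
Qed.

End CantorCase.

(** * Rational functions as maps of the sphere *)

Section FractionRepr.
Variable D : idomainType.
Local Open Scope quotient_scope.

Lemma frac_repr (r : {fraction D}) :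
  r = tofrac (generic_quotient.repr r).1 / tofrac (generic_quotient.repr r).2.
Proof.
set x := generic_quotient.repr r.
have -> : r = \pi_({fraction D}) x by rewrite reprK.
move: x => -[[n d] /= d0].
have dF : tofrac d != 0 by rewrite tofrac_eq0.
apply: (mulIf dF); rewrite divfK //.
unlock tofrac; rewrite -[LHS]FracField.pi_mul.
apply/eqmodP; rewrite /= FracField.equivfE /FracField.mulf /=.
by rewrite !numden_Ratio ?oner_neq0 ?mulr1 // mulrC.
Qed.

End FractionRepr.

Section RatMaps.
Context {R : realType}.
Implicit Types (r : ratfun R) (A B : {poly R[i]}).

Lemma rden_neq0 r : rden r != 0.
Proof.
rewrite /rden; set x := generic_quotient.repr r.
have d0 : x.2 != 0 by exact: denom_ratioP.
apply: contraNneq d0 => E.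
by rewrite -(divpK (dvdp_gcdr x.1 x.2)) E mul0r.
Qed.

Lemma rnum_rden_coprime r : coprimep (rnum r) (rden r).
Proof.
rewrite /rnum /rden; apply: coprimep_div_gcd; apply/orP; right.
exact: denom_ratioP.
Qed.

Lemma rnum_rden_frac r : r = tofrac (rnum r) / tofrac (rden r).
Proof.
have b := rden_neq0 r; rewrite /rden in b; rewrite /rnum /rden.
transitivity (tofrac (generic_quotient.repr r).1 /
              tofrac (generic_quotient.repr r).2); first exact: frac_repr.
set x := generic_quotient.repr r in b *.
have d0 : x.2 != 0 by exact: denom_ratioP.
apply/eqP; rewrite eqr_div ?tofrac_eq0 // -!tofracM tofrac_eq; apply/eqP.
have := divpK (dvdp_gcdl x.1 x.2); have := divpK (dvdp_gcdr x.1 x.2).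
set g := gcdp _ _; set n := (_ %/ _); set d := (_ %/ _) => <- <-; ring.
Qed.

Lemma frac_eq A B A' B' : B != 0 -> B' != 0 ->
  tofrac A / tofrac B = tofrac A' / tofrac B' :> ratfun R -> A * B' = A' * B.
Proof.
move=> b0 b'0 /eqP; rewrite eqr_div ?tofrac_eq0 // -!tofracM tofrac_eq.
by move/eqP.
Qed.

(** Numerators and denominators in lowest terms agree up to a constant, by the
    Gauss divisibility lemma. *)
Lemma lowest_terms A B : B != 0 -> coprimep A B ->
  exists2 c, c != 0 & rnum (tofrac A / tofrac B) = c *: A /\
                      rden (tofrac A / tofrac B) = c *: B.
Proof.
set r := _ / _ => b0 cAB.
have E : A * rden r = rnum r * B.
  by apply: frac_eq => //; [exact: rden_neq0|rewrite -rnum_rden_frac].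
have d1 : rden r %| B.
  rewrite -(Gauss_dvdpr _ (_ : coprimep (rden r) (rnum r))).
    by rewrite -E dvdp_mull.
  by rewrite coprimep_sym rnum_rden_coprime.
have d2 : B %| rden r.
  rewrite -(Gauss_dvdpr _ (_ : coprimep B A)); last by rewrite coprimep_sym.
  by rewrite E dvdp_mull.
have /eqpP [[c1 c2] /= /andP[c10 c20] cE] : rden r %= B by rewrite /eqp d1 d2.
have dE : rden r = (c2 / c1) *: B.
  by rewrite mulrC -scalerA -cE scalerA mulVf // scale1r.
exists (c2 / c1); first by rewrite mulf_neq0 ?invr_eq0.
split => //; apply: (mulIf b0); rewrite -E dE -scalerAl -scalerAr //.
Qed.

Lemma rdegree_frac A B : B != 0 -> coprimep A B ->
  rdegree (tofrac A / tofrac B) = (maxn (size A) (size B)).-1.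
Proof.
move=> b0 cAB; rewrite /rdegree.
have [c c0 [-> ->]] := lowest_terms b0 cAB.
by rewrite !size_scale.
Qed.

Lemma rmap_frac A B n : B != 0 -> coprimep A B ->
  (size A <= n.+1)%N -> (size B <= n.+1)%N -> nonzero2 A`_n B`_n ->
  rmap (tofrac A / tofrac B) =
  fun s : sphere R => if s is Some z then pt A.[z] B.[z] else pt A`_n B`_n.
Proof.
move=> b0 cAB sA sB nAB; apply/funext => s; rewrite /rmap.
have [c c0 [-> ->]] := lowest_terms b0 cAB.
case: s => [z|].
  rewrite !hornerZ /pt mulf_eq0 (negbTE c0) /=; case: eqVneq => // Bz.
  by congr Some; rewrite -mulf_div divff // mul1r.
rewrite !size_scale // lead_coefZ coefZ /pt.
case: (eqVneq B`_n 0) => [Bn|Bn].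
  move: nAB; rewrite /nonzero2 Bn eqxx orbF => An.
  have sBn : (size B <= n)%N.
    by rewrite -ltnS ltn_neqAle sB andbT; apply: contraNneq b0 => E;
      rewrite -lead_coef_eq0 lead_coefE E /= Bn.
  have sAn : (n < size A)%N.
    by rewrite ltnNge; apply: contra An => H; rewrite nth_default.
  by rewrite (leq_ltn_trans sBn sAn).
have sBn : size B = n.+1.
  apply/eqP; rewrite eqn_leq sB /= ltnNge; apply: contra Bn => H.
  by rewrite nth_default.
rewrite sBn ltnNge sA /=; congr Some.
by rewrite lead_coefE sBn /= -mulf_div divff // mul1r.
Qed.

Lemma rmap_mob (a b c d : R[i]) : a * d - b * c != 0 ->
  rmap (tofrac (a *: 'X + b%:P) / tofrac (c *: 'X + d%:P)) = mob a b c d.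
Proof.
move=> D.
have ev (u v z : R[i]) : (u *: 'X + v%:P).[z] = u * z + v by rewrite !hornerE.
have sz (u v : R[i]) : (size (u *: 'X + v%:P)%R <= 2)%N.
  rewrite (leq_trans (size_polyD _ _)) // geq_max size_polyC.
  rewrite (leq_trans (size_scale_leq _ _)) ?size_polyX //=.
  by case: (v != 0).
have c1 (u v : R[i]) : (u *: 'X + v%:P)`_1 = u.
  by rewrite coefD coefZ coefX coefC /= mulr1 addr0.
have c0 (u v : R[i]) : (u *: 'X + v%:P)`_0 = v.
  by rewrite coefD coefZ coefX coefC /= mulr0 add0r.
rewrite (@rmap_frac _ _ 1) ?sz //.
- by apply/funext => -[z|] /=; rewrite ?ev ?c1.
- apply: contraNneq D => E; have := c1 c d; have := c0 c d; rewrite E !coef0.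
  by move=> <- <-; rewrite !mulr0 subrr.
- apply: Pdiv.ClosedField.root_coprimep => z; rewrite /root ev => /eqP H1.
  rewrite ev; apply: contraNneq D => H2.
  have -> : a * d - b * c = a * (c * z + d) - c * (a * z + b) by ring.
  by rewrite H1 H2 !mulr0 subrr.
- rewrite !c1 /nonzero2 -negb_and; apply: contraNN D => /andP[/eqP-> /eqP->].
  by rewrite mul0r mulr0 subrr.
Qed.

Definition qpoly (a b c : R[i]) : {poly R[i]} := a *: 'X^2 + b *: 'X + c%:P.

Lemma qpolyE a b c z : (qpoly a b c).[z] = a * z ^+ 2 + b * z + c.
Proof. by rewrite /qpoly !hornerE. Qed.

Lemma size_qpoly a b c : (size (qpoly a b c) <= 3)%N.
Proof.
rewrite (leq_trans (size_polyD _ _)) // geq_max size_polyC.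
apply/andP; split; last by case: (c != 0).
rewrite (leq_trans (size_polyD _ _)) // geq_max.
rewrite (leq_trans (size_scale_leq _ _)) ?size_polyXn //=.
by rewrite (leq_trans (size_scale_leq _ _)) ?size_polyX.
Qed.

Lemma coef_qpoly a b c : [/\ (qpoly a b c)`_0 = c, (qpoly a b c)`_1 = b
  & (qpoly a b c)`_2 = a].
Proof.
by split; rewrite !coefD !coefZ coefXn coefX coefC /=
  ?(mulr0, mulr1, addr0, add0r).
Qed.

Lemma qpoly_eta A : (size A <= 3)%N -> A = qpoly A`_2 A`_1 A`_0.
Proof.
move=> sA; apply/polyP => i; have [h0 h1 h2] := coef_qpoly A`_2 A`_1 A`_0.
case: i => [|[|[|i]]]; rewrite ?h0 ?h1 ?h2 //.
have s1 : (size A <= i.+3)%N by exact: leq_trans sA _.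
have s2 : (size (qpoly A`_2 A`_1 A`_0)%R <= i.+3)%N.
  exact: leq_trans (size_qpoly _ _ _) _.
by rewrite [LHS]nth_default // [RHS]nth_default.
Qed.

Lemma rmap_qmap (a b c a' b' c' : R[i]) :
  qpoly a' b' c' != 0 -> coprimep (qpoly a b c) (qpoly a' b' c') ->
  nonzero2 a a' ->
  rmap (tofrac (qpoly a b c) / tofrac (qpoly a' b' c')) = qmap a b c a' b' c'.
Proof.
move=> n0 co n2; have [_ _ h] := coef_qpoly a b c.
have [_ _ h'] := coef_qpoly a' b' c'.
rewrite (@rmap_frac _ _ 2) ?size_qpoly ?h ?h' //.
by apply/funext => -[z|] /=; rewrite ?qpolyE.
Qed.

End RatMaps.

(** * Conjugacy classes of quadratic Newton maps *)

Section Conjugacy.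
Context {R : realType}.
Implicit Types (f g h : sphere R -> sphere R) (m n : int).

Lemma is_mobius_mob f : is_mobius f <->
  exists a b c d : R[i], a * d - b * c != 0 /\ f = mob a b c d.
Proof.
by split=> -[a [b [c [d [D E]]]]]; exists a, b, c, d; split; rewrite // E rmap_mob.
Qed.

Definition conj_by (a b c d : R[i]) f g :=
  a * d - b * c != 0 /\ forall s, f (mob a b c d s) = mob a b c d (g s).

Lemma conj_byP f g : conformally_conjugate f g <->
  exists a b c d, conj_by a b c d f g.
Proof.
split.
  move=> [phi [psi [/is_mobius_mob [a [b [c [d [D E]]]]] K1 K2 ->]]].
  by exists a, b, c, d; split => // s; rewrite -E /= K1.
move=> [a [b [c [d [D H]]]]].
exists (mob a b c d), (mob d (- b) (- c) a); split.
- by apply/is_mobius_mob; exists a, b, c, d.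
- exact: mobK.
- exact: mobVK.
- by apply/funext => s /=; rewrite -H mobVK.
Qed.

Lemma conj_sym f g : conformally_conjugate f g -> conformally_conjugate g f.
Proof.
move=> /conj_byP [a [b [c [d [D H]]]]]; apply/conj_byP.
exists d, (- b), (- c), a; split.
  by rewrite (_ : _ - _ = a * d - b * c) //; ring.
by move=> s; apply: (can_inj (mobK D)); rewrite -H !mobVK.
Qed.

Lemma conj_trans g f h : conformally_conjugate f g ->
  conformally_conjugate g h -> conformally_conjugate f h.
Proof.
move=> /conj_byP [a [b [c [d [D H]]]]] /conj_byP [a' [b' [c' [d' [D' H']]]]].
apply/conj_byP; exists (a * a' + b * c'), (a * b' + b * d'), (c * a' + d * c'), (c * b' + d * d').
split.
  rewrite (_ : _ - _ = (a * d - b * c) * (a' * d' - b' * c')) ?mulf_neq0 //; ring.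
by move=> s; rewrite -!mob_comp // H H'.
Qed.

(** z - 1 / (m / z + n / (z - 1)) : fixed points 0, 1, oo of weights m, n and
    1 - m - n, where the multiplier of a fixed point of weight w is 1 - 1/w. *)
Definition wmap (m n : R[i]) : sphere R -> sphere R :=
  qmap (m + n - 1) (1 - m) 0 0 (m + n) (- m).

Lemma conj_by_qmap (a b c d k a0 a1 a2 b0 b1 b2 a0' a1' a2' b0' b1' b2' : R[i]) :
  a * d - b * c != 0 -> k != 0 ->
  (forall x y, nonzero2 x y ->
     nonzero2 (a0' * x ^+ 2 + a1' * x * y + a2' * y ^+ 2)
              (b0' * x ^+ 2 + b1' * x * y + b2' * y ^+ 2)) ->
  (forall x y, let u := a * x + b * y in let v := c * x + d * y in
     let A := a0' * x ^+ 2 + a1' * x * y + a2' * y ^+ 2 in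
     let B := b0' * x ^+ 2 + b1' * x * y + b2' * y ^+ 2 in
     a0 * u ^+ 2 + a1 * u * v + a2 * v ^+ 2 = k * (a * A + b * B) /\
     b0 * u ^+ 2 + b1 * u * v + b2 * v ^+ 2 = k * (c * A + d * B)) ->
  conj_by a b c d (qmap a0 a1 a2 b0 b1 b2) (qmap a0' a1' a2' b0' b1' b2').
Proof.
move=> D k0 nz H; split => // s; have [x [y [n ->]]] := ptP s.
rewrite mob_pt // qmap_pt; last exact: mob_nonzero.
rewrite qmap_pt // mob_pt; last exact: nz.
by have [-> ->] := H x y; rewrite pt_scale.
Qed.

Lemma wmap_nonzero (m n x y : R[i]) : m != 0 -> n != 0 -> m + n - 1 != 0 ->
  nonzero2 x y ->
  nonzero2 ((m + n - 1) * x ^+ 2 + (1 - m) * x * y + 0 * y ^+ 2)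
           (0 * x ^+ 2 + (m + n) * x * y + - m * y ^+ 2).
Proof.
move=> m0 n0 mn; apply: contraTT => /nonzero2P [H1 H2].
have y0 : y = 0.
  apply/eqP; apply: contraT => y0.
  have E1 : (m + n) * x = m * y.
    apply: (mulIf y0); apply/eqP; rewrite -subr_eq0 -H2; apply/eqP; ring.
  have [x0|x0] := eqVneq x 0.
    move/eqP: E1; rewrite x0 mulr0 eq_sym mulf_eq0 (negbTE m0) /=.
    by rewrite (negbTE y0).
  have E2 : (m + n - 1) * x = (m - 1) * y.
    apply: (mulIf x0); apply/eqP; rewrite -subr_eq0 -H1; apply/eqP; ring.
  have xy : x = y.
    have -> : x = (m + n) * x - (m + n - 1) * x by ring.
    by rewrite E1 E2; ring.
  move/eqP: E1; rewrite xy -subr_eq0 -mulrBl addrC addKr mulf_eq0.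
  by rewrite (negbTE n0) (negbTE y0).
move/eqP: H1; rewrite y0 expr0n /= !mulr0 !addr0 mulf_eq0 (negbTE mn) /= expf_eq0 /=.
by move=> x0; rewrite /nonzero2 x0 eqxx.
Qed.

Lemma wmap_swap (m n : R[i]) : m != 0 -> n != 0 -> m + n - 1 != 0 ->
  conformally_conjugate (wmap m n) (wmap n m).
Proof.
move=> m0 n0 mn; apply/conj_byP; exists (-1), 1, 0, 1.
apply: (@conj_by_qmap _ _ _ _ (-1)).
- by rewrite mulr0 subr0 mulr1 oppr_eq0 oner_neq0.
- by rewrite oppr_eq0 oner_neq0.
- by move=> x y; apply: wmap_nonzero => //; rewrite [n + m]addrC.
- by move=> x y /=; split; ring.
Qed.

Lemma wmap_rotate (m n : R[i]) : m != 0 -> n != 0 -> m + n - 1 != 0 ->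
  conformally_conjugate (wmap m n) (wmap m (1 - m - n)).
Proof.
move=> m0 n0 mn; apply/conj_byP; exists 1, 0, 1, (-1).
apply: (@conj_by_qmap _ _ _ _ (-1)).
- by rewrite mul0r subr0 mul1r oppr_eq0 oner_neq0.
- by rewrite oppr_eq0 oner_neq0.
- move=> x y; apply: wmap_nonzero => //.
    by rewrite -oppr_eq0 (_ : - (1 - m - n) = m + n - 1) //; ring.
  by rewrite (_ : _ - 1 = - n) ?oppr_eq0 //; ring.
- by move=> x y /=; split; ring.
Qed.

Lemma weights_frac (A : comNzRingType) (F : fieldType) (phi : {rmorphism A -> F})
    (x m n : A) :
  phi x != 0 -> phi (x - 1) != 0 -> phi ((m + n) * x - m) != 0 ->
  phi x - 1 / (phi m / phi x + phi n / (phi x - 1)) =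
  phi ((m + n - 1) * x ^+ 2 + (1 - m) * x) / phi ((m + n) * x - m).
Proof.
rewrite !(rmorphB, rmorphD, rmorphM, rmorphXn, rmorph1) => x0 x1 D0.
field; rewrite x0 x1 /= andbT.
exact: D0.
Qed.

Lemma rmap_weights (m n : R[i]) : m != 0 -> n != 0 -> m + n != 0 ->
  m + n - 1 != 0 ->
  rmap (tofrac 'X - 1 / (tofrac m%:P / tofrac 'X + tofrac n%:P / (tofrac 'X - 1)))
  = wmap m n.
Proof.
move=> m0 n0 mn mn1.
have E0 : qpoly 0 (m + n) (- m) != 0.
  have [_ c1 _] := coef_qpoly 0 (m + n) (- m).
  by apply: contraNneq mn => E; rewrite -c1 E coef0.
have EA : qpoly (m + n - 1) (1 - m) 0 =
    (m%:P + n%:P - 1) * 'X ^+ 2 + (1 - m%:P) * 'X.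
  by rewrite /qpoly polyC0 addr0 -!mul_polyC !polyCB polyCD polyC1.
have EB : qpoly 0 (m + n) (- m) = (m%:P + n%:P) * 'X - m%:P.
  by rewrite /qpoly scale0r add0r polyCN -mul_polyC polyCD.
pose phi : {rmorphism {poly R[i]} -> ratfun R} := @FracField.tofrac _.
have -> := @weights_frac _ _ phi 'X m%:P n%:P; rewrite -?EB ?tofrac_eq0 ?polyX_eq0 //;
  last by rewrite -polyC1 polyXsubC_eq0.
rewrite -EA.
apply: rmap_qmap => //; last by rewrite /nonzero2 mn1.
apply: Pdiv.ClosedField.root_coprimep => z; rewrite /root !qpolyE => /eqP H1.
have n1 : nonzero2 z 1 by rewrite /nonzero2 oner_neq0 orbT.
have := wmap_nonzero m0 n0 mn1 n1.
by rewrite !expr1n !mulr1 H1 /nonzero2 eqxx.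
Qed.

Lemma natr_weights (d1 d2 : nat) : (0 < d1)%N -> (0 < d2)%N ->
  [/\ d1%:R != 0 :> R[i], d2%:R != 0 :> R[i], d1%:R + d2%:R != 0 :> R[i]
    & d1%:R + d2%:R - 1 != 0 :> R[i]].
Proof.
move=> d10 d20; rewrite subr_eq0 -!natrD pnatr_eq1 !pnatr_eq0 -!lt0n addn_gt0 d10 d20.
by split => //; apply/eqP => E; have := leq_add d10 d20; rewrite E.
Qed.

Lemma rmap_newton1 (d1 d2 : nat) : (0 < d1)%N -> (0 < d2)%N ->
  rmap (newton1 d1 d2) = wmap d1%:R d2%:R :> (sphere R -> sphere R).
Proof.
move=> d10 d20; have [m0 n0 mn mn1] := natr_weights d10 d20.
by rewrite -rmap_weights // !rmorph_nat.
Qed.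

Lemma rmap_newton2 (d1 d2 : nat) : (0 < d1)%N -> (0 < d2)%N ->
  rmap (newton2 d1 d2) = wmap (- d1%:R) (- d2%:R) :> (sphere R -> sphere R).
Proof.
move=> d10 d20; have [m0 n0 mn _] := natr_weights d10 d20.
rewrite -rmap_weights ?oppr_eq0 //.
- rewrite !rmorphN !rmorph_nat /newton2; congr (rmap (_ + _)).
  by rewrite !mulNr -opprD invrN mulrN opprK.
- by rewrite -opprD oppr_eq0.
Qed.

(** Three nonzero integers of sum 1 have signs (+,+,-) or (+,-,-). Swapping and
    rotating the three fixed points brings the two weights of equal sign to 0
    and 1. *)
Lemma wmap_normal_form f (m n : int) : m != 0 -> n != 0 -> m + n - 1 != 0 ->
  conformally_conjugate f (wmap m%:~R n%:~R) ->
  (exists d1 d2 : nat, [/\ (0 < d1)%N, (0 < d2)%N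
     & conformally_conjugate f (rmap (newton1 d1 d2))]) \/
  (exists e1 e2 : nat, [/\ (0 < e1)%N, (0 < e2)%N
     & conformally_conjugate f (rmap (newton2 e1 e2))]).
Proof.
have int0 (k : int) : k != 0 -> k%:~R != 0 :> R[i] by rewrite intr_eq0.
have pp (k l : int) : 0 < k -> 0 < l -> conformally_conjugate f (wmap k%:~R l%:~R) ->
    exists d1 d2 : nat, [/\ (0 < d1)%N, (0 < d2)%N
     & conformally_conjugate f (rmap (newton1 d1 d2))].
  case: k => // k k0; case: l => // l l0 H; exists k, l; split => //.
  by rewrite rmap_newton1.
have nn (k l : int) : k < 0 -> l < 0 -> conformally_conjugate f (wmap k%:~R l%:~R) ->
    exists d1 d2 : nat, [/\ (0 < d1)%N, (0 < d2)%N
     & conformally_conjugate f (rmap (newton2 d1 d2))].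
  move=> k0 l0 H; exists `|k|%N, `|l|%N; split; rewrite ?absz_gt0 ?lt_eqF //.
  rewrite rmap_newton2 ?absz_gt0 ?lt_eqF //.
  by rewrite !natr_absz !ltr0_norm // !rmorphN !opprK.
have mixed (k l : int) : 0 < k -> l < 0 -> k + l - 1 != 0 ->
    conformally_conjugate f (wmap k%:~R l%:~R) ->
    (exists d1 d2 : nat, [/\ (0 < d1)%N, (0 < d2)%N
       & conformally_conjugate f (rmap (newton1 d1 d2))]) \/
    (exists e1 e2 : nat, [/\ (0 < e1)%N, (0 < e2)%N
       & conformally_conjugate f (rmap (newton2 e1 e2))]).
  move=> k0 l0 kl H.
  have kC := int0 _ (lt0r_neq0 k0); have lC := int0 _ (ltr0_neq0 l0).
  have klC : k%:~R + l%:~R - 1 != 0 :> R[i].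
    by rewrite -(intrD) -(intrB _ _ 1) int0.
  have tE : 1 - k%:~R - l%:~R = (1 - k - l)%:~R :> R[i] by rewrite !intrB.
  have tE' : 1 - l%:~R - k%:~R = (1 - k - l)%:~R :> R[i].
    by rewrite -tE; ring.
  have [t0|t0|t0] := ltgtP (1 - k - l) 0.
  - right; apply: (nn l (1 - k - l)) => //; rewrite -tE'.
    apply: conj_trans H _; apply: conj_trans (wmap_swap kC lC klC) _.
    by apply: wmap_rotate => //; rewrite [l%:~R + _]addrC.
  - left; apply: (pp k (1 - k - l)) => //; rewrite -tE.
    by apply: conj_trans H _; apply: wmap_rotate.
  - case/eqP: kl; have -> : k + l - 1 = - (1 - k - l) by ring.
    by rewrite t0 oppr0.
move=> m0 n0 mn H.
have [ms|ms|ms] := ltgtP m 0; last by rewrite ms eqxx in m0.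
  have [ns|ns|ns] := ltgtP n 0; last by rewrite ns eqxx in n0.
    by right; apply: nn H.
  apply: (mixed n m) => //; first by rewrite [n + m]addrC.
  apply: conj_trans H _; apply: wmap_swap; rewrite ?int0 //.
  by rewrite -intrD -(intrB _ _ 1) int0.
have [ns|ns|ns] := ltgtP n 0; last by rewrite ns eqxx in n0.
  exact: (mixed m n).
by left; apply: pp H.
Qed.

(** With r = P/Q the reciprocal of r/r' is P'/P - Q'/Q, whose poles are simple
    and whose residue at a is the order of P/Q at a, a nonzero integer. In
    lowest terms this logarithmic derivative is B/C, and its residue at a root
    a of C is B(a)/C'(a). *)
Lemma local_weight_num (P Q B C : {poly R[i]}) (a : R[i]) :
  P != 0 -> coprimep P Q -> coprimep C B ->
  C * (P^`() * Q - P * Q^`()) = P * Q * B -> root C a -> root P a ->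
  exists m : int, [/\ m != 0, C^`().[a] != 0 & B.[a] = m%:~R * C^`().[a]].
Proof.
move=> P0 cPQ cCB E Ca Pa.
have Ba : B.[a] != 0 by have := coprimep_root cCB Ca.
have Qa : Q.[a] != 0 by have := coprimep_root cPQ Pa.
have [mu [P1 /implyP /(_ P0) P1a PE]] := multiplicity_XsubC P a.
case: mu PE => [|nu] PE.
  by rewrite PE expr0 mulr1 in Pa; rewrite Pa in P1a.
have [C1 CE] := factor_theorem _ _ Ca.
pose L := 'X - a%:P.
have L0 : L != 0 by rewrite polyXsubC_eq0.
have PE' : P^`() = (P1^`() * L + P1 *+ nu.+1) * L ^+ nu.
  rewrite PE derivM deriv_exp derivXsubC mul1r /= -/L exprS; ring.
pose V := (P1^`() * Q - P1 * Q^`()) * L + (P1 *+ nu.+1) * Q.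
have EV : C1 * V = P1 * Q * B.
  apply: (mulIf (expf_neq0 nu.+1 L0)).
  transitivity (C * (P^`() * Q - P * Q^`())).
    by rewrite PE' CE PE -/L /V exprS; ring.
  by rewrite E PE -/L; ring.
have C1a : C^`().[a] = C1.[a].
  by rewrite CE derivM derivXsubC !hornerE subrr !mulr0 add0r.
have BE : B.[a] = (nu.+1)%:R * C1.[a].
  have := congr1 (fun p => p.[a]) EV.
  rewrite /V /L !(hornerM, hornerXsubC, hornerMn, hornerD) subrr mulr0 add0r.
  move=> H; have P1Q : P1.[a] * Q.[a] != 0 by rewrite mulf_neq0.
  by apply: (mulfI P1Q); rewrite -H -mulr_natl; ring.
exists (Posz nu.+1); split => //; rewrite C1a //.
by apply: contraNneq Ba => H; rewrite BE H mulr0.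
Qed.

Lemma local_weight (P Q B C : {poly R[i]}) (a : R[i]) :
  P != 0 -> Q != 0 -> coprimep P Q -> coprimep C B ->
  C * (P^`() * Q - P * Q^`()) = P * Q * B -> root C a ->
  exists m : int, [/\ m != 0, C^`().[a] != 0 & B.[a] = m%:~R * C^`().[a]].
Proof.
move=> P0 Q0 cPQ cCB E Ca.
have [Pa|Pa] := boolP (root P a); first exact: (local_weight_num P0 cPQ cCB E Ca Pa).
have Qa : root Q a.
  have Ba : B.[a] != 0 by have := coprimep_root cCB Ca.
  have := congr1 (fun p => p.[a]) E; rewrite !hornerM (eqP Ca) mul0r.
  move/esym/eqP; rewrite !mulf_eq0 (negbTE Ba) orbF => /orP[] //.
  by move=> Pa'; rewrite /root Pa' in Pa.
have [|||m [m0 Ca' mE]] := @local_weight_num Q P (- B) C a Q0 _ _ _ Ca Qa.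
- by rewrite coprimep_sym.
- by rewrite -scaleN1r coprimepZr // oppr_eq0 oner_neq0.
- transitivity (- (C * (P^`() * Q - P * Q^`()))); first by ring.
  by rewrite E; ring.
exists (- m); split; rewrite ?oppr_eq0 //.
by rewrite rmorphN mulNr -mE hornerN opprK.
Qed.

Lemma newton_frac (A : comNzRingType) (F : fieldType) (phi : {rmorphism A -> F})
    (x p q w : A) : phi q != 0 -> phi w != 0 ->
  phi x - phi p / phi q / (phi w / phi (q ^+ 2)) = phi (x * w - p * q) / phi w.
Proof.
rewrite !(rmorphB, rmorphM, rmorphXn) => q0 w0.
by field; rewrite w0 q0.
Qed.

Lemma newton_tofrac (X P Q W : {poly R[i]}) : W != 0 -> Q != 0 ->
  tofrac X - tofrac P / tofrac Q / (tofrac W / tofrac (Q ^+ 2)) =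
  tofrac (X * W - P * Q) / tofrac W :> ratfun R.
Proof.
move=> W0 Q0; pose phi : {rmorphism {poly R[i]} -> ratfun R} := @FracField.tofrac _.
have W0' : phi W != 0 by rewrite tofrac_eq0.
have Q0' : phi Q != 0 by rewrite tofrac_eq0.
have E := newton_frac X P Q0' W0'; exact E.
Qed.

(** If A/B is the Newton map in lowest terms then B/C with C = X B - A is the
    logarithmic derivative of r. It vanishes at infinity, so B has smaller
    degree than C. *)
Lemma newton_lowest (r : ratfun R) : rdegree (newton r) = 2%N ->
  let A := rnum (newton r) in let B := rden (newton r) in let C := 'X * B - A in
  [/\ coprimep C B, (size B < size C)%N &
    forall a, root C a ->
      exists m : int, [/\ m != 0, C^`().[a] != 0 & B.[a] = m%:~R * C^`().[a]]].
Proof.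
move=> deg2 A B C; set P := rnum r; set Q := rden r.
have B0 : B != 0 := rden_neq0 _.
have Q0 : Q != 0 := rden_neq0 _.
have cAB : coprimep A B := rnum_rden_coprime _.
have cPQ : coprimep P Q := rnum_rden_coprime _.
have degX : newton r != tofrac 'X.
  apply/eqP => E; move: deg2; rewrite E.
  have -> : tofrac 'X = tofrac 'X / tofrac 1 :> ratfun R by rewrite tofrac1 divr1.
  rewrite rdegree_frac ?oner_neq0 ?coprimep1 //.
  by rewrite size_polyX size_poly1.
set W := P^`() * Q - P * Q^`().
have rE : r = tofrac P / tofrac Q := rnum_rden_frac r.
have W0 : W != 0.
  apply: contraNneq degX => W0.
  by rewrite /newton /rderiv -/P -/Q -/W W0 tofrac0 mul0r invr0 mulr0 subr0.
have P0 : P != 0.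
  apply: contraNneq degX => P0.
  by rewrite /newton {1}rE P0 tofrac0 !mul0r subr0.
have CW : C * W = P * Q * B.
  have E1 : tofrac A / tofrac B = tofrac ('X * W - P * Q) / tofrac W :> ratfun R.
    rewrite -rnum_rden_frac /newton /rderiv -/P -/Q -/W {1}rE.
    have Wf : tofrac W != 0 :> ratfun R by rewrite tofrac_eq0.
    have Qf : tofrac Q != 0 :> ratfun R by rewrite tofrac_eq0.
    exact: newton_tofrac.
  have := frac_eq B0 W0 E1; rewrite /C => E2.
  by rewrite mulrBl E2; ring.
have cCB : coprimep C B.
  rewrite coprimep_sym; apply/coprimepP => d dB dC.
  have dA : d %| A.
    have -> : A = 'X * B - C by rewrite /C opprB addrC subrK.
    by rewrite dvdp_sub // dvdp_mull.
  by move/coprimepP: cAB; apply.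
have C0 : C != 0.
  by apply: contraNneq (mulf_neq0 (mulf_neq0 P0 Q0) B0) => C0; rewrite -CW C0 mul0r.
split => //; last by move=> a; exact: (local_weight P0 Q0 cPQ cCB CW).
have sW : (size W < size (P * Q)%R)%N.
  have sPQ : (0 < size P + size Q)%N by rewrite addn_gt0 size_poly_gt0 P0.
  have sP : (0 < size P)%N by rewrite size_poly_gt0.
  have sQ : (0 < size Q)%N by rewrite size_poly_gt0.
  have deriv_lt (p q : {poly R[i]}) : p != 0 -> q != 0 -> p^`() * q != 0 ->
      (size (p^`() * q)%R < size (p * q)%R)%N.
    move=> p0 q0 pq0; have p'0 : p^`() != 0 by apply: contraNneq pq0 => ->; rewrite mul0r.
    rewrite !size_mul //; have := lt_size_deriv p0.
    have : (0 < size q)%N by rewrite size_poly_gt0.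
    by case: (size q) => // n _; rewrite !addnS /= ltn_add2r.
  have lt1 : (size (P^`() * Q)%R < size (P * Q)%R)%N.
    have [->|n0] := eqVneq (P^`() * Q) 0.
      by rewrite size_poly0 size_poly_gt0 mulf_neq0.
    exact: deriv_lt.
  have lt2 : (size (P * Q^`())%R < size (P * Q)%R)%N.
    have [->|n0] := eqVneq (P * Q^`()) 0.
      by rewrite size_poly0 size_poly_gt0 mulf_neq0.
    by rewrite mulrC [P * Q]mulrC; apply: deriv_lt => //; rewrite mulrC.
  apply: leq_ltn_trans (size_polyD _ _) _; rewrite size_polyN.
  by rewrite gtn_max lt1 lt2.
have := congr1 (fun p : {poly R[i]} => size p) CW.
rewrite (size_mul C0 W0) (size_mul _ B0) ?mulf_neq0 // => E.
have sC : (0 < size C)%N by rewrite size_poly_gt0.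
have sB : (0 < size B)%N by rewrite size_poly_gt0.
have sw : (0 < size W)%N by rewrite size_poly_gt0.
move: E sW sC sB sw; move: (size C) (size W) (size B) (size (P * Q)) => c w b' pq.
by move=> E; rewrite -ltnS => *; lia.
Qed.

Lemma cubic_coef (c a1 a2 a3 : R[i]) :
  let C := c *: (('X - a1%:P) * (('X - a2%:P) * ('X - a3%:P))) in
  [/\ C`_3 = c, C`_2 = - c * (a1 + a2 + a3),
      C`_1 = c * (a1 * a2 + a1 * a3 + a2 * a3) & C`_0 = - c * (a1 * a2 * a3)].
Proof.
move=> C; have CE : C = c *: ('X^3 - (a1 + a2 + a3) *: 'X^2 +
    (a1 * a2 + a1 * a3 + a2 * a3) *: 'X - (a1 * a2 * a3)%:P).
  rewrite /C; congr (_ *: _); rewrite -!mul_polyC !(polyCD, polyCM); ring.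
by split; rewrite CE coefZ !(coefB, coefD, coefZ, coefXn, coefX, coefC) /=; ring.
Qed.

Lemma quadratic_coef (c a1 a2 : R[i]) :
  let C := c *: (('X - a1%:P) * ('X - a2%:P)) in
  [/\ C`_2 = c, C`_1 = - c * (a1 + a2) & C`_0 = c * (a1 * a2)].
Proof.
move=> C; have CE : C = c *: ('X^2 - (a1 + a2) *: 'X + (a1 * a2)%:P).
  rewrite /C; congr (_ *: _); rewrite -!mul_polyC !(polyCD, polyCM); ring.
by split; rewrite CE coefZ !(coefB, coefD, coefZ, coefXn, coefX, coefC) /=; ring.
Qed.

Lemma quadratic_deriv (c a1 a2 z : R[i]) :
  (c *: (('X - a1%:P) * ('X - a2%:P)))^`().[z] = c * (2 * z - (a1 + a2)).
Proof.
rewrite derivZ derivM !derivXsubC mul1r mulr1 !(hornerXsubC, hornerZ, hornerD).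
ring.
Qed.

Lemma cubic_deriv (c a1 a2 a3 z : R[i]) :
  (c *: (('X - a1%:P) * (('X - a2%:P) * ('X - a3%:P))))^`().[z] =
  c * ((z - a2) * (z - a3) + (z - a1) * (z - a3) + (z - a1) * (z - a2)).
Proof.
rewrite derivZ !derivM !derivXsubC !mul1r mulr1.
rewrite !(hornerXsubC, hornerZ, hornerM, hornerD); ring.
Qed.

(** A quadratic map has three fixed points. They are the roots of C, together
    with infinity when C has degree 2. The logarithmic derivative is the sum of
    the m_i/(z - a_i); when infinity is not fixed the map being quadratic forces
    the m_i to have sum 1. In either case a Mobius map sending 0, 1 and oo to
    the fixed points brings the map to the form with weights m_1, m_2. *)
Lemma newton_classification (r : ratfun R) : rdegree (newton r) = 2%N ->
  (exists d1 d2 : nat, [/\ (0 < d1)%N, (0 < d2)%N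
     & conformally_conjugate (rmap (newton r)) (rmap (newton1 d1 d2))]) \/
  (exists e1 e2 : nat, [/\ (0 < e1)%N, (0 < e2)%N
     & conformally_conjugate (rmap (newton r)) (rmap (newton2 e1 e2))]).
Proof.
move=> deg2; have [] := newton_lowest deg2.
have Nr := rnum_rden_frac (newton r); have B0 := rden_neq0 (newton r).
have cAB := rnum_rden_coprime (newton r).
move: deg2; rewrite /rdegree; move: Nr B0 cAB.
set A := rnum _; set B := rden _; set C := 'X * B - A.
move=> Nr B0 cAB smax cCB sBC wt.
have {smax} smax : maxn (size A) (size B) = 3%N.
  by move: smax; case: (maxn _ _) => // n /= ->.
have sA : (size A <= 3)%N by rewrite -smax leq_maxl.
have sB : (size B <= 3)%N by rewrite -smax leq_maxr.
have nz2 : nonzero2 A`_2 B`_2.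
  rewrite /nonzero2 -negb_and; apply/negP => /andP[/eqP A2 /eqP B2].
  have drop (p : {poly R[i]}) : (size p <= 3)%N -> p`_2 = 0 -> (size p <= 2)%N.
    move=> sp p2; apply/leq_sizeP => j; rewrite leq_eqVlt => /orP[/eqP<- //|j2].
    by rewrite nth_default // (leq_trans sp).
  have : (maxn (size A) (size B) <= 2)%N by rewrite geq_max !drop.
  by rewrite smax.
have NE : rmap (newton r) = qmap A`_2 A`_1 A`_0 B`_2 B`_1 B`_0.
  rewrite Nr {1}(qpoly_eta sA) {1}(qpoly_eta sB) rmap_qmap -?qpoly_eta //.
have coefC i : C`_i.+1 = B`_i - A`_i.+1 by rewrite /C coefB coefXM.
have coefC0 : C`_0 = - A`_0 by rewrite /C coefB coefXM sub0r.
have A3 : A`_3 = 0 by rewrite nth_default.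
have evB z : B.[z] = B`_2 * z ^+ 2 + B`_1 * z + B`_0.
  by rewrite {1}(qpoly_eta sB) qpolyE.
have C0 : C != 0 by rewrite -size_poly_gt0 (leq_ltn_trans _ sBC).
have [rs Crs] : exists rs : seq R[i], C = lead_coef C *: \prod_(z <- rs) ('X - z%:P).
  by have [rs H] := closed_field_poly_normal C; exists rs; exact: H.
set c := lead_coef C in Crs; have c0 : c != 0 by rewrite lead_coef_eq0.
have sC : size C = (size rs).+1.
  by rewrite Crs size_scale // size_prod_XsubC.
have sC4 : (size C <= 4)%N.
  rewrite (leq_trans (size_polyD _ _)) // geq_max size_polyN (leq_trans sA) // andbT.
  by rewrite mulrC size_mulX.
have intm (m n : int) : m%:~R + n%:~R - 1 != 0 :> R[i] -> m + n - 1 != 0.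
  by rewrite -intrD -(intrB _ _ 1) intr_eq0.
have sB0 : (0 < size B)%N by rewrite size_poly_gt0.
case: rs Crs sC => [|a1 [|a2 [|a3 [|a4 rs]]]] Crs sC.
- by move: sBC; rewrite sC ltnS leqNgt sB0.
- exfalso; have sB1 : (size B <= 1)%N by move: sBC; rewrite sC ltnS.
  have sA2 : (size A <= 2)%N.
    have -> : A = 'X * B - C by rewrite /C opprB addrC subrK.
    rewrite (leq_trans (size_polyD _ _)) // geq_max size_polyN sC leqnn andbT.
    by rewrite mulrC size_mulX.
  have : (maxn (size A) (size B) <= 2)%N by rewrite geq_max sA2 (leq_trans sB1).
  by rewrite smax.
- rewrite !big_cons big_nil mulr1 in Crs.
  have [C2 C1 C0'] := quadratic_coef c a1 a2; rewrite -Crs in C2 C1 C0'.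
  have B2 : B`_2 = 0 by rewrite nth_default //; move: sBC; rewrite sC ltnS.
  have r1 : root C a1 by rewrite Crs rootZ // rootM root_XsubC eqxx.
  have r2 : root C a2 by rewrite Crs rootZ // rootM !root_XsubC eqxx orbT.
  have [m1 [m10 d1 E1]] := wt a1 r1; have [m2 [m20 d2 E2]] := wt a2 r2.
  have dC z : C^`().[z] = c * (2 * z - (a1 + a2)).
    by rewrite Crs quadratic_deriv.
  rewrite dC in d1 E1; rewrite dC in d2 E2; rewrite evB B2 in E1; rewrite evB B2 in E2.
  have a12 : a2 - a1 != 0.
    apply: contraNneq d1 => /eqP; rewrite subr_eq0 => /eqP ->.
    by apply/eqP; ring.
  have B1 : B`_1 = c * (m1%:~R + m2%:~R).
    apply: (mulIf a12).
    transitivity ((0 * a2 ^+ 2 + B`_1 * a2 + B`_0) - (0 * a1 ^+ 2 + B`_1 * a1 + B`_0)).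
      by ring.
    by rewrite E1 E2; ring.
  have B0' : B`_0 = - c * (m1%:~R * a2 + m2%:~R * a1).
    transitivity ((0 * a1 ^+ 2 + B`_1 * a1 + B`_0) - B`_1 * a1); first by ring.
    by rewrite E1 B1; ring.
  have A2 : A`_2 = c * (m1%:~R + m2%:~R - 1).
    have -> : A`_2 = B`_1 - C`_2 by rewrite coefC opprB addrC subrK.
    by rewrite B1 C2; ring.
  have A1 : A`_1 = B`_0 + c * (a1 + a2).
    have -> : A`_1 = B`_0 - C`_1 by rewrite coefC opprB addrC subrK.
    by rewrite C1; ring.
  have A0 : A`_0 = - c * (a1 * a2) by rewrite mulNr -C0' coefC0 opprK.
  have mn : m1%:~R + m2%:~R - 1 != 0 :> R[i].
    by move: nz2; rewrite /nonzero2 B2 eqxx orbF A2 mulf_eq0 negb_or => /andP[].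
  apply: (wmap_normal_form m10 m20 (intm _ _ mn)); apply/conj_byP.
  exists (a2 - a1), a1, 0, 1; rewrite NE.
  apply: (@conj_by_qmap _ _ _ _ (c * (a2 - a1))).
  + by rewrite mulr1 mulr0 subr0.
  + by rewrite mulf_neq0.
  + by move=> x y; apply: wmap_nonzero; rewrite ?intr_eq0.
  + by move=> x y /=; rewrite A2 A1 A0 B2 B1 B0'; split; ring.
- rewrite !big_cons big_nil mulr1 in Crs.
  have [C3 C2 C1 C0'] := cubic_coef c a1 a2 a3; rewrite -Crs in C3 C2 C1 C0'.
  have r1 : root C a1 by rewrite Crs rootZ // rootM root_XsubC eqxx.
  have r2 : root C a2 by rewrite Crs rootZ // !rootM !root_XsubC eqxx orbT.
  have r3 : root C a3 by rewrite Crs rootZ // !rootM !root_XsubC eqxx !orbT.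
  have [m1 [m10 d1 E1]] := wt a1 r1; have [m2 [m20 d2 E2]] := wt a2 r2.
  have [m3 [m30 d3 E3]] := wt a3 r3.
  have dC z : C^`().[z] = c * ((z - a2) * (z - a3) + (z - a1) * (z - a3) + (z - a1) * (z - a2)).
    by rewrite Crs cubic_deriv.
  rewrite dC evB in d1 E1; rewrite dC evB in d2 E2; rewrite dC evB in d3 E3.
  have a12 : a2 - a1 != 0.
    apply: contraNneq d1 => /eqP; rewrite subr_eq0 => /eqP ->; apply/eqP; ring.
  have a13 : a3 - a1 != 0.
    apply: contraNneq d1 => /eqP; rewrite subr_eq0 => /eqP ->; apply/eqP; ring.
  have a23 : a3 - a2 != 0.
    apply: contraNneq d2 => /eqP; rewrite subr_eq0 => /eqP ->; apply/eqP; ring.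
  set M1 : R[i] := m1%:~R in E1; set M2 : R[i] := m2%:~R in E2.
  set M3 : R[i] := m3%:~R in E3.
  set v1 := _ + _ in E1; set v2 := _ + _ in E2; set v3 := _ + _ in E3.
  have V0 : (a2 - a1) * (a3 - a1) * (a3 - a2) != 0 by rewrite !mulf_neq0.
  have B2 : B`_2 = c * (M1 + M2 + M3).
    apply: (mulIf V0).
    transitivity (v1 * (a3 - a2) - v2 * (a3 - a1) + v3 * (a2 - a1)).
      by rewrite /v1 /v2 /v3; ring.
    by rewrite E1 E2 E3; ring.
  have B1 : B`_1 = - c * (M1 * (a2 + a3) + M2 * (a1 + a3) + M3 * (a1 + a2)).
    apply: (mulIf V0).
    transitivity (- v1 * (a3 - a2) * (a3 + a2) + v2 * (a3 - a1) * (a3 + a1) - v3 * (a2 - a1) * (a2 + a1)).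
      by rewrite /v1 /v2 /v3; ring.
    by rewrite E1 E2 E3; ring.
  have B0' : B`_0 = c * (M1 * (a2 * a3) + M2 * (a1 * a3) + M3 * (a1 * a2)).
    transitivity (v1 - B`_2 * a1 ^+ 2 - B`_1 * a1); first by rewrite /v1; ring.
    by rewrite E1 B2 B1; ring.
  have sum1 : M3 = 1 - M1 - M2.
    have : B`_2 = c by rewrite -C3 coefC A3 subr0.
    rewrite B2 -{2}(mulr1 c) => /(mulfI c0) E.
    by rewrite -E; ring.
  have A2 : A`_2 = B`_1 + c * (a1 + a2 + a3).
    have -> : A`_2 = B`_1 - C`_2 by rewrite coefC opprB addrC subrK.
    by rewrite C2; ring.
  have A1 : A`_1 = B`_0 - c * (a1 * a2 + a1 * a3 + a2 * a3).
    have -> : A`_1 = B`_0 - C`_1 by rewrite coefC opprB addrC subrK.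
    by rewrite C1.
  have A0 : A`_0 = c * (a1 * a2 * a3) by rewrite -[LHS]opprK -coefC0 C0'; ring.
  have mn : M1 + M2 - 1 != 0.
    by rewrite -oppr_eq0 (_ : - (M1 + M2 - 1) = M3) ?intr_eq0 // sum1; ring.
  apply: (wmap_normal_form m10 m20 (intm _ _ mn)); apply/conj_byP.
  exists (a3 * (a2 - a1)), (a1 * (a3 - a2)), (a2 - a1), (a3 - a2); rewrite NE -/M1 -/M2.
  have D : (a3 * (a2 - a1)) * (a3 - a2) - a1 * (a3 - a2) * (a2 - a1) != 0.
    rewrite (_ : _ - _ = (a2 - a1) * (a3 - a1) * (a3 - a2)) //; ring.
  apply: (@conj_by_qmap _ _ _ _ (- c * (a2 - a1) * (a3 - a1) * (a3 - a2))) => //.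
  + by rewrite !mulf_neq0 // oppr_eq0.
  + by move=> x y; apply: wmap_nonzero; rewrite ?intr_eq0.
  + by move=> x y /=; rewrite A2 A1 A0 B2 B1 B0' sum1; split; ring.
- by exfalso; move: sC4; rewrite sC.
Qed.

End Conjugacy.

(** * The two-basin normal form *)

Section HalfPlaneSqrt.
Context {R : realType}.
Implicit Types z w : R[i].

(** The branch of the square root on the closed upper half-plane with values
    in the closed first quadrant. *)
Definition hsqrt z : R[i] :=
  Num.sqrt ((nc z + complex.Re z) / 2) +i* Num.sqrt ((nc z - complex.Re z) / 2).

Definition upper z : Prop := 0 <= complex.Im z.
Definition quadrant z : Prop := 0 <= complex.Re z /\ 0 <= complex.Im z.

Lemma hsqrt_quadrant z : quadrant (hsqrt z).
Proof. by split; exact: sqrtr_ge0. Qed.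

Lemma hsqrt_sq z : upper z -> hsqrt z ^+ 2 = z.
Proof.
case: z => x y; rewrite /upper /hsqrt [complex.Im _]/= [complex.Re _]/= => y0.
have := Re_le_nc (x +i* y); rewrite [complex.Re _]/= ler_norml => /andP[h1 h2].
have := nc_sq (x +i* y); rewrite [complex.Re _]/= [complex.Im _]/=.
move: h1 h2; move: (nc _) (nc_ge0 (x +i* y)) => N N0 h1 h2 NE.
have e1 : 0 <= (N + x) / 2 by rewrite divr_ge0 //; lra.
have e2 : 0 <= (N - x) / 2 by rewrite divr_ge0 //; lra.
rewrite expr2; apply: complex_ext => /=; rewrite -?expr2 ?sqr_sqrtr //; first by field.
have -> : forall u v : R, u * v + v * u = 2 * (u * v) by move=> u v; ring.
rewrite -sqrtrM // (_ : (N + x) / 2 * ((N - x) / 2) = (y / 2) ^+ 2).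
  by rewrite sqrtr_sqr ger0_norm ?divr_ge0 //; field.
rewrite (_ : _ * _ = (N ^+ 2 - x ^+ 2) / 4); last by field.
by rewrite NE; field.
Qed.

Lemma sq_upper z : quadrant z -> upper (z ^+ 2).
Proof.
case: z => x y [/= x0 y0]; rewrite /upper expr2 /=.
by rewrite addr_ge0 // mulr_ge0.
Qed.

(** Two vectors of the first quadrant form an angle of at most pi/2. *)
Lemma quadrant_sum z w : quadrant z -> quadrant w ->
  nc z ^+ 2 + nc w ^+ 2 <= nc (z + w) ^+ 2.
Proof.
case: z => x y; case: w => u v; rewrite !nc_sq => -[/= x0 y0] [/= u0 v0].
rewrite -subr_ge0.
rewrite (_ : _ - _ = 2 * (x * u + y * v)); last by ring.
by rewrite mulr_ge0 // addr_ge0 // mulr_ge0.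
Qed.

Lemma parallelogram z w :
  nc (z + w) ^+ 2 + nc (z - w) ^+ 2 = 2 * (nc z ^+ 2 + nc w ^+ 2).
Proof. by case: z => x y; case: w => u v; rewrite !nc_sq /=; ring. Qed.

Lemma quadrant_sq_inj z w : quadrant z -> quadrant w -> z ^+ 2 = w ^+ 2 -> z = w.
Proof.
move=> qz qw E; apply/eqP; rewrite -subr_eq0; apply: contraT => n.
have /eqP : (z - w) * (z + w) = 0.
  have -> : (z - w) * (z + w) = z ^+ 2 - w ^+ 2 by ring.
  by rewrite E subrr.
rewrite mulf_eq0 (negbTE n) /= -nc_eq0 => /eqP s0.
have := quadrant_sum qz qw; have := sqr_ge0 (nc z); have := sqr_ge0 (nc w).
rewrite s0 expr0n /= => h1 h2 h3.
have /eqP : nc z ^+ 2 = 0 by lra.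
have /eqP : nc w ^+ 2 = 0 by lra.
by rewrite !expf_eq0 /= !nc_eq0 => /eqP w0 /eqP z0; rewrite w0 z0 subrr eqxx in n.
Qed.

(** From z - w = (s - u)(s + u) and |s + u| >= |s - u| in the quadrant. *)
Lemma hsqrt_holder z w : upper z -> upper w ->
  nc (hsqrt z - hsqrt w) ^+ 2 <= nc (z - w).
Proof.
move=> uz uw; set s := hsqrt z; set u := hsqrt w.
have -> : z - w = (s - u) * (s + u).
  by rewrite -{1}(hsqrt_sq uz) -{1}(hsqrt_sq uw) -/s -/u; ring.
rewrite ncM expr2 ler_wpM2l ?nc_ge0 //.
rewrite -(@ler_pXn2r _ 2) ?nnegrE ?nc_ge0 //.
have := quadrant_sum (hsqrt_quadrant z) (hsqrt_quadrant w).
by have := parallelogram (hsqrt z) (hsqrt w); rewrite -/s -/u; lra.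
Qed.

End HalfPlaneSqrt.

Section Conjugation.
Context {R : realType}.
Implicit Types (z w : R[i]) (s : sphere R).

Lemma conjC_div z w : (z / w)^* = z^* / w^*.
Proof. by rewrite (rmorphM (@conjc R)) /= conjc_inv. Qed.

Lemma conjC_poly2 (u v k : R) z :
  u%:C * z^* ^+ 2 + v%:C * z^* + k%:C = (u%:C * z ^+ 2 + v%:C * z + k%:C)^*.
Proof. by rewrite !expr2; case: z => x y; apply: complex_ext => /=; ring. Qed.

Definition cj s : sphere R := if s is Some z then Some z^* else None.

Lemma cjK : involutive cj.
Proof. by case=> //= z; rewrite conjcK. Qed.

Lemma cj_continuous : continuous cj.
Proof.
case=> [z|] A.
  move=> /nbhs_Some [e e0 eA]; apply/nbhs_Some; exists e => // w wz /=.
  by apply: eA; rewrite -rmorphB nc_conj.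
move=> /nbhs_None [AN [r rA]]; apply/nbhs_None; split => //.
by exists r => z rz /=; apply: rA; rewrite nc_conj.
Qed.

Lemma qmap_cj (a b c a' b' c' : R) s :
  qmap a%:C b%:C c%:C a'%:C b'%:C c'%:C (cj s) =
  cj (qmap a%:C b%:C c%:C a'%:C b'%:C c'%:C s).
Proof.
have H (x y : R[i]) : pt x^* y^* = cj (pt x y).
  rewrite /pt conjc_eq0; case: eqVneq => //= y0; by rewrite conjC_div.
case: s => [z|]; rewrite /qmap [cj _]/= -H; first by rewrite !conjC_poly2.
by rewrite !conjc_real.
Qed.

End Conjugation.

Section LinearBound.
Context {R : realType}.

Lemma affine_ge (u v m x e : R) :
  `|x| <= m -> e <= u + v * m -> e <= u - v * m -> e <= u + v * x.
Proof.
rewrite ler_norml => /andP[h1 h2] e1 e2.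
have [v0|v0] := leP 0 v; nra.
Qed.

End LinearBound.

Section NormalForm.
Context {R : realType}.
Variables p t a d : R.
Hypotheses (p0 : 0 <= p) (p1 : p < 1) (t0 : 0 <= t) (t1 : t < 1).
Hypotheses (aE : a = 1 + t + p * t) (dE : d = 1 + p + p * t).
Implicit Types (z w : R[i]) (s : sphere R) (x y m : R).

(** The quadratic map with critical points 0 and oo and fixed points
    p, 1 and 1/t. *)
Definition gmap : sphere R -> sphere R :=
  qmap a%:C 0%:C p%:C t%:C 0%:C d%:C.

Lemma bounds : [/\ 0 <= p, p < 1, 0 <= t & t < 1]. Proof. by []. Qed.

Ltac plra := have [? ? ? ?] := bounds; lra.
Ltac pnra := have [? ? ? ?] := bounds; nra.

Lemma pt_ge0 : 0 <= p * t. Proof. exact: mulr_ge0. Qed.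
Lemma pt_lt1 : p * t < 1.
Proof. pnra. Qed.
Lemma a_ge1 : 1 <= a. Proof. by have := pt_ge0; rewrite aE; plra. Qed.
Lemma d_ge1 : 1 <= d. Proof. by have := pt_ge0; rewrite dE; plra. Qed.

Lemma det_gt0 : 0 < a * d - p * t.
Proof.
have -> : a * d - p * t = (1 + p) * (1 + t) * (1 + p * t) by rewrite aE dE; ring.
by have := pt_ge0 => h; rewrite !mulr_gt0 //; plra.
Qed.

Lemma detC : a%:C * d%:C - p%:C * t%:C != 0.
Proof. by rewrite -!rmorphM -rmorphB (inj_eq (@complexI R)) gt_eqF // det_gt0. Qed.

Lemma gmapE z : gmap (Some z) = pt (a%:C * z ^+ 2 + p%:C) (t%:C * z ^+ 2 + d%:C).
Proof. by rewrite /gmap /= !mul0r !addr0. Qed.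

Lemma gmap_continuous : continuous gmap.
Proof.
apply: qmap_continuous => x y n; rewrite !mul0r !addr0.
by apply: mob_nonzero detC _; rewrite nonzero2_sq.
Qed.

Lemma gmap_cj s : gmap (cj s) = cj (gmap s).
Proof. exact: qmap_cj. Qed.

Lemma gmap_opp z : gmap (Some (- z)) = gmap (Some z).
Proof. by rewrite !gmapE sqrrN. Qed.

Lemma gmap_nopole z : t%:C * z ^+ 2 + d%:C != 0 ->
  gmap (Some z) = Some ((a%:C * z ^+ 2 + p%:C) / (t%:C * z ^+ 2 + d%:C)).
Proof. by move=> n; rewrite gmapE pt_Some. Qed.

(** The closed disc of radius rho is mapped into itself, and the Mobius
    coordinate (z - p)/(1 - t z) is multiplied there by a factor of modulus
    less than 1; both facts are affine in Re z^2 or Re z once |z| is fixed, so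
    the extreme cases suffice, which are c1 and c2. *)
Section Disc.
Variable rho : R.
Hypotheses (prho : p <= rho) (rho1 : rho < 1).
Hypothesis c1 : rho * (1 + 2 * t + p * t) < 1 + 2 * p + p * t.
Hypothesis c2 :
  t * rho ^+ 3 + (1 + t + p * t) * rho ^+ 2 - (1 + p + p * t) * rho - p <= 0.

Let rho0 : 0 <= rho. Proof. exact: le_trans prho. Qed.

Let den0 z : nc z <= rho -> t%:C * z ^+ 2 + d%:C != 0.
Proof.
move=> zr; rewrite -nc_gt0; apply: (@lt_le_trans _ _ (nc d%:C - nc (t%:C * z ^+ 2))).
  rewrite ncM !nc_real ncX (ger0_norm (_ : 0 <= d)); last exact: le_trans d_ge1.
  rewrite (ger0_norm t0) subr_gt0 (@lt_le_trans _ _ 1) ?d_ge1 //.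
  apply: (@le_lt_trans _ _ (t * 1)); last by rewrite mulr1.
  rewrite ler_wpM2l // -(expr1n _ 2) ler_pXn2r ?nnegrE ?nc_ge0 //.
  by rewrite (le_trans zr) // ltW.
by have := nc_triangleB d%:C (- (t%:C * z ^+ 2)); rewrite ncN opprK [d%:C + _]addrC.
Qed.

Lemma gmap_disc z : nc z <= rho -> exists2 z', gmap (Some z) = Some z' & nc z' <= rho.
Proof.
move=> zr; have n := den0 zr.
exists ((a%:C * z ^+ 2 + p%:C) / (t%:C * z ^+ 2 + d%:C)); first exact: gmap_nopole.
rewrite ncM ncV ler_pdivrMr ?nc_gt0 //.
rewrite -(@ler_pXn2r _ 2) ?nnegrE ?nc_ge0 ?mulr_ge0 ?nc_ge0 // exprMn.
have M : nc (z ^+ 2) <= rho ^+ 2 by rewrite ncX ler_pXn2r ?nnegrE ?nc_ge0.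
rewrite !nc_sq; move: (Re_le_nc (z ^+ 2)) (nc_sq (z ^+ 2)) (nc_ge0 (z ^+ 2)) M.
move: (nc (z ^+ 2)) => m; case: (z ^+ 2) => x y /= xm mE m0 mr.
rewrite -subr_ge0.
have -> : rho ^+ 2 * ((t * x - 0 * y + d) ^+ 2 + (t * y + 0 * x + 0) ^+ 2) -
    ((a * x - 0 * y + p) ^+ 2 + (a * y + 0 * x + 0) ^+ 2) =
    (rho ^+ 2 * (t ^+ 2 * m ^+ 2 + d ^+ 2) - (a ^+ 2 * m ^+ 2 + p ^+ 2)) +
    2 * (rho ^+ 2 * t * d - a * p) * x.
  by rewrite mE; ring.
have rc : rho * t <= a.
  rewrite (@le_trans _ _ 1) ?a_ge1 //; apply: (@le_trans _ _ (1 * t)); last by plra.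
  by rewrite ler_wpM2r // ltW.
have brd : p <= rho * d.
  by apply: (le_trans prho); rewrite ler_peMr ?d_ge1.
apply: (affine_ge xm).
  have -> : rho ^+ 2 * (t ^+ 2 * m ^+ 2 + d ^+ 2) - (a ^+ 2 * m ^+ 2 + p ^+ 2) +
    2 * (rho ^+ 2 * t * d - a * p) * m =
    (rho * (t * m + d) - (a * m + p)) * (rho * (t * m + d) + (a * m + p)) by ring.
  apply: mulr_ge0; last first.
    by rewrite addr_ge0 // ?mulr_ge0 // addr_ge0 ?mulr_ge0 //; have := a_ge1; have := d_ge1; plra.
  have h : 0 <= (a - rho * t) * (rho ^+ 2 - m) by rewrite mulr_ge0 // subr_ge0.
  have h2 : 0 <= (1 - t * rho) * (rho - p) * (1 - rho).
    rewrite !mulr_ge0 ?subr_ge0 ?(ltW rho1) //.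
    by rewrite mulr_ile1 // ltW.
  have e : (1 - t * rho) * (rho - p) * (1 - rho) = t * rho ^+ 3 - a * rho ^+ 2 + d * rho - p.
    by rewrite aE dE; ring.
  have -> : rho * (t * m + d) - (a * m + p) = (a - rho * t) * (rho ^+ 2 - m) +
     (t * rho ^+ 3 - a * rho ^+ 2 + d * rho - p) by ring.
  by rewrite -e addr_ge0.
have -> : rho ^+ 2 * (t ^+ 2 * m ^+ 2 + d ^+ 2) - (a ^+ 2 * m ^+ 2 + p ^+ 2) -
    2 * (rho ^+ 2 * t * d - a * p) * m =
    (rho * d - p + (a - rho * t) * m) * (rho * d + p - (rho * t + a) * m) by ring.
apply: mulr_ge0.
  by rewrite addr_ge0 // ?mulr_ge0 // subr_ge0.
have h : 0 <= (a + rho * t) * (rho ^+ 2 - m).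
  by rewrite mulr_ge0 ?subr_ge0 // addr_ge0 ?mulr_ge0 //; have := a_ge1; have := d_ge1; plra.
have : rho * d + p - (rho * t + a) * m = (a + rho * t) * (rho ^+ 2 - m) -
   (t * rho ^+ 3 + (1 + t + p * t) * rho ^+ 2 - (1 + p + p * t) * rho - p).
  by rewrite aE dE; ring.
by move=> ->; rewrite addr_ge0 // oppr_ge0.
Qed.

Let num z := nc (z - p%:C) ^+ 2.
Let dn z := nc (1 - t%:C * z) ^+ 2.

Let dn_gt0 z : nc z < 1 -> 0 < dn z.
Proof.
move=> z1; rewrite exprn_gt0 // nc_gt0; apply/eqP => H.
have E : t%:C * z = 1 by apply/esym/eqP; rewrite -subr_eq0 H.
have := congr1 (@Normc.normc _) E; rewrite ncM nc_real Normc.normc1 ger0_norm // => h.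
have : t * nc z < 1 by rewrite mulr_ilt1 ?nc_ge0.
by rewrite h ltxx.
Qed.

Lemma gmap_contract : exists2 k : R, 0 <= k < 1 & forall z z', nc z <= rho ->
  gmap (Some z) = Some z' -> num z' * dn z <= k * (num z * dn z').
Proof.
pose e1 := (1 - rho) * (1 - p * t).
pose e2 := (1 - p * t) * (1 + 2 * p + p * t - rho * (1 + 2 * t + p * t)).
pose e := Num.min e1 e2.
have e0 : 0 < e by rewrite lt_min !mulr_gt0 ?subr_gt0 ?pt_lt1.
have e16 : e <= 1.
  rewrite ge_min; apply/orP; left; have := pt_ge0; have := pt_lt1; have r0 := rho0; have r1 := rho1.
  by move=> h1 h2; rewrite /e1 mulr_ile1 //; lra.
exists (1 - e / 16); first by apply/andP; split; plra.
move=> z z' zr; rewrite gmap_nopole ?den0 // => /Some_inj <-.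
have n := den0 zr; set D := _ + _ in n *.
have N1 : (a%:C * z ^+ 2 + p%:C) / D - p%:C = (1 + t)%:C * (z - p%:C) * (z + p%:C) / D.
  by apply: (mulIf n); rewrite mulrBl !divfK // /D aE dE !(rmorphD, rmorphM) rmorph1; ring.
have N2 : 1 - t%:C * ((a%:C * z ^+ 2 + p%:C) / D) =
    (1 + p)%:C * (1 - t%:C * z) * (1 + t%:C * z) / D.
  apply: (mulIf n); rewrite mulrBl mul1r mulrA !divfK // /D aE dE.
  by rewrite !(rmorphD, rmorphM) rmorph1; ring.
rewrite /num /dn N1 N2 !ncM !nc_real !exprMn !ger0_norm; try plra.
set u := nc (z - _) ^+ 2; set v := nc (1 - _) ^+ 2; set q := nc D^-1 ^+ 2.
have main : (1 + t) ^+ 2 * nc (z + p%:C) ^+ 2 <=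
    (1 - e / 16) * ((1 + p) ^+ 2 * nc (1 + t%:C * z) ^+ 2).
  have z1 : nc z <= 1 by rewrite (le_trans zr) // ltW.
  rewrite !nc_sq; move: (Re_le_nc z) (nc_sq z) (nc_ge0 z) zr z1.
  move: (nc z) => m; case: z {n D N1 N2 u v q} => x y /= xm mE m0 mr m1.
  have -> : (1 + t) ^+ 2 * ((x + p) ^+ 2 + (y + 0) ^+ 2) =
    (1 + t) ^+ 2 * (m ^+ 2 + 2 * p * x + p ^+ 2) by rewrite mE; ring.
  have -> : (1 + (t * x - 0 * y)) ^+ 2 + (0 + (t * y + 0 * x)) ^+ 2 =
     1 + 2 * t * x + t ^+ 2 * m ^+ 2 by rewrite mE; ring.
  have ub : (1 + p) ^+ 2 * (1 + 2 * t * x + t ^+ 2 * m ^+ 2) <= 16.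
    have x1 : x <= 1 by apply: le_trans (ler_norm x) (le_trans xm m1).
    have tx : t * x <= 1.
      apply: (@le_trans _ _ (t * 1)); first by rewrite ler_wpM2l.
      by rewrite mulr1 ltW.
    have tm : t ^+ 2 * m ^+ 2 <= 1 by rewrite mulr_ile1 ?sqr_ge0 ?exprn_ile1 // ltW.
    have pp : (1 + p) ^+ 2 <= 4 by pnra.
    apply: (@le_trans _ _ (4 * 4)); last by plra.
    have nn : 0 <= 1 + 2 * t * x + t ^+ 2 * m ^+ 2.
      have -> : 1 + 2 * t * x + t ^+ 2 * m ^+ 2 = (1 + t * x) ^+ 2 + (t * y) ^+ 2.
        by rewrite mE; ring.
      by rewrite addr_ge0 ?sqr_ge0.
    by apply: ler_pM => //; rewrite ?sqr_ge0 //; plra.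
  suff : e <= (1 + p) ^+ 2 * (1 + 2 * t * x + t ^+ 2 * m ^+ 2) -
      (1 + t) ^+ 2 * (m ^+ 2 + 2 * p * x + p ^+ 2).
    have := ler_wpM2l (ltW e0) ub; set U := (1 + p) ^+ 2 * _; set L := (1 + t) ^+ 2 * _.
    by move=> h1 h2; plra.
  have -> : (1 + p) ^+ 2 * (1 + 2 * t * x + t ^+ 2 * m ^+ 2) -
      (1 + t) ^+ 2 * (m ^+ 2 + 2 * p * x + p ^+ 2) =
      ((1 + p) ^+ 2 * (1 + t ^+ 2 * m ^+ 2) - (1 + t) ^+ 2 * (m ^+ 2 + p ^+ 2)) +
      (2 * ((1 + p) ^+ 2 * t - (1 + t) ^+ 2 * p)) * x by ring.
  have tm0 : 0 <= t * m by rewrite mulr_ge0.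
  have ptm0 : 0 <= p * (t * m) by rewrite mulr_ge0.
  apply: (affine_ge xm).
    have -> : (1 + p) ^+ 2 * (1 + t ^+ 2 * m ^+ 2) - (1 + t) ^+ 2 * (m ^+ 2 + p ^+ 2) +
      (2 * ((1 + p) ^+ 2 * t - (1 + t) ^+ 2 * p)) * m =
      ((1 - m) * (1 - p * t)) * ((1 + p) * (1 + t * m) + (1 + t) * (m + p)) by ring.
    apply: (@le_trans _ _ (e1 * 1)); first by rewrite mulr1 ge_min lexx.
    have tp0 : 0 <= t * p by rewrite mulr_ge0.
    have e10 : 0 <= e1 by rewrite mulr_ge0 ?subr_ge0 ?ltW // pt_lt1.
    have A1 : e1 <= (1 - m) * (1 - p * t).
      by rewrite /e1 ler_wpM2r ?lerB // subr_ge0 ltW // pt_lt1.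
    have B1 : 1 <= (1 + p) * (1 + t * m) + (1 + t) * (m + p) by plra.
    exact: ler_pM.
  have -> : (1 + p) ^+ 2 * (1 + t ^+ 2 * m ^+ 2) - (1 + t) ^+ 2 * (m ^+ 2 + p ^+ 2) -
      (2 * ((1 + p) ^+ 2 * t - (1 + t) ^+ 2 * p)) * m =
      (1 + m) * ((1 - p * t) * (1 + 2 * p + p * t - m * (1 + 2 * t + p * t))) by ring.
  apply: (@le_trans _ _ (1 * e2)); first by rewrite mul1r ge_min lexx orbT.
  have e20 : 0 <= e2 by rewrite mulr_ge0 ?subr_ge0 ?ltW // pt_lt1.
  apply: ler_pM => //; first by plra.
  have h := pt_ge0; have h1 := pt_lt1.
  have h2 : m * (1 + 2 * t + p * t) <= rho * (1 + 2 * t + p * t).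
    by rewrite ler_wpM2r //; plra.
  by rewrite /e2; apply: ler_wpM2l; lra.
have uvq : 0 <= u * v * q := mulr_ge0 (mulr_ge0 (sqr_ge0 _) (sqr_ge0 _)) (sqr_ge0 _).
have := ler_wpM2l uvq main; plra.
Qed.

Lemma disc_attracted z : nc z < rho -> attracted gmap (Some p%:C) (Some z).
Proof.
move=> zr; pose U s : Prop := if s is Some w then nc w < rho : Prop else False.
exists U; split.
  apply/nbhs_Some; exists (rho - nc z); first by rewrite subr_gt0.
  by move=> w wz /=; have := nc_triangleB w z; lra.
move=> W /nbhs_Some [e e0 eW].
have [k /andP[k0 k1] Hk] := gmap_contract.
have dn4 w : nc w <= rho -> dn w <= 4.
  move=> wr; rewrite /dn -(_ : 2 ^+ 2 = 4 :> R); last by ring.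
  rewrite ler_pXn2r ?nnegrE ?nc_ge0 //; apply: le_trans (nc_triangle _ _) _.
  rewrite ncN ncM nc_real Normc.normc1 (ger0_norm t0).
  have : t * nc w <= 1.
    by rewrite mulr_ile1 ?nc_ge0 ?(ltW t1) // (le_trans wr) // ltW.
  lra.
have H n s : U s -> exists z', [/\ iter n gmap s = Some z', nc z' <= rho
     & exists2 w, nc w <= rho & num z' * dn w <= k ^+ n * (num w * dn z')].
  case: s => [w|//] wr; elim: n => [|n [z' [E r' [v vr V]]]].
    exists w; split => //=; first exact: ltW.
    by exists w; rewrite ?expr0 ?mul1r // ltW.
  have [z'' E' r''] := gmap_disc r'.
  exists z''; split => //; first by rewrite iterS E.
  exists v => //; have h := Hk z' z'' r' E'.
  have d'0 := dn_gt0 (le_lt_trans r' rho1); have d''0 := dn_gt0 (le_lt_trans r'' rho1).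
  rewrite -(ler_pM2r d'0) mulrAC.
  apply: (@le_trans _ _ (k * (num z' * dn z'') * dn v)).
    by rewrite ler_wpM2r // sqr_ge0.
  have -> : k * (num z' * dn z'') * dn v = (num z' * dn v) * (k * dn z'') by ring.
  have -> : k ^+ n.+1 * (num v * dn z'') * dn z' =
    (k ^+ n * (num v * dn z')) * (k * dn z'') by rewrite exprS; ring.
  by rewrite ler_wpM2r // mulr_ge0 // ltW.
have [N HN] : exists N, forall n, (N <= n)%N -> k ^+ n * (16 / (1 - t) ^+ 2) < e ^+ 2.
  have t10 : 0 < (1 - t) ^+ 2 by rewrite exprn_gt0 // subr_gt0.
  pose M := 16 / (1 - t) ^+ 2; have M0 : 0 < M by rewrite divr_gt0.
  have : (fun n => k ^+ n) @ \oo --> (0 : R) by apply: cvg_expr; rewrite ger0_norm.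
  move/cvgrPdist_lt => /(_ (e ^+ 2 / M)); rewrite divr_gt0 // ?exprn_gt0 // => /(_ isT).
  case=> N _ HN; exists N => n nN; have := HN n nN.
  by rewrite /= sub0r normrN ger0_norm ?exprn_ge0 // ltr_pdivlMr.
exists N => n s nN Us; have [z' [-> r' [w wr V]]] := H n s Us; apply: eW.
rewrite -(@ltr_pXn2r _ 2) ?nnegrE ?nc_ge0 ?(ltW e0) //.
apply: le_lt_trans (HN n nN); rewrite -/(num z').
have t10 : 0 < 1 - t by rewrite subr_gt0.
have dnw : (1 - t) ^+ 2 <= dn w.
  rewrite /dn ler_pXn2r ?nnegrE ?nc_ge0 ?(ltW t10) //.
  apply: le_trans (nc_triangleB _ _); rewrite ncM nc_real Normc.normc1 (ger0_norm t0).
  by rewrite lerB // ler_piMr // (le_trans wr) // ltW.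
have nw : num w <= 4.
  rewrite /num -(_ : 2 ^+ 2 = 4 :> R); last by ring.
  rewrite ler_pXn2r ?nnegrE ?nc_ge0 //; apply: le_trans (nc_triangle _ _) _.
  rewrite ncN nc_real (ger0_norm p0).
  by have := rho1; have := p1; move=> h1 h2; lra.
rewrite mulrA ler_pdivlMr ?exprn_gt0 //.
apply: (@le_trans _ _ (num z' * dn w)); first by rewrite ler_wpM2l ?sqr_ge0.
apply: le_trans V _; rewrite ler_wpM2l ?exprn_ge0 //.
apply: (@le_trans _ _ (4 * 4)); last by lra.
by apply: ler_pM; rewrite ?sqr_ge0 // dn4.
Qed.

End Disc.

(** The same on an open disc, for the radii at which the two affine
    conditions degenerate. *)
Section OpenDisc.
Variable rho : R.
Hypotheses (prho : p < rho) (rho1 : rho <= 1).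
Hypothesis c1 : rho * (1 + 2 * t + p * t) <= 1 + 2 * p + p * t.
Hypothesis c2 :
  t * rho ^+ 3 + (1 + t + p * t) * rho ^+ 2 - (1 + p + p * t) * rho - p <= 0.

Let shrink r : p <= r -> r < rho ->
  [/\ r < 1, r * (1 + 2 * t + p * t) < 1 + 2 * p + p * t &
  t * r ^+ 3 + (1 + t + p * t) * r ^+ 2 - (1 + p + p * t) * r - p <= 0].
Proof.
move=> pr rr; have rr1 : r < 1 := lt_le_trans rr rho1.
have r0 : 0 <= r := le_trans p0 pr.
have h := pt_ge0; split => //.
  apply: lt_le_trans c1; rewrite ltr_pM2r //; plra.
pose q x := t * x ^+ 2 + (1 + t + p * t) * x - (1 + p + p * t).
have qE x : t * x ^+ 3 + (1 + t + p * t) * x ^+ 2 - (1 + p + p * t) * x - p =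
    x * q x - p by rewrite /q; ring.
rewrite qE; have := c2; rewrite qE => c2'.
have qm : q r <= q rho.
  rewrite /q lerD2r lerD // ler_wpM2l //; first by rewrite ler_pXn2r ?nnegrE ?(ltW rr) // (le_trans r0) // ltW.
    by plra.
  exact: ltW.
have [q0|q0] := leP (q r) 0.
  have : r * q r <= 0 by rewrite mulr_ge0_le0.
  plra.
have : r * q r <= rho * q rho by apply: ler_pM => //; exact: ltW.
lra.
Qed.

Lemma gmap_open_disc z : nc z < rho ->
  attracted gmap (Some p%:C) (Some z) /\
  exists2 z', gmap (Some z) = Some z' & nc z' < rho.
Proof.
move=> zr; pose m := Num.max p (nc z).
have mr : m < rho by rewrite gt_max prho.
have pm : p <= m by rewrite le_max lexx.
have zm : nc z <= m by rewrite le_max lexx orbT.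
have [m1 m2 m3] := shrink pm mr; split.
  pose m' := (m + rho) / 2.
  have mm' : m < m' by rewrite /m'; lra.
  have m'r : m' < rho by rewrite /m'; lra.
  have [n1 n2 n3] := shrink (le_trans pm (ltW mm')) m'r.
  apply: (disc_attracted (le_trans pm (ltW mm')) n1 n2 n3).
  exact: le_lt_trans mm'.
have [z' E z'm] := gmap_disc pm m1 m3 zm.
by exists z' => //; exact: le_lt_trans mr.
Qed.

End OpenDisc.

End NormalForm.

Section InverseBranch.
Context {R : realType}.
Variables p t a d : R.
Hypotheses (p0 : 0 <= p) (p1 : p < 1) (t0 : 0 <= t) (t1 : t < 1).
Hypotheses (aE : a = 1 + t + p * t) (dE : d = 1 + p + p * t).
Implicit Types (z w : R[i]) (s : sphere R) (x y m : R).

Local Notation f := (gmap p t a d).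
Let detC0 : a%:C * d%:C - p%:C * t%:C != 0 := detC p0 p1 t0 t1 aE dE.
Let det0 : 0 < a * d - p * t := det_gt0 p0 p1 t0 t1 aE dE.

(** The inverse branch of the normal form on the closed upper half-plane with
    values in the first quadrant. *)
Definition branch w : R[i] := hsqrt ((d%:C * w - p%:C) / (a%:C - t%:C * w)).

Definition regular w := a%:C - t%:C * w != 0.

(** Reflection in the imaginary axis; [refl \o branch] is the second branch
    needed on the upper half-plane, up to complex conjugation of the image. *)
Definition refl z : R[i] := - z^*.

Lemma hsqrt_continuous : continuous (@hsqrt R).
Proof.
move=> z.
have cn : (fun z : R[i] => nc z) @ nbhs z --> nc z by exact: nc_continuous.
have cr : (fun z : R[i] => complex.Re z) @ nbhs z --> complex.Re z.
  exact: Re_continuous.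
have k2 : (fun _ : R[i] => 2^-1 : R) @ nbhs z --> (2^-1 : R) by exact: cvg_cst.
have s1 := cvgM (cvgD cn cr) k2; have fz : Filter (nbhs z) by exact: nbhs_filter.
have s2 := cvgM (cvgB cn cr) k2.
have r1 : (fun z => Num.sqrt ((nc z + complex.Re z) / 2)) @ nbhs z -->
    Num.sqrt ((nc z + complex.Re z) / 2).
  by move=> A nA; exact: (s1 fz fz _ (sqrt_continuous nA)).
have r2 : (fun z => Num.sqrt ((nc z - complex.Re z) / 2)) @ nbhs z -->
    Num.sqrt ((nc z - complex.Re z) / 2).
  by move=> A nA; exact: (s2 fz fz _ (sqrt_continuous nA)).
exact: (cvg_complex r1 r2).
Qed.

Lemma branch_continuous w : regular w -> branch @ nbhs w --> branch w.
Proof.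
move=> rw; have id := cvgC_id w.
have c1 : (fun z => d%:C * z + - p%:C) @ nbhs w --> d%:C * w + - p%:C.
  exact: (cvgCD (cvgCM (cvgC_cst _) id) (cvgC_cst _)).
have c2 : (fun z => a%:C + - t%:C * z) @ nbhs w --> a%:C + - t%:C * w.
  exact: (cvgCD (cvgC_cst _) (cvgCM (cvgC_cst _) id)).
have n2 : a%:C + - t%:C * w != 0 by rewrite mulNr.
have c3 : (fun z => (d%:C * z + - p%:C) * (a%:C + - t%:C * z)^-1) @ nbhs w -->
    (d%:C * w + - p%:C) * (a%:C + - t%:C * w)^-1.
  exact: (cvgCM c1 (cvgCV n2 c2)).
have -> : branch = hsqrt \o (fun z => (d%:C * z + - p%:C) * (a%:C + - t%:C * z)^-1).
  by apply/funext => z; rewrite /= /branch mulNr.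
by move=> A nA; exact: (c3 _ (hsqrt_continuous nA)).
Qed.

Lemma refl_continuous : continuous refl.
Proof.
move=> z A /nbhsC [e e0 eA]; apply/nbhsC; exists e => // w wz.
apply: eA; have -> : refl w - refl z = - (w - z)^*.
  by rewrite rmorphB /refl opprB opprK addrC.
by rewrite ncN nc_conj.
Qed.

Lemma reflK : involutive refl.
Proof. by case=> x y; rewrite /refl; apply: complex_ext => /=; rewrite ?opprK. Qed.

Lemma nc_refl z : nc (refl z) = nc z.
Proof. by rewrite ncN nc_conj. Qed.

Lemma refl0 : refl 0 = 0.
Proof. by apply: complex_ext; rewrite /= ?oppr0. Qed.

Lemma gmap_refl z : f (Some (refl z)) = cj (f (Some z)).
Proof. by rewrite gmap_opp -gmap_cj. Qed.

Lemma refl_upper z : upper z -> upper (refl z).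
Proof. by case: z => x y; rewrite /upper /= opprK. Qed.

Lemma branch_arg_upper w : upper w -> regular w ->
  upper ((d%:C * w - p%:C) / (a%:C - t%:C * w)).
Proof.
move=> uw rw; set q := _ / _.
have : q * (a%:C - t%:C * w) = d%:C * w - p%:C by rewrite divfK.
have n0 : 0 < nc (a%:C - t%:C * w) ^+ 2 by rewrite exprn_gt0 // nc_gt0.
move: uw n0; clearbody q; rewrite nc_sq; clear rw; case: w => x y; case: q => u v.
rewrite /upper /= => y0 n0 /eqP; rewrite eq_complex /= => /andP[/eqP E1 /eqP E2].
rewrite -(pmulr_lge0 _ n0).
set A := (X in X ^+ 2 + _); set B := (X in _ + X ^+ 2).
have -> : v * (A ^+ 2 + B ^+ 2) = A * (u * B + v * A) - B * (u * A - v * B) by ring.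
rewrite /A /B E1 E2.
have -> : (a - (t * x - 0 * y)) * (d * y + 0 * x - 0) - (0 - (t * y + 0 * x)) *
  (d * x - 0 * y - p) = (a * d - p * t) * y by ring.
by rewrite mulr_ge0 // ltW.
Qed.

Lemma branch_quadrant w : quadrant (branch w).
Proof. exact: hsqrt_quadrant. Qed.

Lemma branch_upper w : upper (branch w).
Proof. exact: (hsqrt_quadrant _).2. Qed.

Lemma gmap_branch w : upper w -> regular w -> f (Some (branch w)) = Some w.
Proof.
move=> uw rw; rewrite gmapE -pt1 hsqrt_sq; last exact: branch_arg_upper.
set D := a%:C - t%:C * w in rw *.
have E1 : a%:C * ((d%:C * w - p%:C) / D) + p%:C = (a%:C * d%:C - p%:C * t%:C) / D * w.
  by apply: (mulIf rw); rewrite mulrDl mulrA divfK // mulrAC divfK // /D; ring.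
have E2 : t%:C * ((d%:C * w - p%:C) / D) + d%:C = (a%:C * d%:C - p%:C * t%:C) / D * 1.
  by apply: (mulIf rw); rewrite mulrDl mulrA divfK // mulr1 divfK // /D; ring.
by rewrite E1 E2 pt_scale // mulf_neq0 ?invr_eq0.
Qed.

Lemma gmap_regular z w : f (Some z) = Some w -> regular w.
Proof.
rewrite gmapE /pt; case: eqVneq => // n /Some_inj <-; rewrite /regular.
have -> : a%:C - t%:C * ((a%:C * z ^+ 2 + p%:C) / (t%:C * z ^+ 2 + d%:C)) =
  (a%:C * d%:C - p%:C * t%:C) / (t%:C * z ^+ 2 + d%:C).
  by apply: (mulIf n); rewrite mulrBl mulrA !divfK //; ring.
by rewrite mulf_neq0 ?invr_eq0.
Qed.

Lemma gmap_sq z w : f (Some z) = Some w ->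
  z ^+ 2 = (d%:C * w - p%:C) / (a%:C - t%:C * w).
Proof.
move=> E; have rw := gmap_regular E; apply: (mulIf rw); rewrite divfK //.
move: E; rewrite gmapE /pt; case: eqVneq => // n /Some_inj <-.
by field; exact: n.
Qed.

Lemma gmap_quadrant_upper z w : quadrant z -> f (Some z) = Some w -> upper w.
Proof.
move=> /sq_upper qz; rewrite gmapE /pt; case: eqVneq => // n /Some_inj E.
have : w * (t%:C * z ^+ 2 + d%:C) = a%:C * z ^+ 2 + p%:C by rewrite -E divfK.
have n0 : 0 < nc (t%:C * z ^+ 2 + d%:C) ^+ 2 by rewrite exprn_gt0 // nc_gt0.
move: qz n0; rewrite nc_sq; clear E n; case: (z ^+ 2) => x y; case: w => u v.
rewrite /upper /= => y0 n0 /eqP; rewrite eq_complex /= => /andP[/eqP E1 /eqP E2].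
rewrite -(pmulr_lge0 _ n0).
set A := (X in X ^+ 2 + _); set B := (X in _ + X ^+ 2).
have -> : v * (A ^+ 2 + B ^+ 2) = A * (u * B + v * A) - B * (u * A - v * B) by ring.
rewrite /A /B E1 E2.
have -> : (t * x - 0 * y + d) * (a * y + 0 * x + 0) - (t * y + 0 * x + 0) *
  (a * x - 0 * y + p) = (a * d - p * t) * y by ring.
by rewrite mulr_ge0 // ltW.
Qed.

Lemma branch_uniq z w : quadrant z -> f (Some z) = Some w -> z = branch w.
Proof.
move=> qz E; apply: quadrant_sq_inj => //; first exact: branch_quadrant.
rewrite /branch hsqrt_sq ?(gmap_sq E) // -(gmap_sq E); exact: sq_upper.
Qed.

(** On the upper half-plane the dynamics folds: a point is recovered from its
    image, or from the conjugate of its image, by one of the two branches. *)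
Lemma unfold z w : upper z -> f (Some z) = Some w ->
  (upper w /\ z = branch w) \/ (upper w^* /\ z = refl (branch w^*)).
Proof.
move=> uz E; have [x0|x0] := leP 0 (complex.Re z); [left|right].
  have qz : quadrant z by split.
  by split; [exact: gmap_quadrant_upper qz E|exact: branch_uniq].
have qz : quadrant (refl z).
  split; last exact: refl_upper.
  by case: z x0 {uz E} => x y /= x0; rewrite oppr_ge0 ltW.
have E' : f (Some (refl z)) = Some w^* by rewrite gmap_refl E.
split; first exact: gmap_quadrant_upper qz E'.
by rewrite -[LHS]reflK; congr refl; exact: branch_uniq.
Qed.

Lemma attracted_cj s : attracted f (Some p%:C) s -> attracted f (Some p%:C) (cj s).
Proof.
have E : f = cj \o f \o cj by apply/funext => u /=; rewrite -gmap_cj cjK.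
move=> H; rewrite {1}E.
have := attracted_conj (@cjK R) (@cjK R) (@cj_continuous R) (@cj_continuous R) H.
have -> : cj (Some p%:C) = Some p%:C by congr Some; exact: conjc_real.
by [].
Qed.

(** The basin is exhausted by the preimages of the disc of radius rho. Their
    upper halves are obtained by applying both branches to the previous one, and
    the two images share the critical point 0, so connectedness is inherited. *)
Section Connected.
Variable rho : R.
Hypothesis disc : forall z, nc z < rho -> attracted f (Some p%:C) (Some z) /\
  exists2 z', f (Some z) = Some z' & nc z' < rho.
Hypothesis p_rho : p < rho.
Hypothesis basin_None : ~ attracted f (Some p%:C) None.

Let cf : continuous f := gmap_continuous p0 p1 t0 t1 aE dE.

Fixpoint pull n : set R[i] :=
  if n is n'.+1 then branch @` pull n' `|` (refl \o branch) @` pull n'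
  else [set z | upper z /\ nc z < rho].

Lemma pull_basin n z : pull n z ->
  [/\ upper z, attracted f (Some p%:C) (Some z) & regular z].
Proof.
have reg w : attracted f (Some p%:C) (Some w) -> regular w.
  move=> Aw; apply/eqP => /eqP; rewrite subr_eq0 => /eqP aw.
  apply: basin_None; apply: (basin_preimage cf); rewrite /basin /=.
  have tn : t%:C != 0.
    apply/eqP => tz; move: aw; rewrite tz mul0r => /eqP.
    by rewrite (inj_eq (@complexI R)) gt_eqF // (lt_le_trans ltr01) // (a_ge1 p0 p1 t0 t1 aE).
  have -> : pt a%:C t%:C = Some w; last exact: Aw.
  rewrite pt_Some //; congr Some; apply: (mulIf tn).
  by rewrite divfK // mulrC.
elim: n z => [z [uz zr]|n IH z].
  by have [Az _] := disc zr; split => //; exact: reg.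
have step w : pull n w -> attracted f (Some p%:C) (Some (branch w)).
  move=> /IH [uw Aw rw]; apply: (basin_preimage cf).
  by rewrite gmap_branch.
move=> [[w pw <-]|[w pw <-]].
  by split; [exact: branch_upper|exact: step|exact/reg/step].
have A : attracted f (Some p%:C) (Some (refl (branch w))).
  apply: (basin_preimage cf); rewrite gmap_refl; have [uw Aw rw] := IH _ pw.
  rewrite (gmap_branch uw rw); exact: (attracted_cj Aw).
by split; [exact/refl_upper/branch_upper|exact: A|exact: reg].
Qed.

Lemma pull_unfold n z w : upper z -> f (Some z) = Some w ->
  (upper w -> pull n w) -> (upper w^* -> pull n w^*) -> pull n.+1 z.
Proof.
move=> uz E H1 H2; have [[uw ->]|[uw ->]] := unfold uz E; [left|right].
  by exists w => //; exact: H1.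
by exists w^* => //; exact: H2.
Qed.

Lemma pull_incr n : pull n `<=` pull n.+1.
Proof.
elim: n => [|n IH] z.
  move=> [uz zr]; have [_ [w E wr]] := disc zr.
  by apply: (pull_unfold uz E) => uw; split => //; rewrite nc_conj.
move=> [[w pw <-]|[w pw <-]]; [left|right]; exists w => //; exact: IH.
Qed.

Lemma pull0 n : pull n 0.
Proof.
elim: n => [|n IH]; last exact: pull_incr.
split; first by rewrite /upper.
by rewrite Normc.normc0 (le_lt_trans p0).
Qed.

Lemma pull_complete n z : upper z -> (exists2 w, iter n f (Some z) = Some w & nc w < rho) ->
  pull n z.
Proof.
elim: n z => [|n IH] z uz [w].
  by move=> /= /Some_inj E wr; split => //; rewrite E.
rewrite iterSr => E wr.
case E1 : (f (Some z)) E => [v|] E; last first.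
  exfalso; apply: basin_None.
  have : basin f (Some p%:C) (iter n f None) by rewrite E; have [] := disc wr.
  by elim: n {IH E} => //= n IH H; apply: IH; exact: (basin_preimage cf).
apply: (pull_unfold uz E1) => uv; apply: IH => //; first by exists w.
have it k s : iter k f (cj s) = cj (iter k f s).
  by elim: k => //= k ->; rewrite gmap_cj.
by exists w^*; rewrite ?nc_conj // -[Some v^*]/(cj (Some v)) it E.
Qed.

Lemma segment_star (z : R[i]) : connected [set s%:C * z | s in `[0, 1]%classic : set R].
Proof.
apply: connected_continuous_connected; first exact: segment_connected.
apply: continuous_subspaceT => s.
have c1 : (fun s : R => s%:C) @ nbhs s --> s%:C.
  by apply: cvg_complex; [exact: cvg_id|exact: cvg_cst].
exact: (cvgCM c1 (cvgC_cst z)).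
Qed.

Lemma pull_connected n : connected (pull n).
Proof.
elim: n => [|n IH].
  have -> : pull 0 = \bigcup_(z in pull 0) [set s%:C * z | s in `[0, 1]%classic : set R].
    apply/seteqP; split => [z pz|z].
      exists z => //; exists 1; last by rewrite mul1r.
      by rewrite /= in_itv /= lexx ler01.
    move=> [w [uw wr] [s /= /[!in_itv] /= /andP[s0 s1] <-]]; split.
      case: w uw {wr} => x y; rewrite /upper /= => y0.
      by rewrite mul0r addr0 mulr_ge0.
    rewrite ncM nc_real ger0_norm //; apply: le_lt_trans wr.
    by rewrite ler_piMl ?nc_ge0.
  apply: bigcup_connected; last by move=> z _; exact: segment_star.
  exists 0 => z _; exists 0; last by rewrite mul0r.
  by rewrite /= in_itv /= lexx ler01.
have cb : {within pull n, continuous branch}.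
  by apply: continuous_in_subspaceT => w /set_mem /pull_basin [_ _ rw]; exact: branch_continuous.
have c1 : connected (branch @` pull n) by exact: connected_continuous_connected.
have c2 : connected ((refl \o branch) @` pull n).
  rewrite (_ : _ @` _ = refl @` (branch @` pull n)); last first.
    apply/seteqP; split=> [z [w pw <-]|z [_ [w pw <-] <-]]; last by exists w.
    by exists (branch w) => //; exists w.
  exact: (connected_continuous_connected c1 (continuous_subspaceT refl_continuous)).
have f00 : pull n.+1 0 := pull0 n.+1.
have b0 : exists2 w, pull n w & branch w = 0.
  case: f00 => [[w pw E]|[w pw E]]; first by exists w.
  exists w => //; rewrite -[LHS]reflK -[refl (branch w)]/((refl \o branch) w) E.
  by rewrite refl0.
case: b0 => w pw bw; apply: connectedU => //.
exists 0; split; exists w => //=.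
by rewrite bw refl0.
Qed.

Lemma gmap_basin_connected : connected (basin f (Some p%:C)).
Proof.
pose U : set R[i] := \bigcup_n pull n.
have cU : connected U.
  apply: bigcup_connected; last by move=> n _; exact: pull_connected.
  by exists 0 => n _; exact: pull0.
have -> : basin f (Some p%:C) = Some @` U `|` cj @` (Some @` U).
  apply/seteqP; split => s; last first.
    move=> [[z [n _ /pull_basin [_ H _]] <-] //|[_ [z [n _ /pull_basin [_ H _]] <-] <-]].
    exact: attracted_cj.
  have enter v : basin f (Some p%:C) v ->
     exists n, exists2 w, iter n f v = Some w & nc w < rho.
    move=> [V [nV HV]].
    have [|N HN] := HV (fun s => if s is Some w then nc w < rho : Prop else False).
      apply/nbhs_Some; exists (rho - p); first by rewrite subr_gt0.
      move=> w wp /=; have := nc_triangleB w p%:C; rewrite nc_real ger0_norm //.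
      by move: wp; lra.
    exists N; have := HN N v (leqnn N) (nbhs_singleton nV).
    by case: (iter N f v) => // w wr; exists w.
  case: s => [z|]; last by move=> /basin_None.
  move=> Bz; have [uz|uz] := leP 0 (complex.Im z).
    left; exists z => //; have [n Hn] := enter _ Bz; exists n => //.
    exact: pull_complete.
  right; exists (Some z^*); last by rewrite /= conjcK.
  exists z^* => //; have [n Hn] := enter _ (attracted_cj Bz); exists n => //.
  by apply: pull_complete => //; case: z uz {Bz Hn} => x y; rewrite /upper /= => /ltW; rewrite oppr_ge0.
have cSU : connected (Some @` U : set (sphere R)).
  apply: connected_continuous_connected => //; apply: continuous_subspaceT.
  exact: one_point_compactification_some_continuous.
apply: connectedU => //.
  exists (Some 0); split; first by exists 0 => //; exists 0%N => //; exact: pull0.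
  exists (Some 0); last by congr Some; apply: complex_ext; rewrite /= ?oppr0.
  by exists 0 => //; exists 0%N => //; exact: pull0.
exact: (connected_continuous_connected cSU (continuous_subspaceT (@cj_continuous R))).
Qed.

End Connected.
End InverseBranch.

(** * The invariant annulus and uniform expansion *)

Lemma unif_frac (F : fieldType) (A P T K x y : F) : K != 0 ->
  1 - T * x != 0 -> 1 - T * y != 0 -> 1 + T * x != 0 -> 1 + T * y != 0 ->
  ((A * x ^+ 2 + P) / (K * ((1 - T * x) * (1 + T * x))) -
   (A * y ^+ 2 + P) / (K * ((1 - T * y) * (1 + T * y)))) *
  (K * ((1 + T * x) * (1 + T * y))) =
  (A + P * T ^+ 2) * (x / (1 - T * x) - y / (1 - T * y)) * (x + y).
Proof. by move=> k x1 y1 x2 y2; field; rewrite k x1 y1 x2 y2. Qed.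

Lemma mobius_sub (F : fieldType) (A P T D x y : F) :
  A - T * x != 0 -> A - T * y != 0 ->
  (D * x - P) / (A - T * x) - (D * y - P) / (A - T * y) =
  (A * D - P * T) * (x - y) / ((A - T * x) * (A - T * y)).
Proof. by move=> x1 y1; field; rewrite x1 y1. Qed.

Section Annulus.
Context {R : realType}.
Variables p t a d : R.
Hypotheses (t0 : 0 <= t) (tp : t <= p) (p1 : p < 1).
Hypotheses (aE : a = 1 + t + p * t) (dE : d = 1 + p + p * t).
Implicit Types (z w x y : R[i]) (s : sphere R).

Lemma ann_bounds : [/\ 0 <= t, t <= p, p < 1, 0 <= p & t < 1] /\ 0 <= p * t.
Proof.
have h : 0 <= p by exact: le_trans tp.
by split; [split => //; exact: le_lt_trans p1|exact: mulr_ge0].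
Qed.

Let p0 : 0 <= p. Proof. by have [[]] := ann_bounds. Qed.
Let t1 : t < 1. Proof. by have [[]] := ann_bounds. Qed.

Local Notation f := (gmap p t a d).

(** A radius between 1 and 1/t such that the exterior of the disc is absorbed by
    the fixed point 1/t. With this choice the cubic condition on the inverse
    radius factors at p = 1, which is the worst case. *)
Definition outer_radius : R := 3 / (1 + 2 * t).
Local Notation Y := outer_radius.

Definition annulus z := 1 <= nc z /\ nc z <= Y.

Lemma outer_radius_gt1 : 1 < Y.
Proof. by have [[? ? ? ? ?] ?] := ann_bounds; rewrite /Y ltr_pdivlMr; lra. Qed.

Lemma outer_radius_t : t * Y < 1.
Proof.
by have [[? ? ? ? ?] ?] := ann_bounds; rewrite /Y mulrA ltr_pdivrMr; lra.
Qed.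

Lemma outer_radiusV : Y^-1 = (1 + 2 * t) / 3.
Proof. by rewrite /Y invf_div. Qed.

Lemma inner_disc z : nc z < 1 -> attracted f (Some p%:C) (Some z) /\
  exists2 z', f (Some z) = Some z' & nc z' < 1.
Proof.
have [[? ? ? ? ?] ?] := ann_bounds.
by apply: gmap_open_disc => //; rewrite ?expr1n; lra.
Qed.

(** Inversion exchanges the parameters p and t. *)
Lemma gmap_sinv s : gmap p t a d (sinv s) = sinv (gmap t p d a s).
Proof.
have [x [y [n ->]]] := ptP s; rewrite sinv_pt // /gmap !qmap_pt //; last first.
  by move: n; rewrite /nonzero2 orbC.
rewrite !mul0r !addr0 sinv_pt; first by congr pt; ring.
apply: mob_nonzero; last by rewrite nonzero2_sq.
by rewrite mulrC [t%:C * _]mulrC; exact: (detC p0 p1 t0 t1 aE dE).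
Qed.

Lemma gmap_sinv_conj : f = sinv \o gmap t p d a \o sinv.
Proof. by apply/funext => s /=; rewrite -gmap_sinv sinvK. Qed.

Let aE' : d = 1 + p + t * p. Proof. by rewrite dE [t * p]mulrC. Qed.
Let dE' : a = 1 + t + t * p. Proof. by rewrite aE [t * p]mulrC. Qed.

Lemma outer_disc_swap z : nc z < Y^-1 -> attracted (gmap t p d a) (Some t%:C) (Some z) /\
  exists2 z', gmap t p d a (Some z) = Some z' & nc z' < Y^-1.
Proof.
have [[h1 h2 h3 h4 h5] h6] := ann_bounds.
set y := Y^-1; have yE : t = (3 * y - 1) / 2 by rewrite /y outer_radiusV; field.
have y0 : 1 <= 3 * y by lra.
have y1 : y < 1 by lra.
apply: gmap_open_disc => //; first by lra.
- exact: ltW.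
- have e : 0 <= (1 - p) * (1 + t) + t * (1 - p * t).
    by rewrite addr_ge0 // mulr_ge0; nra.
  have yE' : y = (1 + 2 * t) / 3 by rewrite /y outer_radiusV.
  rewrite yE'; nra.
have c1 : 0 <= y * (y ^+ 2 + y - t * (1 - y)) by rewrite mulr_ge0 //; nra.
have c2 : (5 * y ^+ 3 - 3 * y ^+ 2 - 3 * y + 1) / 2 <= 0.
  have -> : (5 * y ^+ 3 - 3 * y ^+ 2 - 3 * y + 1) / 2 =
    - ((1 - y) * (5 * y ^+ 2 + 2 * y - 1) / 2) by field.
  by rewrite oppr_le0 divr_ge0 // mulr_ge0; nra.
(* affine in p, with a favourable slope: the value at p = 1 decides *)
have -> : p * y ^+ 3 + (1 + p + t * p) * y ^+ 2 - (1 + t + t * p) * y - t =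
  (5 * y ^+ 3 - 3 * y ^+ 2 - 3 * y + 1) / 2 -
  (1 - p) * (y * (y ^+ 2 + y - t * (1 - y))) by rewrite yE; field.
have := mulr_ge0 (_ : 0 <= 1 - p) c1; rewrite subr_ge0 ltW // => /(_ isT); lra.
Qed.

Lemma outer_disc z : nc z < Y^-1 ->
  attracted f (sinv (Some t%:C)) (sinv (Some z)) /\
  exists2 z', f (sinv (Some z)) = sinv (Some z') & nc z' < Y^-1.
Proof.
move=> zY; have [A [z' E z'Y]] := outer_disc_swap zY; split; last first.
  by exists z' => //; rewrite gmap_sinv E.
rewrite gmap_sinv_conj; apply: attracted_conj => //; try exact: sinvK;
  exact: sinv_continuous.
Qed.

Lemma sinv_outer w : Y < nc w -> exists2 z, Some w = sinv (Some z) & nc z < Y^-1.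
Proof.
move=> wY; have Y0 : 0 < Y := lt_trans ltr01 outer_radius_gt1.
have w0 : w != 0 by rewrite -nc_gt0 (lt_trans Y0).
exists w^-1; first by rewrite /= invr_eq0 (negbTE w0) invrK.
by rewrite ncV ltf_pV2 // posrE // (lt_trans Y0).
Qed.

(** Points leaving the annulus never come back, so preimages of its points
    that are finite lie in it. *)
Lemma annulus_preimage z w : f (Some z) = Some w -> annulus w -> annulus z.
Proof.
move=> E [w1 wY]; split.
  rewrite leNgt; apply/negP => /inner_disc [_ [z']]; rewrite E => /Some_inj <-.
  by rewrite ltNge w1.
rewrite leNgt; apply/negP => /sinv_outer [v Ev /outer_disc [_ [v']]].
rewrite -Ev E => /= E'; case: eqVneq E' => // v0 /Some_inj E'.
have Y0 : 0 < Y := lt_trans ltr01 outer_radius_gt1.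
have v0' : 0 < nc v' by rewrite nc_gt0.
move: wY; rewrite E' ncV => wY; apply/negP; rewrite -leNgt.
by rewrite -(invrK (nc v')) lef_pV2 // posrE // invr_gt0.
Qed.

Definition half_annulus z := upper z /\ annulus z.
Local Notation X := half_annulus.

Lemma annulus_reg z : nc z <= Y -> t * nc z < 1.
Proof.
by move=> zY; apply: le_lt_trans outer_radius_t; rewrite ler_wpM2l.
Qed.

Lemma nc_one_sub z : nc z <= Y -> 1 - t * Y <= nc (1 - t%:C * z).
Proof.
move=> zY; apply: le_trans (nc_triangleB _ _).
by rewrite Normc.normc1 ncM nc_real ger0_norm // lerB // ler_wpM2l.
Qed.

Lemma nc_a_sub z : nc z <= Y -> 1 - t * Y <= nc (a%:C - t%:C * z).
Proof.
move=> zY; apply: le_trans (nc_triangleB _ _).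
have a1 := a_ge1 p0 p1 t0 t1 aE.
rewrite nc_real ger0_norm ?(le_trans ler01) // ncM nc_real ger0_norm //.
by rewrite lerB // ler_wpM2l.
Qed.

Let gap0 : 0 < 1 - t * Y. Proof. by rewrite subr_gt0 outer_radius_t. Qed.

Lemma annulus_regular z : nc z <= Y -> regular t a z.
Proof. by move=> zY; rewrite /regular -nc_gt0; exact: lt_le_trans (nc_a_sub zY). Qed.

Lemma branch_half z : X z -> X (branch p t a d z).
Proof.
move=> [uz az]; split; first exact: branch_upper.
apply: (annulus_preimage _ az); apply: gmap_branch => //.
by case: az => _; exact: annulus_regular.
Qed.

Lemma refl_half z : X z -> X (refl z).
Proof. by move=> [uz az]; split; [exact: refl_upper|rewrite /annulus nc_refl]. Qed.

(** The coordinate sending the fixed point 1/t to infinity; on the annulus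
    the map expands its Euclidean metric. *)
Definition unif z := z / (1 - t%:C * z).

Let sub0 z : t * nc z < 1 -> 1 - t%:C * z != 0.
Proof.
move=> h; rewrite -nc_gt0; apply: lt_le_trans (nc_triangleB _ _).
by rewrite Normc.normc1 ncM nc_real ger0_norm // subr_gt0.
Qed.

Let add0 z : t * nc z < 1 -> 1 + t%:C * z != 0.
Proof.
by move=> h; have := @sub0 (- z); rewrite ncN mulrN opprK; exact.
Qed.

Lemma unif_gmap z w : t * nc z < 1 -> f (Some z) = Some w ->
  unif w = (a%:C * z ^+ 2 + p%:C) / ((1 + p)%:C * ((1 - t%:C * z) * (1 + t%:C * z))).
Proof.
move=> zt; rewrite gmapE /pt; case: eqVneq => // n /Some_inj <-; rewrite /unif.
set D := t%:C * z ^+ 2 + d%:C in n *.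
have p0' : (1 + p)%:C != 0 :> R[i].
  by rewrite (inj_eq (@complexI R)) gt_eqF // ltr_wpDr.
have E : 1 - t%:C * ((a%:C * z ^+ 2 + p%:C) / D) =
    (1 + p)%:C * ((1 - t%:C * z) * (1 + t%:C * z)) / D.
  apply: (mulIf n); rewrite mulrBl mul1r mulrA !divfK // /D aE dE.
  by rewrite !(rmorphD, rmorphM) rmorph1; ring.
rewrite E -mulf_div divff ?invr_eq0 // mulr1.
by rewrite invrM ?invrK ?unitfE ?invr_eq0 // ?mulf_neq0 // ?sub0 ?add0.
Qed.

Lemma unif_gmap_sub z1 z2 w1 w2 : t * nc z1 < 1 -> t * nc z2 < 1 ->
  f (Some z1) = Some w1 -> f (Some z2) = Some w2 ->
  nc (unif w1 - unif w2) * ((1 + p) * (nc (1 + t%:C * z1) * nc (1 + t%:C * z2))) =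
  (1 + t) * (1 + p * t) * nc (unif z1 - unif z2) * nc (z1 + z2).
Proof.
move=> h1 h2 E1 E2.
have n1 := sub0 h1; have n2 := sub0 h2; have m1 := add0 h1; have m2 := add0 h2.
have p0' : (1 + p)%:C != 0 :> R[i].
  by rewrite (inj_eq (@complexI R)) gt_eqF // ltr_wpDr.
have -> : 1 + p = nc (1 + p)%:C by rewrite nc_real ger0_norm // addr_ge0.
have -> : (1 + t) * (1 + p * t) = nc (a + p * t ^+ 2)%:C.
  rewrite nc_real aE ger0_norm; first by ring.
  by rewrite !addr_ge0 ?mulr_ge0 ?sqr_ge0.
rewrite -!ncM; congr (nc _); rewrite (unif_gmap h1 E1) (unif_gmap h2 E2) /unif.
by rewrite (unif_frac _ _ p0' n1 n2 m1 m2) rmorphD rmorphM rmorphXn.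
Qed.

Lemma unif_conj z1 z2 : nc (unif z1^* - unif z2^*) = nc (unif z1 - unif z2).
Proof.
have E z : unif z^* = (unif z)^*.
  rewrite /unif conjC_div; congr (_ / _).
  by case: z => x y; apply: complex_ext => /=; ring.
by rewrite !E -rmorphB nc_conj.
Qed.

Lemma unif_lip x y : nc x <= Y -> nc y <= Y -> nc (x - y) <= 4 * nc (unif x - unif y).
Proof.
move=> xY yY; have h1 := annulus_reg xY; have h2 := annulus_reg yY.
have n1 := sub0 h1; have n2 := sub0 h2.
have -> : x - y = (unif x - unif y) * ((1 - t%:C * x) * (1 - t%:C * y)).
  by rewrite /unif; field; rewrite n1 n2.
rewrite ncM mulrC ler_wpM2r ?nc_ge0 // ncM.
have b z : t * nc z < 1 -> nc (1 - t%:C * z) <= 2.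
  move=> h; apply: le_trans (nc_triangle _ _) _.
  by rewrite ncN ncM nc_real Normc.normc1 (ger0_norm t0); lra.
rewrite (_ : 4 = 2 * 2 :> R); last by ring.
by apply: ler_pM; rewrite ?nc_ge0 ?b.
Qed.

Lemma unif_lipV x y : nc x <= Y -> nc y <= Y ->
  nc (unif x - unif y) * (1 - t * Y) ^+ 2 <= nc (x - y).
Proof.
move=> xY yY; have h1 := annulus_reg xY; have h2 := annulus_reg yY.
have n1 := sub0 h1; have n2 := sub0 h2.
have -> : x - y = (unif x - unif y) * ((1 - t%:C * x) * (1 - t%:C * y)).
  by rewrite /unif; field; rewrite n1 n2.
rewrite ncM ler_wpM2l ?nc_ge0 // ncM expr2.
by apply: ler_pM; rewrite ?nc_one_sub // ltW.
Qed.

(** Nearby points of the annulus are moved apart by a definite factor. By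
    the parallelogram law |z1 + z2|^2 >= 4 |z1 z2| - |z1 - z2|^2, and since
    r/(1 + t r)^2 increases for r < 1/t the factor is at least
    l = f'(1) > 1, up to an error that vanishes with |z1 - z2|. *)
Lemma expansion : exists2 mu : R, 1 < mu & exists2 delta : R, 0 < delta &
  forall z1 z2 w1 w2, annulus z1 -> annulus z2 -> nc (z1 - z2) ^+ 2 <= delta ->
  f (Some z1) = Some w1 -> f (Some z2) = Some w2 ->
  mu * nc (unif z1 - unif z2) <= nc (unif w1 - unif w2).
Proof.
have [[? ? ? ? ?] ?] := ann_bounds.
have q0 : 0 < (1 + p) * (1 + t) by rewrite mulr_gt0; lra.
pose l := 2 * (1 + p * t) / ((1 + p) * (1 + t)).
have l1 : 1 < l by rewrite /l ltr_pdivlMr //; nra.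
have lE : l * ((1 + p) * (1 + t)) = 2 * (1 + p * t) by rewrite /l divfK // gt_eqF.
clearbody l.
pose mu := (1 + l) / 2; have mu1 : 1 < mu by rewrite /mu; lra.
have mul : mu < l by rewrite /mu; lra.
have l0 : 0 < l by lra.
exists mu => //; exists (4 * (1 - (mu / l) ^+ 2)).
  rewrite mulr_gt0 // subr_gt0 exprn_ilt1 // ?divr_ge0 //; try lra.
  by rewrite ltr_pdivrMr // mul1r.
move=> z1 z2 w1 w2 [r1 r1Y] [r2 r2Y] dz E1 E2.
have h1 := annulus_reg r1Y; have h2 := annulus_reg r2Y.
have := unif_gmap_sub h1 h2 E1 E2.
set U := nc (unif w1 - _); set V := nc (unif z1 - _); set s := nc (z1 + z2).
set e1 := nc (1 + _); set e2 := nc (1 + _) => H.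
have e10 : 0 < e1 by rewrite nc_gt0 add0.
have e20 : 0 < e2 by rewrite nc_gt0 add0.
have V0 : 0 <= V := nc_ge0 _.
have main : mu * ((1 + p) * (e1 * e2)) <= (1 + t) * (1 + p * t) * s.
  have s0 : 0 <= s := nc_ge0 _.
  suff : (2 * mu * (e1 * e2)) ^+ 2 <= (l * (1 + t) ^+ 2 * s) ^+ 2.
    rewrite ler_pXn2r ?nnegrE ?mulr_ge0 ?sqr_ge0 ?(ltW e10) ?(ltW e20) //; try lra.
    move=> h; have : 0 <= 1 + p by lra.
    move=> /ler_wpM2l /(_ _ _ h).
    have -> : (1 + p) * (l * (1 + t) ^+ 2 * s) = (l * ((1 + p) * (1 + t))) * (1 + t) * s by ring.
    by rewrite lE; lra.
  have S : nc z1 * nc z2 * (mu / l) ^+ 2 * 4 <= s ^+ 2.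
    have := parallelogram z1 z2; rewrite -/s => P.
    have q : 0 <= (nc z1 - nc z2) ^+ 2 by exact: sqr_ge0.
    have pp : 1 <= nc z1 * nc z2 by rewrite mulr_ege1.
    have qq : 0 <= 1 - (mu / l) ^+ 2.
      rewrite subr_ge0 exprn_ile1 // ?divr_ge0 //; try lra.
      by rewrite ler_pdivrMr // mul1r ltW.
    nra.
  have T z : 1 <= nc z -> t * nc z < 1 -> nc (1 + t%:C * z) ^+ 2 <= nc z * (1 + t) ^+ 2.
    move=> g1 g2; apply: (@le_trans _ _ ((1 + t * nc z) ^+ 2)).
      rewrite ler_pXn2r ?nnegrE ?nc_ge0 // ?addr_ge0 ?mulr_ge0 ?nc_ge0 //.
      apply: le_trans (nc_triangle _ _) _.
      by rewrite ncM nc_real Normc.normc1 (ger0_norm t0).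
    rewrite -subr_ge0.
    have -> : nc z * (1 + t) ^+ 2 - (1 + t * nc z) ^+ 2 =
      (nc z - 1) * (1 - t * (t * nc z)) by ring.
    by rewrite mulr_ge0 ?subr_ge0 // mulr_ile1 ?mulr_ge0 ?nc_ge0 // ltW.
  have T12 : e1 ^+ 2 * e2 ^+ 2 <= (nc z1 * (1 + t) ^+ 2) * (nc z2 * (1 + t) ^+ 2).
    by apply: ler_pM; rewrite ?sqr_ge0 // T.
  have mE : mu = (mu / l) * l by rewrite divfK // gt_eqF.
  have -> : (2 * mu * (e1 * e2)) ^+ 2 = 4 * (mu / l) ^+ 2 * l ^+ 2 * (e1 ^+ 2 * e2 ^+ 2).
    by rewrite {1}mE; ring.
  have k1 : 0 <= 4 * (mu / l) ^+ 2 * l ^+ 2.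
    by apply: mulr_ge0 (sqr_ge0 _); apply: mulr_ge0 (sqr_ge0 _); lra.
  apply: le_trans (ler_wpM2l k1 T12) _.
  have := ler_wpM2l (sqr_ge0 (l * (1 + t) ^+ 2)) S; lra.
have k0 : 0 < (1 + p) * (e1 * e2) by rewrite mulr_gt0 ?mulr_gt0 //; lra.
rewrite -(ler_pM2r k0) H.
have := ler_wpM2r V0 main; lra.
Qed.

(** The branches are only Holder continuous at the critical value, which is
    enough to keep images of nearby points within the range of the
    expansion estimate. *)
Lemma branch_close : exists2 C : R, 0 < C & forall x y, X x -> X y ->
  nc (branch p t a d x - branch p t a d y) ^+ 2 <= C * nc (unif x - unif y).
Proof.
have det0 := det_gt0 p0 p1 t0 t1 aE dE.
exists ((a * d - p * t) * 4 / (1 - t * Y) ^+ 2).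
  by rewrite divr_gt0 ?mulr_gt0 ?exprn_gt0.
move=> x y [ux [_ xY]] [uy [_ yY]].
have rx := annulus_regular xY; have ry := annulus_regular yY.
apply: le_trans (hsqrt_holder _ _) _;
  try exact: (branch_arg_upper p0 p1 t0 t1 aE dE).
have -> : (d%:C * x - p%:C) / (a%:C - t%:C * x) - (d%:C * y - p%:C) / (a%:C - t%:C * y)
   = (a * d - p * t)%:C * (x - y) / ((a%:C - t%:C * x) * (a%:C - t%:C * y)).
  by rewrite (mobius_sub _ _ rx ry) rmorphB !rmorphM.
rewrite ncM ncV ncM nc_real (ger0_norm (ltW det0)) !ncM.
rewrite ler_pdivrMr ?mulr_gt0 ?nc_gt0 //.
set L := nc (a%:C - _); set L' := nc (a%:C - _).
have LL : (1 - t * Y) ^+ 2 <= L * L'.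
  by rewrite expr2; apply: ler_pM; rewrite ?nc_a_sub // ltW.
have g2 : 0 < (1 - t * Y) ^+ 2 by rewrite exprn_gt0.
apply: (@le_trans _ _ ((a * d - p * t) * (4 * nc (unif x - unif y)))).
  by rewrite ler_wpM2l ?unif_lip // ltW.
rewrite -subr_ge0.
set k := 1 - t * Y in g2 LL *; set D := a * d - p * t in det0 *.
have -> : D * 4 / k ^+ 2 * nc (unif x - unif y) * (L * L') - D * (4 * nc (unif x - unif y)) =
  D * 4 * nc (unif x - unif y) * (L * L' - k ^+ 2) / k ^+ 2.
  by field; rewrite gt_eqF.
by rewrite divr_ge0 ?(ltW g2) // mulr_ge0 ?subr_ge0 // !mulr_ge0 ?nc_ge0 // ltW.
Qed.

(** The letter false stands for the branch with values in the first quadrant. *)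
Fixpoint branches (c : seq bool) z : R[i] :=
  if c is b :: c' then
    let w := branch p t a d (branches c' z) in if b then refl w else w
  else z.

Lemma branches_half c z : X z -> X (branches c z).
Proof.
move=> Xz; elim: c => //= b c IH; have := branch_half IH.
by case: b => // ?; exact: refl_half.
Qed.

(** Contraction for points closer than eta in the expanded metric; images stay
    closer than eta, so the estimate can be iterated. *)
Lemma branches_contract_near : exists2 mu : R, 1 < mu & exists2 eta : R, 0 < eta &
  forall c x y, X x -> X y -> nc (unif x - unif y) <= eta ->
  mu ^+ size c * nc (unif (branches c x) - unif (branches c y)) <= eta.
Proof.
have [mu mu1 [de de0 Hexp]] := expansion; have [C C0 Hclose] := branch_close.
exists mu => //; exists (de / C); first exact: divr_gt0.
move=> c x y Xx Xy xy; elim: c => [|b c IH]; first by rewrite expr0 mul1r.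
set v := branches c x in IH; set v' := branches c y in IH.
have Xv : X v by exact: branches_half.
have Xv' : X v' by exact: branches_half.
have D0 := nc_ge0 (unif v - unif v').
have close : nc (branch p t a d v - branch p t a d v') ^+ 2 <= de.
  apply: le_trans (Hclose _ _ Xv Xv') _.
  rewrite -ler_pdivlMl // mulrC; apply: le_trans IH; rewrite ler_peMl //.
  by rewrite exprn_ege1 // ltW.
have [_ av] := branch_half Xv; have [_ av'] := branch_half Xv'.
have E z : X z -> f (Some (branch p t a d z)) = Some z.
  by move=> [uz [_ zY]]; apply: gmap_branch => //; exact: annulus_regular.
apply: le_trans IH; rewrite [size _]/= exprSr -mulrA ler_wpM2l ?exprn_ge0 //.
  by rewrite (le_trans ler01) // ltW.
rewrite /= -/v -/v'; case: b.
  rewrite -[leRHS]unif_conj; apply: Hexp.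
  - by rewrite /annulus nc_refl.
  - by rewrite /annulus nc_refl.
  - by rewrite (_ : refl _ - refl _ = refl (branch p t a d v - branch p t a d v')) ?nc_refl //
      /refl rmorphB opprB opprK addrC.
  - by rewrite gmap_refl E.
  - by rewrite gmap_refl E.
by apply: Hexp => //; exact: E.
Qed.

End Annulus.

(** * Uniform contraction of the inverse branches *)

Section Polar.
Context {R : realType}.
Implicit Types (r c x y : R).

Lemma sqrt_sub_sq x y : 0 <= x -> 0 <= y ->
  (Num.sqrt x - Num.sqrt y) ^+ 2 <= `|x - y|.
Proof.
move=> x0 y0; set u := Num.sqrt x; set v := Num.sqrt y.
have u0 : 0 <= u by exact: sqrtr_ge0.
have v0 : 0 <= v by exact: sqrtr_ge0.
have -> : x - y = (u - v) * (u + v).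
  by rewrite -[x]sqr_sqrtr // -[y]sqr_sqrtr // -/u -/v; ring.
rewrite normrM (ger0_norm (_ : 0 <= u + v)) ?addr_ge0 //.
rewrite -real_normK ?num_real // expr2 ler_wpM2l //.
by rewrite ler_norml; apply/andP; split; lra.
Qed.

Lemma sq_le1 x : (x ^+ 2 <= 1) = (`|x| <= 1).
Proof.
rewrite -(real_normK (num_real x)) -[X in (X = _)]/(`|x| ^+ 2 <= 1).
by rewrite -{1}(expr1n R 2) ler_pXn2r ?nnegrE.
Qed.

Definition polar r c : R[i] := (r * c) +i* (r * Num.sqrt (1 - c ^+ 2)).

Lemma nc_polar r c : 0 <= r -> c ^+ 2 <= 1 -> nc (polar r c) = r.
Proof.
move=> r0 c1; apply/eqP; rewrite -(@eqrXn2 _ 2) ?nc_ge0 //; apply/eqP.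
by rewrite nc_sq /= !exprMn sqr_sqrtr ?subr_ge0 //; ring.
Qed.

Lemma polar_upper r c : 0 <= r -> upper (polar r c).
Proof. by move=> r0; rewrite /upper mulr_ge0 // sqrtr_ge0. Qed.

Lemma polarE (z : R[i]) : upper z -> z != 0 ->
  polar (nc z) (complex.Re z / nc z) = z.
Proof.
move=> uz; rewrite -nc_gt0 => z0; have n0 : nc z != 0 by rewrite gt_eqF.
apply: complex_ext; rewrite /polar /=; first by rewrite mulrC divfK.
rewrite -[X in X * _]ger0_norm ?nc_ge0 // -sqrtr_sqr -sqrtrM ?sqr_ge0 //.
have -> : nc z ^+ 2 * (1 - (complex.Re z / nc z) ^+ 2) = complex.Im z ^+ 2.
  transitivity (nc z ^+ 2 - complex.Re z ^+ 2); first by field.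
  by rewrite nc_sq; ring.
by rewrite sqrtr_sqr ger0_norm.
Qed.

Lemma polar_step r r' c c' (m : R) : 0 <= r' -> c ^+ 2 <= 1 -> c' ^+ 2 <= 1 ->
  0 <= m -> m <= 1 -> `|c - c'| <= 2 * m ^+ 2 ->
  nc (polar r c - polar r' c') <= `|r - r'| + r' * (4 * m).
Proof.
move=> r0 c1 c1' m0 m1 cc.
have -> : polar r c - polar r' c' = (r - r')%:C * polar 1 c + r'%:C * (polar 1 c - polar 1 c').
  by apply: complex_ext => /=; ring.
apply: le_trans (nc_triangle _ _) _; rewrite !ncM !nc_real nc_polar // mulr1.
rewrite (ger0_norm r0) lerD2l ler_wpM2l //.
apply: le_trans (nc_le_ReIm _) _ => /=; rewrite !mul1r.
have s2 : `|Num.sqrt (1 - c ^+ 2) - Num.sqrt (1 - c' ^+ 2)| <= 2 * m.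
  rewrite -(@ler_pXn2r _ 2) ?nnegrE ?mulr_ge0 // real_normK ?num_real //.
  apply: le_trans (sqrt_sub_sq _ _) _; rewrite ?subr_ge0 //.
  have -> : 1 - c ^+ 2 - (1 - c' ^+ 2) = (c' - c) * (c + c') by ring.
  rewrite normrM distrC (_ : (2 * m) ^+ 2 = 2 * m ^+ 2 * 2); last by ring.
  apply: ler_pM => //; apply: le_trans (ler_normD _ _) _.
  by move: c1 c1'; rewrite !sq_le1; lra.
have mm : m ^+ 2 <= m by rewrite expr2 ler_piMl.
lra.
Qed.

End Polar.

Section Contraction.
Context {R : realType}.
Variables p t a d : R.
Hypotheses (t0 : 0 <= t) (tp : t <= p) (p1 : p < 1).
Hypotheses (aE : a = 1 + t + p * t) (dE : d = 1 + p + p * t).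
Implicit Types (z w x y : R[i]).

Local Notation f := (gmap p t a d).
Local Notation Y := (outer_radius t).
Local Notation X := (half_annulus t).

Let Y1 : 1 < Y := outer_radius_gt1 t0 tp p1.

Lemma half_annulus1 : X 1.
Proof. by split; [rewrite /upper /=|rewrite /annulus Normc.normc1; split => //; exact: ltW]. Qed.

(** The half-annulus is joined to 1 by chains of bounded length with
    arbitrarily small steps, obtained by moving modulus and cosine linearly. With
    M^2 steps the sine changes by at most 2/M at each of them. *)
Lemma half_annulus_chain (e : R) : 0 < e -> exists N, forall z, X z ->
  exists c : nat -> R[i], [/\ c 0 = 1, c N = z,
    forall j, (j <= N)%N -> X (c j) & forall j, (j < N)%N -> nc (c j - c j.+1) <= e].
Proof.
move=> e0; pose M := (Num.trunc (5 * Y / e)).+1.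
have Me : 5 * Y / e < M%:R by exact: truncnS_gt.
have M0 : 0 < M%:R :> R by rewrite ltr0n.
pose N := (M ^ 2)%N; have NE : N%:R = M%:R ^+ 2 :> R by rewrite natrX.
have N0 : 0 < N%:R :> R by rewrite NE exprn_gt0.
exists N => z [uz [z1 zY]].
have z0 : z != 0 by rewrite -nc_gt0 (lt_le_trans ltr01).
pose r j := 1 + j%:R / N%:R * (nc z - 1).
pose k := complex.Re z / nc z.
have k1 : `|k| <= 1.
  by rewrite normrM normfV (ger0_norm (nc_ge0 z)) ler_pdivrMr ?nc_gt0 // mul1r Re_le_nc.
have [kl ku] : -1 <= k /\ k <= 1 by apply/andP; rewrite -ler_norml.
pose c j := 1 + j%:R / N%:R * (k - 1).
have J j : (j <= N)%N -> 0 <= j%:R / N%:R :> R /\ j%:R / N%:R <= 1 :> R.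
  by move=> jN; rewrite divr_ge0 // ler_pdivrMr // mul1r ler_nat.
have c2 j : (j <= N)%N -> c j ^+ 2 <= 1.
  move=> /J [j0 j1]; rewrite sq_le1 /c; move: (_ / _) j0 j1 => x j0 j1.
  have h0 : 0 <= x * (1 - k) by rewrite mulr_ge0 // subr_ge0.
  have h1 : x * (1 - k) <= 1 - k by rewrite ler_piMl // subr_ge0.
  by rewrite ler_norml; apply/andP; split; lra.
have r1 j : (j <= N)%N -> 1 <= r j.
  by move=> /J [j0 j1]; rewrite /r lerDl mulr_ge0 // subr_ge0.
have rY j : (j <= N)%N -> r j <= Y.
  move=> /J [j0 j1]; apply: le_trans zY; rewrite /r -lerBrDl ler_piMl // subr_ge0 //.
have r0 j : (j <= N)%N -> 0 <= r j.
  by move=> /r1; apply: le_trans.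
exists (fun j => polar (r j) (c j)); split.
- rewrite /r /c !mul0r !addr0 /polar; apply: complex_ext; rewrite /= ?mulr1 //.
  by rewrite expr1n subrr sqrtr0 mulr0.
- rewrite /r /c divff ?gt_eqF // !mul1r !(addrC 1) !subrK; exact: polarE.
- move=> j jN; split; first exact/polar_upper/r0.
  by rewrite /annulus nc_polar ?r0 ?c2 //; split; [exact: r1|exact: rY].
move=> j jN; have m1 : M%:R^-1 <= 1 :> R by rewrite invf_le1 // ler1n.
have stepc : `|c j - c j.+1| <= 2 * M%:R^-1 ^+ 2.
  have -> : c j - c j.+1 = (1 - k) * M%:R^-1 ^+ 2.
    by rewrite /c -natr1 exprVn -NE; field; rewrite gt_eqF.
  rewrite normrM (ger0_norm (sqr_ge0 _)) ler_wpM2r ?sqr_ge0 //.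
  by rewrite ger0_norm; lra.
apply: le_trans (polar_step _ _ _ _ _ m1 stepc) _; rewrite ?r0 ?c2 ?invr_ge0 //; try exact: ltnW.
have stepr : `|r j - r j.+1| <= Y * M%:R^-1.
  have -> : r j - r j.+1 = - ((nc z - 1) * M%:R^-1 ^+ 2).
    by rewrite /r -natr1 exprVn -NE; field; rewrite gt_eqF.
  have h0 : 0 <= nc z - 1 by rewrite subr_ge0.
  rewrite normrN ger0_norm ?mulr_ge0 ?sqr_ge0 //.
  apply: ler_pM; rewrite ?sqr_ge0 //; first by lra.
  by rewrite expr2 ler_piMl // invr_ge0.
apply: (@le_trans _ _ (Y * M%:R^-1 + Y * (4 * M%:R^-1))).
  apply: lerD => //; rewrite ler_wpM2r ?rY // mulr_ge0 ?invr_ge0 //.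
have -> : Y * M%:R^-1 + Y * (4 * M%:R^-1) = 5 * Y / M%:R by ring.
rewrite ler_pdivrMr // [e * _]mulrC -ler_pdivrMr //; exact: ltW.
Qed.

(** The expansion estimate only compares nearby points. Along a chain of N
    small steps it sums up to a bound that is N times larger but decays at the
    same geometric rate. *)
Lemma branches_contract : exists C q : R, [/\ 0 <= C, 0 <= q < 1 &
  forall c x y, X x -> X y ->
  nc (branches p t a d c x - branches p t a d c y) <= C * q ^+ size c].
Proof.
have [mu mu1 [eta eta0 near]] := branches_contract_near t0 tp p1 aE dE.
have gap : 0 < 1 - t * Y by rewrite subr_gt0 (outer_radius_t t0 tp p1).
have [N chain] := half_annulus_chain (mulr_gt0 eta0 (exprn_gt0 2 gap)).
have mu0 : 0 < mu by rewrite (lt_trans ltr01).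
pose G := branches p t a d.
have XG c x : X x -> X (G c x) := @branches_half R p t a d t0 tp p1 aE dE c x.
have toone c z : X z -> nc (G c z - G c 1) <= 4 * (eta * N%:R * mu^-1 ^+ size c).
  move=> Xz; have [u [u0 uN uX us]] := chain z Xz.
  have XE v : X v -> nc v <= Y by case=> _ [].
  apply: le_trans (unif_lip t0 tp p1 (XE _ (XG c _ Xz)) (XE _ (XG c _ half_annulus1))) _.
  rewrite ler_wpM2l //.
  have step j : (j < N)%N -> nc (unif t (G c (u j.+1)) - unif t (G c (u j))) <= eta * mu^-1 ^+ size c.
    move=> jN; have Xj := uX _ (ltnW jN); have Xj1 := uX _ jN.
    rewrite exprVn ler_pdivlMr ?exprn_gt0 // mulrC.
    apply: near => //.
    rewrite -(ler_pM2r (exprn_gt0 2 gap)).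
    apply: le_trans (unif_lipV t0 tp p1 (XE _ Xj1) (XE _ Xj)) _.
    by rewrite nc_sub us.
  have : forall j, (j <= N)%N -> nc (unif t (G c (u j)) - unif t (G c 1)) <=
     j%:R * (eta * mu^-1 ^+ size c).
    elim=> [|j IH] jN; first by rewrite u0 subrr Normc.normc0 mul0r.
    rewrite -(subrK (unif t (G c (u j))) (unif t (G c (u j.+1)))) -addrA.
    apply: le_trans (nc_triangle _ _) _; rewrite -natr1 mulrDl mul1r [leRHS]addrC.
    by apply: lerD; [exact: step|exact/IH/ltnW].
  by move=> /(_ N (leqnn N)); rewrite uN; lra.
exists (8 * (eta * N%:R)), mu^-1; split.
- by rewrite !mulr_ge0 // ltW.
- by rewrite invr_ge0 (ltW mu0) /= invf_lt1.
move=> c x y Xx Xy.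
have -> : branches p t a d c x - branches p t a d c y = (G c x - G c 1) + - (G c y - G c 1).
  by rewrite /G; ring.
apply: le_trans (nc_triangle _ _) _; rewrite ncN.
have := lerD (toone c x Xx) (toone c y Xy); lra.
Qed.

End Contraction.

(** * The limit curve *)

Section GeometricLimits.
Context {R : realType}.

Lemma geometric_small (C q e : R) : 0 <= q < 1 -> 0 < e ->
  exists N, forall n, (N <= n)%N -> C * q ^+ n < e.
Proof.
move=> /andP[q0 q1] e0; pose M := `|C| + 1; have M0 : 0 < M by rewrite ltr_wpDl.
have : (fun n => q ^+ n) @ \oo --> (0 : R) by apply: cvg_expr; rewrite ger0_norm.
move/cvgrPdist_lt => /(_ (e / M)); rewrite divr_gt0 // => /(_ isT).
case=> N _ HN; exists N => n nN; have := HN n nN.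
rewrite /= sub0r normrN ger0_norm ?exprn_ge0 // ltr_pdivlMr // mulrC.
apply: le_lt_trans; rewrite ler_wpM2r ?exprn_ge0 // (le_trans (ler_norm C)) //.
by rewrite lerDl.
Qed.

Lemma geometric_eq0 (C q : R) (z : R[i]) : 0 <= q < 1 ->
  (forall n, nc z <= C * q ^+ n) -> z = 0.
Proof.
move=> q01 H; apply/eqP; rewrite -nc_eq0; apply/eqP/le_anti; rewrite nc_ge0 andbT.
rewrite leNgt; apply/negP => z0; have [N HN] := geometric_small C q01 z0.
by have := lt_le_trans (HN N (leqnn N)) (H N); rewrite ltxx.
Qed.

(** The limit is the supremum of the lower bounds u_n - C q^n. *)
Lemma geometric_lim_real (C q : R) (u : nat -> R) : 0 <= C -> 0 <= q ->
  (forall n m, (n <= m)%N -> `|u n - u m| <= C * q ^+ n) ->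
  exists l, forall n, `|u n - l| <= C * q ^+ n.
Proof.
move=> C0 q0 H; pose S := [set u n - C * q ^+ n | n in [set: nat]].
have r0 n : 0 <= C * q ^+ n by rewrite mulr_ge0 // exprn_ge0.
have ub m : ubound S (u m + C * q ^+ m).
  move=> _ [n _ <-]; have [nm|mn] := leqP n m.
    have := H _ _ nm; rewrite ler_norml => /andP[_]; have := r0 m; lra.
  have := H _ _ (ltnW mn); rewrite ler_norml => /andP[h _]; have := r0 n; move: h; lra.
have S0 : S !=set0 by exists (u 0%N - C * q ^+ 0), 0%N.
exists (sup S) => n; rewrite ler_norml; apply/andP; split.
  by have := ge_sup S0 (ub n); lra.
have : u n - C * q ^+ n <= sup S by apply: ub_le_sup; [exists (u n + C * q ^+ n)|exists n].
lra.
Qed.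

Lemma geometric_lim (C q : R) (u : nat -> R[i]) : 0 <= C -> 0 <= q ->
  (forall n m, (n <= m)%N -> nc (u n - u m) <= C * q ^+ n) ->
  exists l, forall n, nc (u n - l) <= 2 * C * q ^+ n.
Proof.
move=> C0 q0 H.
have [|x Hx] := @geometric_lim_real C q (fun n => complex.Re (u n)) C0 q0.
  move=> n m nm; apply: le_trans (H n m nm); have := Re_le_nc (u n - u m).
  by case: (u n) => ? ?; case: (u m) => ? ?.
have [|y Hy] := @geometric_lim_real C q (fun n => complex.Im (u n)) C0 q0.
  move=> n m nm; apply: le_trans (H n m nm); have := Im_le_nc (u n - u m).
  by case: (u n) => ? ?; case: (u m) => ? ?.
exists (x +i* y) => n; apply: le_trans (nc_le_ReIm _) _.
have := lerD (Hx n) (Hy n); case: (u n) => v w /=; lra.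
Qed.

End GeometricLimits.

Section Curve.
Context {R : realType}.
Variables p t a d : R.
Hypotheses (t0 : 0 <= t) (tp : t <= p) (p1 : p < 1).
Hypotheses (aE : a = 1 + t + p * t) (dE : d = 1 + p + p * t).
Implicit Types (z w x y : R[i]) (s : R) (h k : R -> R[i]).

Local Notation f := (gmap p t a d).
Local Notation Y := (outer_radius t).
Local Notation X := (half_annulus t).
Local Notation g := (branch p t a d).

Let p0 : 0 <= p. Proof. exact: le_trans tp. Qed.
Let t1 : t < 1. Proof. exact: le_lt_trans p1. Qed.

Lemma half_annulus_regular z : X z -> regular t a z.
Proof. by move=> [_ [_ zY]]; apply: (annulus_regular t0 tp p1 aE). Qed.

Lemma gmap_branch_half z : X z -> f (Some (g z)) = Some z.
Proof. by move=> Xz; apply: gmap_branch => //; [case: Xz|exact: half_annulus_regular]. Qed.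

Lemma gmap_1 : f (Some 1) = Some 1.
Proof.
rewrite gmapE expr1n !mulr1.
have E : a%:C + p%:C = t%:C + d%:C :> R[i] by rewrite -!rmorphD /= aE dE; congr _%:C; ring.
have n : t%:C + d%:C != 0 :> R[i].
  rewrite -rmorphD (inj_eq (@complexI R)) gt_eqF // ltr_wpDl //.
  by rewrite (lt_le_trans ltr01) // (d_ge1 p0 p1 t0 t1 dE).
by rewrite E pt_Some // divff.
Qed.

Lemma branch_1 : g 1 = 1.
Proof.
apply/esym/(branch_uniq p0 p1 t0 t1 aE dE); last exact: gmap_1.
by split; rewrite /= ?ler01.
Qed.

Lemma refl_1 : refl 1 = -1 :> R[i].
Proof. by apply: complex_ext; rewrite /= ?oppr0. Qed.

(** The two halves of the curve meet on the imaginary axis, at a preimage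
    of -1. *)
Lemma refl_branchN1 : refl (g (- 1)) = g (- 1).
Proof.
have Re0 (x : R) : x <= 0 -> complex.Re (hsqrt (x%:C)) = 0.
  move=> x0; rewrite /hsqrt /= expr0n addr0 sqrtr_sqr ler0_norm //.
  by rewrite addNr mul0r sqrtr0.
have E : (d%:C * - 1 - p%:C) / (a%:C - t%:C * - 1) = (- (d + p) / (a + t))%:C :> R[i].
  rewrite !mulrN !mulr1 opprK rmorphM fmorphV rmorphN !rmorphD; congr (_ / _).
  by rewrite opprD.
have x0 : - (d + p) / (a + t) <= 0.
  have a1 := a_ge1 p0 p1 t0 t1 aE; have d1 := d_ge1 p0 p1 t0 t1 dE.
  rewrite mulNr oppr_le0 divr_ge0 // addr_ge0 //; exact: le_trans ler01 _.
rewrite /branch E; move: (Re0 _ x0); case: (hsqrt _) => u v /= ->.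
by apply: complex_ext => /=; rewrite ?oppr0 ?opprK.
Qed.

(** The constant extension outside [0,1] turns the gluing of two halves of a
    curve into a sum, as in the next definition. *)
Definition admissible h : Prop := [/\ continuous h, forall s, X (h s),
  forall s, s <= 0 -> h s = 1 & forall s, 1 <= s -> h s = -1].

(** The pullback of a curve by the two branches; the sum is a disguised case
    distinction, one of the first two terms always being [g (-1)]. *)
Definition pullback h s : R[i] := g (h (2 * s)) + refl (g (h (2 - 2 * s))) - g (- 1).

Lemma pullbackE h s : admissible h ->
  pullback h s = if s <= 1 / 2 then g (h (2 * s)) else refl (g (h (2 - 2 * s))).
Proof.
move=> [_ _ _ h1]; rewrite /pullback; case: leP => s2.
  by rewrite (h1 (2 - 2 * s)) ?refl_branchN1 ?addrK //; lra.
by rewrite (h1 (2 * s)) ?[g _ + _]addrC ?addrK //; lra.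
Qed.

Lemma branch_half' z : X z -> X (g z).
Proof. exact: branch_half. Qed.

Lemma pullback_admissible h : admissible h -> admissible (pullback h).
Proof.
move=> ah; have [ch Xh h0 h1] := ah.
have cgh : continuous (g \o h).
  move=> s A nA; exact: ch s _ (branch_continuous (half_annulus_regular (Xh s)) nA).
have c1 : continuous (fun s : R => 2 * s) by move=> s; exact: mulrl_continuous.
have c2 : continuous (fun s : R => 2 - 2 * s).
  by move=> s; apply: cvgB; [exact: cvg_cst|exact: c1].
split.
- move=> s; have k1 : (fun s => g (h (2 * s))) @ nbhs s --> g (h (2 * s)).
    exact: (continuous_comp (c1 s) (cgh _)).
  have k2 : (fun s => refl (g (h (2 - 2 * s)))) @ nbhs s --> refl (g (h (2 - 2 * s))).
    by move=> A /refl_continuous nA; exact: (continuous_comp (c2 s) (cgh _)) _ nA.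
  exact: (cvgCD (cvgCD k1 k2) (cvgC_cst _)).
- move=> s; rewrite pullbackE //; case: ifP => _; first exact: branch_half'.
  exact/refl_half/branch_half'.
- move=> s s0; rewrite pullbackE // ifT; last by lra.
  by rewrite h0 ?branch_1 //; lra.
move=> s s1; rewrite pullbackE // ifF; last by apply/negbTE; rewrite -ltNge; lra.
by rewrite h0 ?branch_1 ?refl_1 //; lra.
Qed.

Lemma iter_pullback_admissible n h : admissible h -> admissible (iter n pullback h).
Proof. by move=> ah; elim: n => //= n; exact: pullback_admissible. Qed.

Lemma iter_pullback n s : exists c s', size c = n /\
  forall h, admissible h -> iter n pullback h s = branches p t a d c (h s').
Proof.
elim: n s => [|n IH] s; first by exists [::], s.
case: (leP s (1 / 2)) => s2.
  have [c [s' [<- H]]] := IH (2 * s); exists (false :: c), s'; split => // h ah.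
  rewrite /= pullbackE ?s2 ?H //; exact: iter_pullback_admissible.
have [c [s' [<- H]]] := IH (2 - 2 * s); exists (true :: c), s'; split => // h ah.
rewrite /= pullbackE ?leNgt ?s2 /= ?H //; exact: iter_pullback_admissible.
Qed.

Definition half_circle s : R[i] := polar 1 (1 - 2 * Num.min (Num.max s 0) 1).

Lemma half_circle_admissible : admissible half_circle.
Proof.
have cl s : 0 <= Num.min (Num.max s 0) 1 <= 1.
  by rewrite le_min le_max lexx orbT ler01 ge_min lexx orbT.
have sq s : (1 - 2 * Num.min (Num.max s 0) 1) ^+ 2 <= 1.
  by have /andP[] := cl s; move: (Num.min _ _) => x x0 x1; rewrite sq_le1 ler_norml; lra.
have Y1 := outer_radius_gt1 t0 tp p1.
split.
- move=> s.
  have cm : (fun s => Num.min (Num.max s 0) 1) @ nbhs s --> Num.min (Num.max s 0) 1.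
    apply: (@continuous_min R R (fun s => Num.max s 0) (cst 1)); last exact: cvg_cst.
    apply: (@continuous_max R R id (cst 0)); last exact: cvg_cst.
    exact: cvg_id.
  have cc : (fun s => 1 - 2 * Num.min (Num.max s 0) 1) @ nbhs s -->
      1 - 2 * Num.min (Num.max s 0) 1.
    by apply: cvgB; [exact: cvg_cst|apply: cvgM => //; exact: cvg_cst].
  have cs : (fun s => Num.sqrt (1 - (1 - 2 * Num.min (Num.max s 0) 1) ^+ 2)) @ nbhs s -->
     Num.sqrt (1 - (1 - 2 * Num.min (Num.max s 0) 1) ^+ 2).
    have c2 : (fun s => 1 - (1 - 2 * Num.min (Num.max s 0) 1) ^+ 2) @ nbhs s -->
     1 - (1 - 2 * Num.min (Num.max s 0) 1) ^+ 2.
      by apply: cvgB; [exact: cvg_cst|rewrite expr2; apply: (cvgM cc cc)].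
    by move=> A nA; exact: (c2 _ (sqrt_continuous nA)).
  have k1 : (fun _ : R => 1 : R) @ nbhs s --> (1 : R) by exact: cvg_cst.
  exact: (cvg_complex (cvgM k1 cc) (cvgM k1 cs)).
- move=> s; split; first exact: polar_upper.
  by rewrite /annulus nc_polar //; split => //; exact: ltW.
- move=> s s0; rewrite /half_circle max_r // min_l ?ler01 // mulr0 subr0.
  by apply: complex_ext; rewrite /= ?mulr1 // expr1n subrr sqrtr0 mulr0.
move=> s s1; rewrite /half_circle max_l ?(le_trans ler01) // min_r //.
have -> : 1 - 2 * 1 = - 1 :> R by ring.
by apply: complex_ext; rewrite /= ?mul1r // sqrrN expr1n subrr sqrtr0 oppr0.
Qed.

(** The n-th pullbacks of two admissible curves are, at each parameter, images
    under the same word of length n. Hence the iterated pullbacks of a half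
    circle form a uniform Cauchy sequence; the limit is admissible and equals
    its own pullback. *)
Lemma invariant_curve : exists2 k, admissible k & forall s,
  k s = if s <= 1 / 2 then g (k (2 * s)) else refl (g (k (2 - 2 * s))).
Proof.
have [C [q [C0 q01 Hc]]] := branches_contract t0 tp p1 aE dE.
have q0 : 0 <= q by case/andP: q01.
pose u n := iter n pullback half_circle.
have au n : admissible (u n) := iter_pullback_admissible n half_circle_admissible.
have Hu s n m : (n <= m)%N -> nc (u n s - u m s) <= C * q ^+ n.
  move=> nm; rewrite /u -(subnKC nm) iterD; have [c [s' [<- H]]] := iter_pullback n s.
  rewrite !H; try exact: half_circle_admissible; try exact: (au (m - size c)%N).
  apply: Hc; first by case: half_circle_admissible.
  by have [_ Xu _ _] := au (m - size c)%N; exact: Xu.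
have [k Hk] := choice (fun s => geometric_lim C0 q0 (Hu s)).
have small := geometric_small (2 * C) q01.
have lim0 z : (forall n, nc z <= 2 * C * q ^+ n) -> z = 0 by exact: geometric_eq0.
have near0 s e : 0 < e -> exists N, forall n, (N <= n)%N -> nc (u n s - k s) < e.
  move=> /small [N HN]; exists N => n nN; exact: le_lt_trans (Hk s n) (HN n nN).
have Xk s : X (k s).
  have Xu n : X (u n s) by have [_ H _ _] := au n; exact: H.
  split.
    rewrite /upper leNgt; apply/negP => k0.
    have [|N HN] := near0 s (- complex.Im (k s)); first by rewrite oppr_gt0.
    have := HN N (leqnn N); have [+ _] := Xu N; rewrite /upper.
    have := Im_le_nc (u N s - k s); rewrite ler_norml => /andP[_].
    by case: (u N s) => ? ?; case: (k s) k0 => ? ? /= ? ? ? ?; lra.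
  split; rewrite leNgt; apply/negP => k0.
    have [|N HN] := near0 s (1 - nc (k s)); first by rewrite subr_gt0.
    have := HN N (leqnn N); have [_ [+ _]] := Xu N.
    by have := nc_triangleB (u N s) (k s); lra.
  have [|N HN] := near0 s (nc (k s) - Y); first by rewrite subr_gt0.
  have := HN N (leqnn N); have [_ [_ +]] := Xu N.
  by have := nc_triangleB (k s) (u N s); rewrite nc_sub; lra.
have ck : continuous k.
  move=> s A /nbhsC [e e0 eA]; have e30 : 0 < e / 3 by lra.
  have [N HN] := small _ e30; have [cu _ _ _] := au N.
  have : nbhs s [set s' | nc (u N s' - u N s) < e / 3].
    by apply: (cu s [set z | nc (z - u N s) < e / 3]); apply/nbhsC; exists (e / 3).
  apply: filterS => s' /= h; apply: eA.
  have -> : k s' - k s = - (u N s' - k s') + ((u N s' - u N s) + (u N s - k s)) by ring.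
  have h1 := le_lt_trans (Hk s N) (HN N (leqnn N)).
  have h2 := le_lt_trans (Hk s' N) (HN N (leqnn N)).
  apply: le_lt_trans (nc_triangle _ _) _; rewrite ncN.
  have := nc_triangle (u N s' - u N s) (u N s - k s); lra.
have ak : admissible k.
  split => // s hs; apply/eqP; rewrite eq_sym -subr_eq0; apply/eqP/lim0 => n.
    by have [_ _ u0 _] := au n; rewrite -(u0 s hs).
  by have [_ _ _ u1] := au n; rewrite -(u1 s hs).
exists k => // s; rewrite -pullbackE //.
apply/eqP; rewrite eq_sym -subr_eq0 -nc_eq0; apply/eqP/le_anti; rewrite nc_ge0 andbT.
rewrite leNgt; apply/negP; set e := nc _ => e0.
have cont b : exists2 de : R, 0 < de &
    forall z, nc (z - k b) < de -> nc (g z - g (k b)) < e / 2.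
  have /nbhsC [de de0 H] : nbhs (k b) [set z | nc (g z - g (k b)) < e / 2].
    apply: (branch_continuous (half_annulus_regular (Xk b))) [set z | nc (z - g (k b)) < e / 2] _.
    by apply/nbhsC; exists (e / 2) => //; lra.
  by exists de.
have conv b : exists N, forall n, (N <= n)%N -> nc (g (u n b) - g (k b)) < e / 2.
  have [de de0 H] := cont b; have [N HN] := near0 b de de0.
  by exists N => n nN; exact/H/HN.
have e20 : 0 < e / 2 by lra.
have [N1 H1] := conv (2 * s); have [N2 H2] := conv (2 - 2 * s).
have [N3 H3] := near0 s (e / 2) e20.
pose N := (maxn N1 (maxn N2 N3)).
have hN : nc (pullback (u N) s - pullback k s) < e / 2.
  rewrite !pullbackE //; case: ifP => _; first by apply: H1; rewrite leq_maxl.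
  rewrite (_ : refl _ - refl _ = refl (g (u N (2 - 2 * s)) - g (k (2 - 2 * s)))).
    by rewrite nc_refl; apply: H2; rewrite /N maxnCA leq_maxl.
  by rewrite /refl rmorphB opprB opprK addrC.
have h3 : nc (u N.+1 s - k s) < e / 2.
  by apply: H3; rewrite (leq_trans _ (leqnSn _)) // /N maxnA leq_maxr.
have : e < e.
  rewrite {1}/e (_ : pullback k s - k s =
    - (pullback (u N) s - pullback k s) + (u N.+1 s - k s)); last first.
    by rewrite /u /=; ring.
  apply: le_lt_trans (nc_triangle _ _) _; rewrite ncN.
  move: hN h3; lra.
by rewrite ltxx.
Qed.

End Curve.

(** * The invariant Jordan curve *)

Section Jordan.
Context {R : realType}.
Variables p t a d : R.
Hypotheses (t0 : 0 <= t) (tp : t <= p) (p1 : p < 1).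
Hypotheses (aE : a = 1 + t + p * t) (dE : d = 1 + p + p * t).
Implicit Types (z w x y : R[i]) (s : R) (u : sphere R).

Local Notation f := (gmap p t a d).
Local Notation Y := (outer_radius t).
Local Notation X := (half_annulus t).
Local Notation g := (branch p t a d).

Let p0 : 0 <= p. Proof. exact: le_trans tp. Qed.
Let t1 : t < 1. Proof. exact: le_lt_trans p1. Qed.

Definition trapped : set (sphere R) :=
  [set u | forall n, exists2 z, iter n f u = Some z & annulus t z].

Lemma trapped_gmap u : trapped u -> trapped (f u).
Proof. by move=> Ku n; have := Ku n.+1; rewrite iterSr. Qed.

Lemma iter_gmap_cj n u : iter n f (cj u) = cj (iter n f u).
Proof. by elim: n => //= n ->; rewrite gmap_cj. Qed.

Lemma trapped_cj u : trapped u -> trapped (cj u).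
Proof.
move=> Ku n; have [z E [z1 zY]] := Ku n; exists z^*; first by rewrite iter_gmap_cj E.
by rewrite /annulus nc_conj.
Qed.

Lemma trapped_cjV u : trapped (cj u) -> trapped u.
Proof. by move=> /trapped_cj; rewrite cjK. Qed.

Variable k : R -> R[i].
Hypothesis ak : admissible t k.
Hypothesis kE : forall s,
  k s = if s <= 1 / 2 then g (k (2 * s)) else refl (g (k (2 - 2 * s))).

Let Xk s : X (k s). Proof. by have [_ H _ _] := ak; exact: H. Qed.
Let k_at0 : k 0 = 1. Proof. by have [_ _ H _] := ak; exact: H. Qed.
Let k_at1 : k 1 = -1. Proof. by have [_ _ _ H] := ak; exact: H. Qed.

Let fg := gmap_branch_half t0 tp p1 aE dE.

Lemma gmap_curve s : f (Some (k s)) =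
  if s <= 1 / 2 then Some (k (2 * s)) else cj (Some (k (2 - 2 * s))).
Proof. by rewrite kE; case: ifP => _; rewrite ?gmap_refl fg //. Qed.

Lemma curve_trapped s : trapped (Some (k s)).
Proof.
move=> n; have : exists s', iter n f (Some (k s)) = Some (k s') \/
    iter n f (Some (k s)) = cj (Some (k s')).
  elim: n => [|n [s' [E|E]]]; first by exists s; left.
    rewrite iterS E gmap_curve; case: ifP => _; first by exists (2 * s'); left.
    by exists (2 - 2 * s'); right.
  rewrite iterS E gmap_cj gmap_curve; case: ifP => _; first by exists (2 * s'); right.
  by exists (2 - 2 * s'); left; rewrite cjK.
case=> s' E; have [_ as'] := Xk s'; case: E => ->;
   [by exists (k s')|by exists (k s')^* => //; rewrite /annulus nc_conj; exact: as'].
Qed.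

(** A trapped point of the upper half-plane and a point of the curve with the
    same itinerary are images under the same long word of branches. *)
Lemma trapped_itinerary n z : upper z -> trapped (Some z) ->
  exists c s, [/\ size c = n, 0 <= s <= 1 &
    exists z' s', [/\ X z', z = branches p t a d c z' & k s = branches p t a d c (k s')]].
Proof.
elim: n z => [|n IH] z uz Kz.
  have [_ [<-] az] := Kz 0%N.
  exists [::], 0; split; rewrite ?lexx ?ler01 //.
  by exists z, 0.
have [w E aw] : exists2 w, f (Some z) = Some w & annulus t w := Kz 1%N.
have Kw : trapped (Some w) by rewrite -E; exact: trapped_gmap.
have [[uw ->]|[uw ->]] := unfold p0 p1 t0 t1 aE dE uz E.
  have [c [s [cn s01 [z' [s' [Xz' wE ksE]]]]]] := IH w uw Kw.
  exists (false :: c), (s / 2); split; [by rewrite /= cn|by case/andP: s01; lra|].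
  exists z', s'; split; rewrite //= ?wE // kE ifT; last by case/andP: s01; lra.
  by rewrite mulrC divfK ?ksE // pnatr_eq0.
have [c [s [cn s01 [z' [s' [Xz' wE ksE]]]]]] := IH _ uw (trapped_cj Kw).
case/andP: s01 => s0 s1.
case: (ltP s 1) => s1'.
  exists (true :: c), (1 - s / 2); split; [by rewrite /= cn|lra|].
  exists z', s'; split; rewrite //= ?wE // kE ifF; last by apply/negbTE; rewrite -ltNge; lra.
  by rewrite -ksE (_ : 2 - 2 * (1 - s / 2) = s) //; field.
exists (true :: c), (1 / 2); split; [by rewrite /= cn|lra|].
exists z', s'; split; rewrite //= ?wE // kE lexx.
have sE : s = 1 by lra.
rewrite (_ : 2 * (1 / 2) = 1); last by field.
by rewrite -ksE sE k_at1 refl_branchN1.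
Qed.

(** Such words contract geometrically, so the point is a limit of points of the
    curve, which is compact. *)
Lemma trapped_curve z : upper z -> trapped (Some z) -> exists2 s, 0 <= s <= 1 & k s = z.
Proof.
move=> uz Kz; have [C [q [C0 q01 Hc]]] := branches_contract t0 tp p1 aE dE.
have cI : closed (k @` `[0, 1]%classic).
  apply: compact_closed; first exact: hausdorffC.
  apply: continuous_compact; last exact: segment_compact.
  by apply: continuous_subspaceT; case: ak.
have [s] : (k @` `[0, 1]%classic) z.
  apply: cI => B /nbhsC [e e0 eB]; have [N HN] := geometric_small C q01 e0.
  have [c [s [cn s01 [z' [s' [Xz' zE ksE]]]]]] := trapped_itinerary N uz Kz.
  exists (k s); split; first by exists s; rewrite //= in_itv.
  apply: eB; apply: le_lt_trans (HN N (leqnn N)); rewrite ksE zE -cn; exact: Hc.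
by rewrite /= in_itv => s01 E; exists s.
Qed.

(** The map preserves the positive real axis, so the doubled parameters of a
    real point on the first half of the curve all stay on the first half, which
    is possible for 0 only. *)
Lemma curve_real_left s : 0 <= s <= 1 / 2 -> complex.Im (k s) = 0 -> s = 0.
Proof.
have step s' : 0 <= s' <= 1 / 2 -> complex.Im (k s') = 0 ->
    2 * s' <= 1 / 2 /\ complex.Im (k (2 * s')) = 0.
  move=> /andP[s0 s2] Im0; have := gmap_curve s'; rewrite s2.
  have [_ [ks1 _]] := Xk s'.
  have qk : quadrant (k s') by rewrite kE s2; exact: branch_quadrant.
  set x := complex.Re (k s'); have x0 : 0 <= x by case: qk.
  have -> : k s' = x%:C by apply: complex_ext.
  have a1 := a_ge1 p0 p1 t0 t1 aE; have d1 := d_ge1 p0 p1 t0 t1 dE.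
  have x1 : 1 <= x by rewrite -[x]ger0_norm // -nc_real (_ : x%:C = k s') //; apply: complex_ext.
  have n : 0 < t * x ^+ 2 + d by rewrite ltr_wpDl ?mulr_ge0 ?sqr_ge0 // (lt_le_trans ltr01).
  rewrite gmap_nopole; last by rewrite -rmorphXn -rmorphM -rmorphD (inj_eq (@complexI R)) gt_eqF.
  rewrite -rmorphXn -!rmorphM -!rmorphD -fmorphV -rmorphM => /Some_inj E.
  have pos : 0 < (a * x ^+ 2 + p) / (t * x ^+ 2 + d).
    rewrite divr_gt0 // ltr_wpDr // mulr_gt0 ?exprn_gt0 //; exact: lt_le_trans ltr01 _.
  split; last by rewrite -E.
  rewrite leNgt; apply/negP => h; have := kE (2 * s'); rewrite leNgt h /= -E.
  have [+ _] := branch_quadrant p t a d (k (2 - 2 * (2 * s'))).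
  case: (g _) => u v /= u0 [] Eu _; move: pos; rewrite Eu; lra.
move=> s01 Im0; have : forall n s, 0 <= s <= 1 / 2 -> complex.Im (k s) = 0 ->
   s <= 1 * (1 / 2) ^+ n.
  elim=> [|n IH] s' s01' I0; first by rewrite expr0; case/andP: s01'; lra.
  have [h1 h2] := step s' s01' I0.
  have := IH (2 * s') _ h2; rewrite h1 mulr_ge0 //; last by case/andP: s01'.
  by move=> /(_ isT); rewrite exprS; lra.
move=> H; apply/(@complexI R)/(@geometric_eq0 R 1 (1 / 2)); first by apply/andP; split; lra.
by move=> n; rewrite nc_real ger0_norm; [exact: H|case/andP: s01].
Qed.

Lemma curve_refl s : 1 / 2 < s -> k s = refl (k (1 - s)).
Proof.
move=> s2; rewrite (kE s) leNgt s2 /= (kE (1 - s)) ifT; last by lra.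
by congr (refl (g (k _))); ring.
Qed.

Lemma curve_real s : 0 <= s <= 1 -> complex.Im (k s) = 0 -> s = 0 \/ s = 1.
Proof.
move=> /andP[s0 s1] I0; case: (leP s (1 / 2)) => s2.
  by left; apply: curve_real_left; rewrite ?s0.
right; have : 1 - s = 0; last by lra.
apply: curve_real_left; first by apply/andP; split; lra.
by move: I0; rewrite curve_refl //; case: (k _) => x y /=; rewrite opprK.
Qed.

Lemma curve_left s : s <= 1 / 2 -> 0 <= complex.Re (k s).
Proof. by move=> s2; rewrite kE s2; have [] := branch_quadrant p t a d (k (2 * s)). Qed.

Lemma curve_right s : 1 / 2 < s -> complex.Re (k s) <= 0.
Proof.
move=> s2; rewrite curve_refl //; have := curve_left (_ : 1 - s <= 1 / 2).
case: (k _) => x y /= h; rewrite oppr_le0; apply: h; lra.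
Qed.

(** Doubling the parameter separates any two points until they lie in
    different halves, where only the imaginary axis could identify them. *)
Lemma curve_inj s s' : 0 <= s <= 1 -> 0 <= s' <= 1 -> k s = k s' -> s = s'.
Proof.
have key n : forall s s', 0 <= s -> s < s' -> s' <= 1 -> k s = k s' ->
    s' - s <= 1 * (1 / 2) ^+ n.
  elim: n => [|n IH] {}s {}s' h0 hl h1 E; first by rewrite expr0; lra.
  have := gmap_curve s; have := gmap_curve s'; rewrite -E => -> .
  case: (leP s' (1 / 2)) => s'2.
    rewrite ifT; last by lra.
    move=> /Some_inj E'; have := IH (2 * s) (2 * s') _ _ _ (esym E').
    by rewrite exprS => H; have := H ltac:(lra) ltac:(lra) ltac:(lra); lra.
  case: (leP s (1 / 2)) => s2.
    move=> E'; exfalso.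
    have R0 : complex.Re (k s) = 0.
      by apply/le_anti; rewrite (curve_left s2) {1}E (curve_right s'2).
    have I0 : complex.Im (k (2 * s)) = 0.
      have [u1 _] := Xk (2 * s); have [u2 _] := Xk (2 - 2 * s').
      move: E' u1 u2 => /Some_inj; rewrite /upper; case: (k (2 * s)) => x y.
      by case: (k _) => x' y' [_ <-] /= h h'; lra.
    have [|s20|s21] := curve_real _ I0; first by apply/andP; split; lra.
      have s_0 : s = 0 by lra.
      by move: R0; rewrite s_0 k_at0 /=; lra.
    have sE : s = 1 / 2 by lra.
    have : complex.Im (k (2 - 2 * s')) = 0.
      by move: E' => /Some_inj; rewrite s21 k_at1; case: (k _) => x y [_ /=]; rewrite oppr0 => /eqP; rewrite oppr_eq0 => /eqP.
    move=> J0; have [||] := curve_real _ J0; [by apply/andP; split; lra| |by lra].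
    move=> s'1; have {}s'1 : s' = 1 by lra.
    by move: R0; rewrite E s'1 k_at1 /=; lra.
  move=> /(congr1 (@cj R)); rewrite !cjK => /Some_inj E'.
  have := IH (2 - 2 * s') (2 - 2 * s) _ _ _ E'.
  by rewrite exprS => H; have := H ltac:(lra) ltac:(lra) ltac:(lra); lra.
have key' s1 s2 : 0 <= s1 -> s1 < s2 -> s2 <= 1 -> k s1 = k s2 -> False.
  move=> h0 hl h1 E; have : s2 - s1 = 0; last by lra.
  apply/(@complexI R)/(@geometric_eq0 R 1 (1 / 2)); first by apply/andP; split; lra.
  by move=> n; rewrite nc_real ger0_norm; [exact: key|lra].
move=> /andP[h0 h1] /andP[h0' h1'] E; case: (ltgtP s s') => // h; exfalso.
  exact: (key' s s').
by apply: (key' s' s) => //.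
Qed.

(** The curve and its mirror image, parametrized over the upper and lower half
    of the unit circle by the affine function of Re z running from 0 at 1 to 1
    at -1. *)
Definition closed_curve z : sphere R :=
  Some (if 0 <= complex.Im z then k ((1 - complex.Re z) / 2)
        else (k ((1 - complex.Re z) / 2))^*).

Local Notation circle := [set z : R[i] | `|z| = 1].

Lemma circleE z : circle z <-> complex.Re z ^+ 2 + complex.Im z ^+ 2 = 1.
Proof.
rewrite /= normc_nc -nc_sq; split => [/(@complexI R) ->|h]; first by rewrite expr1n.
congr _%:C; apply/eqP; rewrite -(@eqrXn2 _ 2) ?nc_ge0 //; apply/eqP.
by rewrite h expr1n.
Qed.

Lemma circle_param z : circle z -> 0 <= (1 - complex.Re z) / 2 <= 1.
Proof.
move=> /circleE h; have : complex.Re z ^+ 2 <= 1 by rewrite -h lerDl sqr_ge0.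
by rewrite sq_le1 ler_norml => /andP[h1 h2]; apply/andP; split; lra.
Qed.

Lemma closed_curve_continuous : {within circle, continuous closed_curve}.
Proof.
have cs : continuous (fun z : R[i] => (1 - complex.Re z) / 2).
  move=> z; have k1 : (fun _ : R[i] => 1 : R) @ nbhs z --> (1 : R) by exact: cvg_cst.
  have k2 : (fun _ : R[i] => 2^-1 : R) @ nbhs z --> (2^-1 : R) by exact: cvg_cst.
  have fz : Filter (nbhs z) by exact: nbhs_filter.
  exact: (cvgM (cvgB k1 (@Re_continuous R z)) k2).
have ck : continuous k by case: ak.
have c1 : continuous (fun z : R[i] => Some (k ((1 - complex.Re z) / 2)) : sphere R).
  move=> z; have h := continuous_comp (cs z) (ck _).
  exact: (continuous_comp h (@one_point_compactification_some_continuous _ _)).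
have c2 : continuous (fun z : R[i] => cj (Some (k ((1 - complex.Re z) / 2)))).
  by move=> z; exact: (continuous_comp (c1 z) (@cj_continuous R _)).
have ncirc : closed circle.
  have -> : circle = (fun z : R[i] => nc z) @^-1` [set 1].
    by apply/seteqP; split => z /=; rewrite normc_nc; [move/(@complexI R)|move=> ->].
  by move/continuous_closedP: (@nc_continuous R); apply; exact: closed_eq.
pose A := circle `&` [set z | 0 <= complex.Im z].
pose B := circle `&` [set z | complex.Im z <= 0].
have -> : circle = A `|` B.
  apply/seteqP; split => z; last by case=> [] [].
  by move=> cz; case: (leP 0 (complex.Im z)) => h; [left|right]; split => //=; exact: ltW.
apply: withinU_continuous.
- apply: closedI => //; move/continuous_closedP: (@Im_continuous R) => /(_ [set x | 0 <= x]).
  by apply; exact: closed_ge.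
- apply: closedI => //; move/continuous_closedP: (@Im_continuous R) => /(_ [set x | x <= 0]).
  by apply; exact: closed_le.
- apply: subspace_eq_continuous (continuous_subspaceT c1) => z /set_mem [_ /= h].
  change (Some (k ((1 - complex.Re z) / 2)) = closed_curve z).
  by rewrite /closed_curve h.
apply: subspace_eq_continuous (continuous_subspaceT c2) => z /set_mem [/circleE cz /= h].
change (cj (Some (k ((1 - complex.Re z) / 2))) = closed_curve z).
rewrite /closed_curve; case: leP => // h'.
have I0 : complex.Im z = 0 by apply/le_anti; rewrite h h'.
move: cz; rewrite I0 expr0n addr0 => /eqP; rewrite sqrf_eq1 => /orP[]/eqP ->.
  by rewrite subrr mul0r k_at0; congr Some; apply: complex_ext; rewrite /= ?oppr0.
rewrite opprK divff ?pnatr_eq0 // k_at1; congr Some.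
by apply: complex_ext; rewrite /= ?oppr0.
Qed.

Let Re_circle z z' : (1 - complex.Re z) / 2 = (1 - complex.Re z') / 2 ->
  complex.Re z = complex.Re z'.
Proof. by lra. Qed.

Let real_param z : circle z -> (1 - complex.Re z) / 2 = 0 \/ (1 - complex.Re z) / 2 = 1 ->
  complex.Im z = 0.
Proof.
move=> /circleE h R1; have E : complex.Re z ^+ 2 = 1.
  by case: R1 => R1; [have -> : complex.Re z = 1 by lra|have -> : complex.Re z = -1 by lra];
    rewrite ?sqrrN expr1n.
have /eqP : complex.Im z ^+ 2 = 0 by lra.
by rewrite expf_eq0 /= => /eqP.
Qed.

Lemma closed_curve_inj : set_inj circle closed_curve.
Proof.
have mixed z z' : circle z -> circle z' -> complex.Im z' < 0 ->
    k ((1 - complex.Re z) / 2) = (k ((1 - complex.Re z') / 2))^* -> False.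
  move=> cz cz' I' E; have [u1 _] := Xk ((1 - complex.Re z) / 2).
  have [u2 _] := Xk ((1 - complex.Re z') / 2).
  have I0 : complex.Im (k ((1 - complex.Re z') / 2)) = 0.
    move: u1 u2; rewrite E /upper; case: (k _) => x y /=; lra.
  have := real_param cz' (curve_real (circle_param cz') I0); lra.
have same z z' : circle z -> circle z' ->
    k ((1 - complex.Re z) / 2) = k ((1 - complex.Re z') / 2) ->
    0 <= complex.Im z * complex.Im z' -> z = z'.
  move=> cz cz' E II.
  have RE := Re_circle (curve_inj (circle_param cz) (circle_param cz') E).
  apply: complex_ext => //; have /circleE h := cz; have /circleE h' := cz'.
  have : complex.Im z ^+ 2 = complex.Im z' ^+ 2 by move: h; rewrite RE -h' => /addrI.
  move=> /eqP; rewrite eqf_sqr => /orP[]/eqP // EI.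
  move: II; rewrite EI mulNr -expr2 oppr_ge0 => I2.
  have /eqP : complex.Im z' ^+ 2 = 0 by apply/le_anti; rewrite I2 sqr_ge0.
  by rewrite expf_eq0 /= => /eqP ->; rewrite oppr0.
move=> z z' /set_mem cz /set_mem cz' /Some_inj.
case: (leP 0 (complex.Im z)) => h; case: (leP 0 (complex.Im z')) => h' E.
- by apply: same => //; exact: mulr_ge0.
- by case: (mixed z z').
- by case: (mixed z' z).
apply: same => //; last by apply: mulr_le0; exact: ltW.
by rewrite -[LHS]conjcK E conjcK.
Qed.

Lemma closed_curve_image : closed_curve @` circle = trapped.
Proof.
apply/seteqP; split => [_ [z _ <-]|u Ku].
  rewrite /closed_curve; case: ifP => _; first exact: curve_trapped.
  exact: (trapped_cj (curve_trapped _)).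
pose P s : R[i] := polar 1 (1 - 2 * s).
have PE s : 0 <= s <= 1 -> [/\ circle (P s), circle (P s)^*, (1 - complex.Re (P s)) / 2 = s
    & 0 <= complex.Im (P s)].
  move=> /andP[s0 s1]; have sq : (1 - 2 * s) ^+ 2 <= 1.
    by rewrite sq_le1 ler_norml; apply/andP; split; lra.
  have n1 : nc (P s) = 1 by rewrite nc_polar.
  split; rewrite /= ?normc_nc ?nc_conj ?n1 //.
  - by rewrite -[X in (X%:C)]/(nc (P s)^*) nc_conj n1.
  - by rewrite mul1r; field.
have [z [uE] [z1 zY]] := Ku 0%N; rewrite /= in uE; rewrite uE in Ku *.
case: (leP 0 (complex.Im z)) => h.
  have [s s01 <-] := trapped_curve h Ku; have [c1 _ c3 c4] := PE s s01.
  by exists (P s) => //; rewrite /closed_curve c4 c3.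
have uz : upper z^* by case: z h {uE z1 zY Ku} => x y /= h; rewrite /upper /= oppr_ge0 ltW.
have [s s01 kz] := trapped_curve uz (trapped_cj Ku); have [c1 c2 c3 c4] := PE s s01.
exists (P s)^* => //; rewrite /closed_curve.
have -> : complex.Re (P s)^* = complex.Re (P s) by case: (P s).
rewrite c3 kz; case: leP => h'; last by rewrite conjcK.
have I0 : complex.Im (P s) = 0.
  by move: h' c4; case: (P s) => x y /=; lra.
have := real_param c1; rewrite c3 I0.
exfalso; move: I0; rewrite /P /polar /= mul1r => /eqP; rewrite sqrtr_eq0 => sq.
have s01' : s = 0 \/ s = 1.
  have /eqP : s * (1 - s) = 0 by case/andP: s01 => g0 g1; nra.
  by rewrite mulf_eq0 => /orP[/eqP ->|/eqP e]; [left|right; lra].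
have : z^* = 1 \/ z^* = -1 by rewrite -kz; case: s01' => ->; rewrite ?k_at0 ?k_at1; [left|right].
by case: z h {uE z1 zY Ku uz kz} => x y /= h [] [] _; lra.
Qed.

Lemma trapped_jordan : jordan_curve trapped.
Proof.
exists closed_curve; split; [exact: closed_curve_continuous|exact: closed_curve_inj|].
exact: closed_curve_image.
Qed.

Lemma outer_radius_escapes : ~ trapped (Some Y%:C).
Proof.
have Y1 := outer_radius_gt1 t0 tp p1.
move=> KY; have uY : upper Y%:C by rewrite /upper /=.
have [s s01 kY] := trapped_curve uY KY.
have I0 : complex.Im (k s) = 0 by rewrite kY.
by have [sE|sE] := curve_real s01 I0; move: kY; rewrite sE ?k_at0 ?k_at1 => -[]; lra.
Qed.

Lemma escaping_itinerary n s : exists c s', [/\ size c = n,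
  k s = branches p t a d c (k s') & ~ trapped (Some (branches p t a d c Y%:C))].
Proof.
elim: n s => [|n IH] s; first by exists [::], s; split => //; exact: outer_radius_escapes.
have Y1 := outer_radius_gt1 t0 tp p1.
have XY : X Y%:C.
  split; first by rewrite /upper /=.
  by rewrite /annulus nc_real ger0_norm; lra.
have XG c : X (branches p t a d c Y%:C) by exact: (branches_half t0 tp p1 aE dE).
case: (leP s (1 / 2)) => s2.
  have [c [s' [cn E nK]]] := IH (2 * s); exists (false :: c), s'; split.
  - by rewrite /= cn.
  - by rewrite kE s2 E.
  by move=> /trapped_gmap; rewrite [branches _ _ _ _ _ _]/= fg.
have [c [s' [cn E nK]]] := IH (2 - 2 * s); exists (true :: c), s'; split.
- by rewrite /= cn.
- by rewrite kE leNgt s2 /= E.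
by move=> /trapped_gmap; rewrite [branches _ _ _ _ _ _]/= gmap_refl fg // => /trapped_cjV.
Qed.

(** The real point Y of the half-annulus is not on the curve, whose only real
    points are 1 and -1, so it escapes; its images under words escape as well
    and accumulate at every point of the curve. *)
Lemma trapped_nowhere_dense u W : trapped u -> nbhs u W -> exists2 v, W v & ~ trapped v.
Proof.
have [C [q [C0 q01 Hc]]] := branches_contract t0 tp p1 aE dE.
have Y1 := outer_radius_gt1 t0 tp p1.
have XY : X Y%:C.
  split; first by rewrite /upper /=.
  by rewrite /annulus nc_real ger0_norm; lra.
have main s V : nbhs (Some (k s) : sphere R) V -> exists2 v, V v & ~ trapped v.
  move=> /nbhs_Some [e e0 eV]; have [N HN] := geometric_small C q01 e0.
  have [c [s' [cn E nK]]] := escaping_itinerary N s.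
  exists (Some (branches p t a d c Y%:C)) => //; apply: eV.
  by apply: le_lt_trans (HN N (leqnn N)); rewrite E -cn; exact: Hc.
move=> Ku nW; have [z [uE] _] := Ku 0%N; rewrite /= in uE; rewrite uE in Ku nW.
case: (leP 0 (complex.Im z)) => h.
  by have [s s01 kz] := trapped_curve h Ku; apply: (main s); rewrite kz.
have uz : upper z^* by case: z h {uE Ku nW} => x y /= h; rewrite /upper /= oppr_ge0 ltW.
have [s s01 kz] := trapped_curve uz (trapped_cj Ku).
have [v Wv nK] : exists2 v, W (cj v) & ~ trapped v.
  apply: (main s (fun v => W (cj v))); rewrite kz.
  by apply: (@cj_continuous R (Some z^*)); rewrite /= conjcK.
by exists (cj v) => // /trapped_cjV.
Qed.

End Jordan.

Section TwoBasins.
Context {R : realType}.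
Variables p t a d : R.
Hypotheses (t0 : 0 <= t) (tp : t <= p) (p1 : p < 1).
Hypotheses (aE : a = 1 + t + p * t) (dE : d = 1 + p + p * t).
Implicit Types (z w x y : R[i]) (s u : sphere R).

Local Notation f := (gmap p t a d).
Local Notation Y := (outer_radius t).
Local Notation K := (trapped p t a d).

Let p0 : 0 <= p. Proof. exact: le_trans tp. Qed.
Let t1 : t < 1. Proof. exact: le_lt_trans p1. Qed.
Let Y1 : 1 < Y := outer_radius_gt1 t0 tp p1.
Let Y0 : 0 < Y. Proof. exact: lt_trans Y1. Qed.
Let cf : continuous f := gmap_continuous p0 p1 t0 t1 aE dE.

Lemma attracted_infty : attracted f (sinv (Some t%:C)) None.
Proof.
have := (outer_disc t0 tp p1 aE dE (_ : nc 0 < Y^-1)).1.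
by rewrite Normc.normc0 invr_gt0 /= eqxx; apply.
Qed.

Lemma untrapped_attracted s : ~ K s ->
  attracted f (Some p%:C) s \/ attracted f (sinv (Some t%:C)) s.
Proof.
move=> nK; have [n nKn] : exists n, ~ exists2 z, iter n f s = Some z & annulus t z.
  by apply: contrapT => H; apply: nK => n; apply: contrapT => Hn; apply: H; exists n.
have back b : basin f b (iter n f s) -> basin f b s.
  by elim: n {nKn} => //= n IH H; apply: IH; exact: basin_preimage H.
case E : (iter n f s) nKn back => [z|] nKn back; last by right; apply: back; exact: attracted_infty.
have [z1|z1] := ltP (nc z) 1.
  by left; apply: back; have [] := inner_disc t0 tp p1 aE dE z1.
have [zY|zY] := ltP Y (nc z); last by case: nKn; exists z.
right; apply: back; have [v -> /(outer_disc t0 tp p1 aE dE)[]] := sinv_outer t0 tp p1 zY.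
by [].
Qed.

Lemma fixed_points_neq : Some p%:C != sinv (Some t%:C) :> sphere R.
Proof.
apply/eqP; rewrite /=; case: eqVneq => // tn /Some_inj E.
have : p%:C * t%:C = 1 :> R[i] by rewrite E mulVf.
rewrite -rmorphM -(rmorph1 (@real_complex R)) => /(@complexI R) h.
have : p * t < 1 by rewrite mulr_ilt1.
by rewrite h ltxx.
Qed.

Lemma gmap_dichotomy : exists O,
  [/\ dichotomy f (Some p%:C) (sinv (Some t%:C)) K O & jordan_curve K].
Proof.
have [k ak kE] := invariant_curve t0 tp p1 aE dE.
(* t < r < 1/Y, so the disc of radius 1/r contains the annulus but not 1/t *)
pose r := (t + Y^-1) / 2.
have tY : t < Y^-1 by rewrite -[Y^-1]mul1r ltr_pdivlMr // (outer_radius_t t0 tp p1).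
have r0 : 0 < r by rewrite divr_gt0 // ltr_wpDl // invr_gt0.
have rY : Y < r^-1 by rewrite -[Y]invrK ltf_pV2 ?posrE ?invr_gt0 // /r; lra.
pose O : set (sphere R) := fun s =>
  if s is Some z then (1 + p) / 2 < nc z /\ nc z < r^-1 else False.
exists O; split; last exact: (trapped_jordan t0 tp p1 aE dE ak kE).
split.
- exact: cf.
- exact: untrapped_attracted.
- exact: trapped_gmap.
- by move=> s W; exact: (trapped_nowhere_dense t0 tp p1 aE dE ak kE).
- rewrite openE => -[z [h1 h2]|//].
  apply/nbhs_Some; exists (Num.min (nc z - (1 + p) / 2) (r^-1 - nc z)).
    by rewrite lt_min !subr_gt0 h1.
  move=> w; rewrite lt_min => /andP[e1 e2]; split.
    by have := nc_triangleB z w; rewrite nc_sub; lra.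
  by have := nc_triangleB w z; lra.
- move=> s Ks; have [z /= -> [z1 zY]] := Ks 0%N; split.
    by have := p1; lra.
  exact: le_lt_trans rY.
- exists [set s | if s is Some z then nc z < (1 + p) / 2 : Prop else False].
    apply/nbhs_Some; exists ((1 + p) / 2 - p); first by have := p1; lra.
    move=> w h /=; have := nc_triangleB w p%:C; rewrite nc_real ger0_norm //; lra.
  by case=> [z /= h [h' _]|//]; have := lt_trans h h'; rewrite ltxx.
exists [set s | if sinv s is Some z then nc z < r : Prop else False].
  apply: (@nbhs_sinv R (fun s => if s is Some z then nc z < r : Prop else False) (Some t%:C)).
  apply/nbhs_Some; exists (r - t); first by rewrite /r; lra.
  by move=> w h /=; have := nc_triangleB w t%:C; rewrite nc_real ger0_norm //; lra.
case=> [z|_ []]; rewrite /mkset /=; case: (eqVneq z 0) => // z0; rewrite ncV => h [_ h'].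
have z0' : 0 < nc z by rewrite nc_gt0.
by move: h; rewrite -[r]invrK ltf_pV2 ?posrE ?invr_gt0 // => h; have := lt_trans h h'; rewrite ltxx.
Qed.

Lemma gmap_basin_p_connected : connected (basin f (Some p%:C)).
Proof.
apply: (gmap_basin_connected p0 p1 t0 t1 aE dE (rho := 1)) => //.
  exact: (inner_disc t0 tp p1 aE dE).
by move=> H; have := basin_disjoint fixed_points_neq H; apply; exact: attracted_infty.
Qed.

Lemma gmap_basin_t_connected : connected (basin f (sinv (Some t%:C))).
Proof.
rewrite (gmap_sinv_conj t0 tp p1 aE dE).
apply: connected_basin_conj; try exact: sinvK; try exact: sinv_continuous.
have aE' : d = 1 + p + t * p by rewrite dE [t * p]mulrC.
have dE' : a = 1 + t + t * p by rewrite aE [t * p]mulrC.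
apply: (gmap_basin_connected t0 t1 p0 p1 aE' dE' (rho := Y^-1)).
- exact: (outer_disc_swap t0 tp p1 aE dE).
- by rewrite -[Y^-1]mul1r ltr_pdivlMr // (outer_radius_t t0 tp p1).
move=> /(attracted_conj (@sinvK R) (@sinvK R) (@sinv_continuous R) (@sinv_continuous R)).
rewrite -(gmap_sinv_conj t0 tp p1 aE dE) /= => H.
have n0 : nc (0 : R[i]) < 1 by rewrite Normc.normc0.
exact: (basin_disjoint fixed_points_neq (inner_disc t0 tp p1 aE dE n0).1 H).
Qed.

End TwoBasins.

(** * Newton maps with two attracting fixed points *)

Section NormalFormAttracting.
Context {R : realType}.
Variables p t a d : R.
Hypotheses (p0 : 0 <= p) (p1 : p < 1) (t0 : 0 <= t) (t1 : t < 1).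
Hypotheses (aE : a = 1 + t + p * t) (dE : d = 1 + p + p * t).

(** In the coordinate (z - p)/(1 - t z) the map fixes 0 and is divisible by
    the coordinate. *)
Lemma gmap_linearly_attracting : linearly_attracting (gmap p t a d) (Some p%:C).
Proof.
have pt1 : p * t < 1 := pt_lt1 p0 p1 t0 t1.
have pt0 : 0 <= p * t := pt_ge0 p0 t0.
pose P : R[i] := p%:C; pose T : R[i] := t%:C.
have D : 1 * 1 - - P * - T != 0.
  rewrite mulr1 mulrNN /P /T -rmorphM -(rmorph1 (real_complex R)) -rmorphB.
  by rewrite (inj_eq (@complexI R)) gt_eqF // subr_gt0.
have Ka : a%:C = 1 + T + P * T by rewrite aE !(rmorphD, rmorphM) rmorph1.
have Kd : d%:C = 1 + P + P * T by rewrite dE !(rmorphD, rmorphM) rmorph1.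
pose nu (w : R[i]) := (1 + T) * (P *+ 2 + (1 + P * T) * w).
pose de (w : R[i]) := (1 + P) * (1 + P * T + T *+ 2 * w).
have de0 : de 0 != 0.
  rewrite /de mulr0 addr0 /P /T -(rmorph1 (real_complex R)) -rmorphM -!rmorphD -rmorphM.
  by rewrite (inj_eq (@complexI R)) gt_eqF // mulr_gt0 // ltr_wpDr.
have id0 := cvgC_id (0 : R[i]).
have cn : nu @ nbhs (0 : R[i]) --> nu 0.
  exact: (cvgCM (cvgC_cst _) (cvgCD (cvgC_cst _) (cvgCM (cvgC_cst _) id0))).
have cd : de @ nbhs (0 : R[i]) --> de 0.
  exact: (cvgCM (cvgC_cst _) (cvgCD (cvgC_cst _) (cvgCM (cvgC_cst _) id0))).
pose chi := mob 1 (- P) (- T) 1; pose chi' := mob 1 (- - P) (- - T) 1.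
have K1 : cancel chi chi' by exact: mobK D.
have K2 : cancel chi' chi by exact: mobVK D.
have Ppt : Some p%:C = pt P 1 :> sphere R by rewrite pt_Some ?oner_neq0 // divr1.
exists 1, (- P), (- T), 1, (chi \o gmap p t a d \o chi'), chi'.
exists (fun w => nu w / de w); split.
- exact: D.
- by split; [exact: K1|exact: K2].
- split; first by apply/funext => s /=; rewrite !K1.
  rewrite Ppt mob_pt /nonzero2 ?oner_neq0 ?orbT //.
  have -> : 1 * P + - P * 1 = 0 by ring.
  have -> : - T * P + 1 * 1 = 1 * 1 - - P * - T by ring.
  by rewrite pt_Some // mul0r.
- split; last exact: (cvgCM cn (cvgCV de0 cd)).
  have := cvgC_neq0 de0 cd; apply: filterS => w dw.
  have n1 : nonzero2 w 1 by rewrite /nonzero2 oner_neq0 orbT.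
  have D' : 1 * 1 - - - P * - - T != 0 by rewrite [- - P * _]mulrNN.
  have n2 := mob_nonzero D' n1.
  transitivity (chi (gmap p t a d (chi' (pt w 1)))).
    by rewrite (pt_Some _ (oner_neq0 _)) divr1.
  rewrite /chi' mob_pt // /gmap qmap_pt // /chi mob_pt; last first.
    rewrite !mul0r !addr0; apply: mob_nonzero; last by rewrite nonzero2_sq.
    exact: (detC p0 p1 t0 t1 aE dE).
  rewrite mulrA -pt_Some // -(pt_scale (w * nu w) (de w) D) Ka Kd -/P -/T /nu /de.
  by congr pt; ring.
rewrite /nu /de !mulr0 !addr0 /P /T -(rmorph1 (real_complex R)) -rmorphM -rmorphMn.
rewrite -!rmorphD -!rmorphM -fmorphV -rmorphM nc_real ger0_norm.
  rewrite ltr_pdivrMr ?mulr_gt0 ?ltr_wpDr // mul1r -subr_gt0.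
  have -> : (1 + p) * (1 + p * t) - (1 + t) * (p *+ 2) = (1 - p) * (1 - p * t) by ring.
  by rewrite mulr_gt0 // subr_gt0.
by rewrite divr_ge0 // mulr_ge0 ?addr_ge0 // mulrn_wge0.
Qed.

End NormalFormAttracting.

Section TwoBasinMaps.
Context {R : realType}.
Implicit Types (f g : sphere R -> sphere R) (K O : set (sphere R)).

Definition two_basin_map f : Prop := exists K O a b,
  [/\ dichotomy f a b K O, a != b & jordan_curve K] /\
  [/\ connected (basin f a), connected (basin f b), linearly_attracting f a
    & linearly_attracting f b].

Definition one_basin_map f : Prop := exists K O a,
  [/\ dichotomy f a a K O, totally_disconnected K, connected (basin f a)
    & linearly_attracting f a].

Lemma conformal_witness f g : conformally_conjugate f g -> exists (a b c d : R[i]) psi,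
  [/\ a * d - b * c != 0, cancel (mob a b c d) psi /\ cancel psi (mob a b c d),
      continuous (mob a b c d), continuous psi & f = mob a b c d \o g \o psi].
Proof.
move=> /conj_byP [a [b [c [d [D H]]]]].
exists a, b, c, d, (mob d (- b) (- c) a); split => //.
- by split; [exact: mobK|exact: mobVK].
- exact: mob_continuous.
- by apply: mob_continuous; rewrite (_ : _ - _ = a * d - b * c) //; ring.
by apply/funext => s /=; rewrite -H mobVK.
Qed.

Lemma two_basin_conj f g : conformally_conjugate f g -> two_basin_map g -> two_basin_map f.
Proof.
move=> /conformal_witness [a [b [c [d [psi [D [K1 K2] c1 c2 ->]]]]]].
move=> [K [U [x [y [[dKO xy jK] [cx cy lx ly]]]]]].
exists (psi @^-1` K), (psi @^-1` U), (mob a b c d x), (mob a b c d y); split.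
  split; [exact: dichotomy_conj|by rewrite (inj_eq (can_inj K1))|].
  exact: jordan_curve_image jK.
by split; [exact: connected_basin_conj|exact: connected_basin_conj|
  exact: linearly_attracting_conj|exact: linearly_attracting_conj].
Qed.

Lemma one_basin_conj f g : conformally_conjugate f g -> one_basin_map g -> one_basin_map f.
Proof.
move=> /conformal_witness [a [b [c [d [psi [D [K1 K2] c1 c2 ->]]]]]].
move=> [K [U [x [dKO tK cx lx]]]].
exists (psi @^-1` K), (psi @^-1` U), (mob a b c d x).
by split; [exact: dichotomy_conj|exact: totally_disconnected_image K1 K2 c2 tK|
  exact: connected_basin_conj|exact: linearly_attracting_conj].
Qed.

Lemma two_basin_fatou f : two_basin_map f ->
  (exists U V : set (sphere R), [/\ U <> V,
     completely_invariant_attracting_domain f U,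
     completely_invariant_attracting_domain f V & fatou_set f = U `|` V]) /\
  jordan_curve (julia_set f).
Proof.
move=> [K [U [x [y [[dKO xy jK] [cx cy lx ly]]]]]]; split; last by rewrite (dichotomy_julia dKO).
by apply: (dichotomy_two_basins dKO) => //; exact: linearly_attracting_fixed.
Qed.

Lemma one_basin_fatou f : one_basin_map f ->
  completely_invariant_attracting_domain f (fatou_set f) /\
  totally_disconnected (julia_set f).
Proof.
move=> [K [U [x [dKO tK cx lx]]]]; split; last by rewrite (dichotomy_julia dKO).
by apply: (dichotomy_one_basin dKO) => //; exact: linearly_attracting_fixed.
Qed.

Lemma gmap_two_basin (p t a d : R) : 0 <= t -> t <= p -> p < 1 ->
  a = 1 + t + p * t -> d = 1 + p + p * t -> two_basin_map (gmap p t a d).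
Proof.
move=> t0 tp p1 aE dE; have p0 := le_trans t0 tp; have t1 := le_lt_trans tp p1.
have [U [D J]] := gmap_dichotomy t0 tp p1 aE dE.
exists (trapped p t a d), U, (Some p%:C), (sinv (Some t%:C)); split; first split => //.
  exact: fixed_points_neq.
split.
- exact: gmap_basin_p_connected.
- exact: gmap_basin_t_connected.
- exact: gmap_linearly_attracting.
rewrite (gmap_sinv_conj t0 tp p1 aE dE).
have mE : mob 0 1 1 0 = @sinv R.
  apply/funext => s; have [x [y [n ->]]] := ptP s.
  by rewrite mob_pt // sinv_pt // !mul0r !mul1r add0r addr0.
have D1 : 0 * 0 - 1 * 1 != 0 :> R[i].
  by rewrite mul0r mul1r sub0r oppr_eq0 oner_neq0.
rewrite -{1 3}mE; apply: linearly_attracting_conj => //; rewrite ?mE; try exact: sinvK.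
by apply: gmap_linearly_attracting => //; rewrite ?aE ?dE mulrC.
Qed.

(** The conjugating Mobius map sends 0, 1 and oo to p, 1/t and 1; the constant
    k compares the homogeneous components of the two sides. *)
Lemma wmap_gmap (p t m n : R[i]) : 1 - p != 0 -> 1 - t != 0 -> 1 - p * t != 0 ->
  m != 0 -> n != 0 -> m + n - 1 != 0 ->
  m * ((1 - p) * (1 - p * t)) = (1 + p) * (1 + p * t) ->
  n * ((1 - t) * (1 - p * t)) = (1 + t) * (1 + p * t) ->
  conformally_conjugate (qmap (1 + t + p * t) 0 p t 0 (1 + p + p * t)) (wmap m n).
Proof.
move=> p1 t1 pt1 m0 n0 mn mE nE; apply/conj_byP.
exists (- (1 - p * t)), (p * (1 - t)), (- (1 - p * t)), (1 - t).
pose k := - ((1 - t) * (1 - p) * (1 - p * t)).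
have km : k * m = - ((1 - t) * ((1 + p) * (1 + p * t))) by rewrite -mE /k; ring.
have kn : k * n = - ((1 - p) * ((1 + t) * (1 + p * t))) by rewrite -nE /k; ring.
apply: (@conj_by_qmap R _ _ _ _ k).
- rewrite (_ : _ - _ = k); last by rewrite /k; ring.
  by rewrite oppr_eq0 !mulf_neq0.
- by rewrite oppr_eq0 !mulf_neq0.
- by move=> x y; exact: wmap_nonzero.
have main (u v x y : R[i]) : k * (u * ((m + n - 1) * x ^+ 2 + (1 - m) * x * y + 0 * y ^+ 2)
   + v * (0 * x ^+ 2 + (m + n) * x * y + - m * y ^+ 2)) =
   u * ((k * m + k * n - k) * x ^+ 2 + (k - k * m) * x * y)
   + v * ((k * m + k * n) * x * y - k * m * y ^+ 2) by ring.
by move=> x y /=; rewrite !main km kn /k; split; ring.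
Qed.

(** The two parameters are recovered from the weights d1 and d2: if P and T
    are the images of p and t under x |-> (1 + x)/(1 - x),
    then P T = d1 + d2 - 1 and P / T = d1 / d2. *)
Lemma normal_form_parameters (m n : R) : 1 <= n -> n <= m -> exists p t,
  [/\ 0 <= t, t <= p, p < 1,
  m * ((1 - p) * (1 - p * t)) = (1 + p) * (1 + p * t) &
  n * ((1 - t) * (1 - p * t)) = (1 + t) * (1 + p * t)].
Proof.
move=> n1 nm; have n0 : 0 < n by lra.
have m0 : 0 < m by lra.
have D0 : 0 < m + n - 1 by lra.
pose P := Num.sqrt ((m + n - 1) * m / n); pose T := Num.sqrt ((m + n - 1) * n / m).
have P0 : 0 < P by rewrite sqrtr_gt0 divr_gt0 ?mulr_gt0.
have T0 : 0 < T by rewrite sqrtr_gt0 divr_gt0 ?mulr_gt0.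
have P2 : P ^+ 2 = (m + n - 1) * m / n by rewrite sqr_sqrtr // ltW // divr_gt0 ?mulr_gt0.
have T2 : T ^+ 2 = (m + n - 1) * n / m by rewrite sqr_sqrtr // ltW // divr_gt0 ?mulr_gt0.
have PT : P * T = m + n - 1.
  apply/eqP; rewrite -(@eqrXn2 _ 2) ?(ltW D0) // ?mulr_ge0 ?(ltW P0) ?(ltW T0) //.
  by rewrite exprMn P2 T2; apply/eqP; field; rewrite !gt_eqF.
have PnTm : P * n = T * m.
  apply: (mulfI (lt0r_neq0 P0)); rewrite !mulrA PT -expr2 P2 divfK ?gt_eqF //.
have T1 : 1 <= T.
  rewrite -(@ler_pXn2r _ 2) ?nnegrE ?(ltW T0) // expr1n T2 ler_pdivlMr // mul1r.
  by nra.
have TP : T <= P by rewrite -(ler_pM2r n0) PnTm ler_pM2l.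
have P1' : 0 < P + 1 by lra.
have T1' : 0 < T + 1 by lra.
clearbody P T.
exists ((P - 1) / (P + 1)), ((T - 1) / (T + 1)); split.
- by rewrite divr_ge0 //; lra.
- by rewrite ler_pdivrMr // mulrAC ler_pdivlMr //; lra.
- by rewrite ltr_pdivrMr //; lra.
- have E : m * (P + T) = P * (P * T + 1) by rewrite PT; lra.
  have -> : m * ((1 - (P - 1) / (P + 1)) * (1 - (P - 1) / (P + 1) * ((T - 1) / (T + 1)))) =
     4 * (m * (P + T)) / ((P + 1) ^+ 2 * (T + 1)) by field; rewrite !gt_eqF.
  by rewrite E; field; rewrite !gt_eqF.
have E : n * (P + T) = T * (P * T + 1) by rewrite PT; lra.
have -> : n * ((1 - (T - 1) / (T + 1)) * (1 - (P - 1) / (P + 1) * ((T - 1) / (T + 1)))) =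
   4 * (n * (P + T)) / ((T + 1) ^+ 2 * (P + 1)) by field; rewrite !gt_eqF.
by rewrite E; field; rewrite !gt_eqF.
Qed.

Lemma newton1_two_basin (d1 d2 : nat) : (0 < d1)%N -> (0 < d2)%N ->
  two_basin_map (rmap (newton1 d1 d2) : sphere R -> sphere R).
Proof.
wlog le21 : d1 d2 / (d2 <= d1)%N => [H|] d10 d20.
  have [h|/ltnW h] := leqP d2 d1; first exact: H.
  have [m0 n0 _ mn] := natr_weights (R := R) d10 d20.
  rewrite rmap_newton1 //; apply: two_basin_conj (wmap_swap m0 n0 mn) _.
  by rewrite -rmap_newton1 //; exact: H.
have [m0 n0 _ mn] := natr_weights (R := R) d10 d20.
have [||p [t [t0 tp p1 mE nE]]] := @normal_form_parameters d1%:R d2%:R.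
- by rewrite ler1n.
- by rewrite ler_nat.
have p0 := le_trans t0 tp; have t1 := le_lt_trans tp p1.
have toC (x y : R) : x = y -> x%:C = y%:C :> R[i] by move=> ->.
have nz (x : R) : x < 1 -> 1 - x%:C != 0 :> R[i].
  by move=> x1; rewrite -(rmorph1 (real_complex R)) -rmorphB (inj_eq (@complexI R)) gt_eqF // subr_gt0.
rewrite rmap_newton1 //; apply: (@two_basin_conj _ (gmap p t (1 + t + p * t) (1 + p + p * t)));
  last exact: gmap_two_basin.
apply: conj_sym; rewrite /gmap !(rmorphD, rmorphM) rmorph1 rmorph0.
apply: wmap_gmap => //; try exact: nz.
- by rewrite -rmorphM; apply: nz; rewrite mulr_ilt1.
- by have := toC _ _ mE; rewrite !(rmorphD, rmorphM, rmorphN, rmorphB) rmorph_nat rmorph1.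
- by have := toC _ _ nE; rewrite !(rmorphD, rmorphM, rmorphN, rmorphB) rmorph_nat rmorph1.
Qed.

Lemma newton2_one_basin (e1 e2 : nat) : (0 < e1)%N -> (0 < e2)%N ->
  one_basin_map (rmap (newton2 e1 e2) : sphere R -> sphere R).
Proof.
move=> e10 e20; have a0 : 0 < e1%:R :> R by rewrite ltr0n.
have b0 : 0 < e2%:R :> R by rewrite ltr0n.
pose E : R := e1%:R + e2%:R; have EE : E = e1%:R + e2%:R by [].
have -> : rmap (newton2 e1 e2) = cmap e1%:R E :> (sphere R -> sphere R).
  rewrite rmap_newton2 //; apply/funext => s; have [x [y [n ->]]] := ptP s.
  rewrite /wmap /cmap !qmap_pt // EE rmorphD !rmorph_nat.
  have n1 : -1 != 0 :> R[i] by rewrite oppr_eq0 oner_neq0.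
  by rewrite -[RHS](pt_scale _ _ n1); congr pt; ring.
exists (cantor e1%:R E), (@disc2 R), None; split.
- exact: cantor_dichotomy a0 b0 EE.
- exact: cantor_totally_disconnected a0 b0 EE.
- exact: cantor_basin_connected a0 b0 EE.
- exact: cmap_linearly_attracting a0 b0 EE.
Qed.

End TwoBasinMaps.

Theorem theorem1p1 (R : realType) (r : ratfun R) :
  rdegree (newton r) = 2%N ->
  let N := rmap (newton r) in
  [/\ (exists d1 d2 : nat, [/\ (0 < d1)%N, (0 < d2)%N
         & conformally_conjugate N (rmap (newton1 d1 d2))]) \/
      (exists e1 e2 : nat, [/\ (0 < e1)%N, (0 < e2)%N
         & conformally_conjugate N (rmap (newton2 e1 e2))]),
      (forall d1 d2 : nat, (0 < d1)%N -> (0 < d2)%N ->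
         conformally_conjugate N (rmap (newton1 d1 d2)) ->
         (exists U V : set (sphere R),
            [/\ U <> V,
                completely_invariant_attracting_domain N U,
                completely_invariant_attracting_domain N V
              & fatou_set N = (U `|` V)%classic]) /\
         jordan_curve (julia_set N)),
      (forall e1 e2 : nat, (0 < e1)%N -> (0 < e2)%N ->
         conformally_conjugate N (rmap (newton2 e1 e2)) ->
         completely_invariant_attracting_domain N (fatou_set N) /\
         totally_disconnected (julia_set N))
    & jordan_curve (julia_set N) \/ totally_disconnected (julia_set N)].
Proof.
move=> deg2 N.
have J d1 d2 : (0 < d1)%N -> (0 < d2)%N ->
    conformally_conjugate N (rmap (newton1 d1 d2)) -> two_basin_map N.
  by move=> d10 d20 H; apply: two_basin_conj H _; exact: newton1_two_basin.
have D e1 e2 : (0 < e1)%N -> (0 < e2)%N ->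
    conformally_conjugate N (rmap (newton2 e1 e2)) -> one_basin_map N.
  by move=> e10 e20 H; apply: one_basin_conj H _; exact: newton2_one_basin.
have C := newton_classification deg2; split => //.
- by move=> d1 d2 d10 d20 /(J _ _ d10 d20) /two_basin_fatou.
- by move=> e1 e2 e10 e20 /(D _ _ e10 e20) /one_basin_fatou.
case: C => [[d1 [d2 [d10 d20 H]]]|[e1 [e2 [e10 e20 H]]]].
  by left; have [] := two_basin_fatou (J _ _ d10 d20 H).
by right; have [] := one_basin_fatou (D _ _ e10 e20 H).
Qed.
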